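(* Let $k$ be a field of characteristic two, let $G=\mathrm{SL}_2$ over $k$, let $T\subset G$ be the diagonal torus and let $N$ be the normalizer of $T$ in $G$. Then $H^i(G,k[G/N])\cong k$ for all $i\ge 0$. More specifically, let $f:k\hookrightarrow k[G/N]$ be the inclusion of the constants, and let $\mathcal E$ be the extension of rational $G$-modules $$\mathcal E:\quad 0\to k[G/N]\to k[G/T]\to k[G/N]\to 0$$ described in the context; then for every $i\ge 1$ the one-dimensional $k$-vector space $H^i(G,k[G/N])=\mathrm{Ext}^i_G(k,k[G/N])$ is spanned by the Yoneda product of $f$ and $i$ copies of $\mathcal E$. Consequently $H^*(G,k[G/N])$ is a polynomial ring over $k$ in one variable of degree one.
   Context: $G=\mathrm{SL}_2$ is regarded as an affine algebraic group scheme over $k$, with $k[G]=k[a,b,c,d]/(ad-bc-1)$, where $\begin{pmatrix}a&b\\c&d\end{pmatrix}$ is the general matrix in $G$. The diagonal subgroup is $T$, and $N=T\cup\sigma T$ with $\sigma=\begin{pmatrix}0&1\\1&0\end{pmatrix}$ (which has determinant $-1=1$ in characteristic two). For a closed subgroup $H\subset G$, $k[G/H]$ is the ring of regular functions on $G$ invariant under right translation by $H$, viewed as a rational $G$-module through left translation, i.e. $(g\cdot f)(x)=f(g^{-1}x)$. The ring $k[G/T]$ is a free $k[G/N]$-module with basis $1,\ ad$, and the class of $ad$ in $k[G/T]/k[G/N]$ is $G$-invariant, so $k[G/T]/k[G/N]$ is a free $k[G/N]$-module on this class; the extension $\mathcal E$ consists of the inclusion $k[G/N]\hookrightarrow k[G/T]$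 followed by the resulting $G$-equivariant map $k[G/T]\to k[G/N]$, $x+y\cdot ad\mapsto y$ for $x,y\in k[G/N]$. $H^i(G,M)=\mathrm{Ext}^i_G(k,M)$ denotes rational cohomology, i.e. the $i$-th right derived functor of $M\mapsto M^G$ on rational $G$-modules. The ring structure on $H^*(G,k[G/N])$ is the cup product induced by the multiplication of the $k$-algebra $k[G/N]$, on which $G$ acts by algebra automorphisms. *)

(* Defs.v *)
From HB Require Import structures.
From mathcomp Require Import all_boot all_order all_algebra.
From mathcomp Require Import ring_quotient boolp classical_sets mpoly.

Set Implicit Arguments.
Unset Strict Implicit.
Unset Printing Implicit Defensive.

Import GRing.Theory.
Local Open Scope ring_scope.
Local Open Scope quotient_scope.

Definition mklin (k : pzRingType) (U V : lmodType k) (f : U -> V)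
    (lf : linear f) : {linear U -> V} :=
  HB.pack f (GRing.isLinear.Build k U V *:%R f lf).

Section LinearFacts.
Variables (k : pzRingType) (U V : lmodType k) (f : U -> V) (lf : linear f).
Lemma lin0 : f 0 = 0. Proof. exact: (linear0 (mklin lf)). Qed.
Lemma linD x y : f (x + y) = f x + f y. Proof. exact: (linearD (mklin lf)). Qed.
Lemma linB x y : f (x - y) = f x - f y. Proof. exact: (linearB (mklin lf)). Qed.
Lemma linZ a x : f (a *: x) = a *: f x. Proof. exact: (linearZZ (mklin lf)). Qed.
Lemma lin_sum I (r : seq I) (F : I -> U) :
  f (\sum_(i <- r) F i) = \sum_(i <- r) f (F i).
Proof. exact: (linear_sum (mklin lf)). Qed.
End LinearFacts.

Section Subspaces.
Variables (k : fieldType) (V : lmodType k).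

Definition is_subspace (S : V -> Prop) : Prop :=
  S 0 /\ forall (a : k) (x y : V), S x -> S y -> S (a *: x + y).

Record subspace := Subspace {
  subspace_set :> V -> Prop;
  subspaceP : is_subspace subspace_set }.

Definition subspace_pred (S : subspace) : {pred V} := fun x => `[< S x >].

Lemma subspace_submod (S : subspace) : submod_closed (subspace_pred S).
Proof.
have [S0 Sl] := subspaceP S.
split; first exact/asboolP.
by move=> a u v /asboolP Su /asboolP Sv; apply/asboolP; exact: Sl.
Qed.

Definition sub_space (S : subspace) : Type := {x : V | subspace_pred S x}.

HB.instance Definition _ (S : subspace) := SubChoice.on (sub_space S).
HB.instance Definition _ (S : subspace) :=
  GRing.SubChoice_isSubLmodule.Build k V (subspace_pred S) (sub_space S)
    (subspace_submod S).

Definition to_sub (S : subspace) (x : V) (Sx : S x) : sub_space S :=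
  exist _ x (introT (asboolP _) Sx).

Lemma sub_spaceP (S : subspace) (x : sub_space S) : S (val x).
Proof. exact/asboolP/(valP x). Qed.

Lemma subspaceD (S : subspace) x y : S x -> S y -> S (x + y).
Proof. by move=> Sx Sy; rewrite -[x]scale1r; apply: (subspaceP S).2. Qed.
Lemma subspace0 (S : subspace) : S 0. Proof. exact: (subspaceP S).1. Qed.
Lemma subspaceZ (S : subspace) a x : S x -> S (a *: x).
Proof. by move=> Sx; rewrite -[_ *: _]addr0; apply: (subspaceP S).2 => //; exact: subspace0. Qed.
Lemma subspaceN (S : subspace) x : S x -> S (- x).
Proof. by rewrite -scaleN1r; apply: subspaceZ. Qed.
Lemma subspaceB (S : subspace) x y : S x -> S y -> S (x - y).
Proof. by move=> Sx Sy; apply: subspaceD => //; apply: subspaceN. Qed.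
Lemma subspace_sum (S : subspace) I (r : seq I) (F : I -> V) :
  (forall i, S (F i)) -> S (\sum_(i <- r) F i).
Proof.
by move=> SF; elim/big_ind: _ => // [|x y]; [apply: subspace0 | apply: subspaceD].
Qed.

Section Quotient.
Variable S : subspace.
Definition quot_equiv (x y : V) : bool := `[< S (x - y) >].

Lemma quot_equiv_refl : reflexive quot_equiv.
Proof. by move=> x; apply/asboolP; rewrite subrr; apply: subspace0. Qed.
Lemma quot_equiv_sym x y : quot_equiv x y = quot_equiv y x.
Proof.
by apply/asboolP/asboolP => H; rewrite -opprB; apply: subspaceN.
Qed.
Lemma quot_equiv_trans : transitive quot_equiv.
Proof.
move=> y x z /asboolP H1 /asboolP H2; apply/asboolP.
by rewrite -[x - z](subrKA y); apply: subspaceD.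
Qed.
Canonical quot_equiv_rel :=
  EquivRel quot_equiv quot_equiv_refl quot_equiv_sym quot_equiv_trans.

Definition quot_space : Type := {eq_quot quot_equiv}.
HB.instance Definition _ := Choice.on quot_space.

Definition qclass (x : V) : quot_space := \pi_{eq_quot quot_equiv} x.
Definition qrepr (x : quot_space) : V := repr (x : {eq_quot quot_equiv}).

Lemma qreprK x : qclass (qrepr x) = x. Proof. exact: reprK. Qed.
Lemma qclassE x y : qclass x = qclass y <-> S (x - y).
Proof.
split=> [/eqP|H]; first by rewrite /qclass eqmodE => /asboolP.
by apply/eqP; rewrite /qclass eqmodE; apply/asboolP.
Qed.
Lemma qreprE x : S (qrepr (qclass x) - x).
Proof. by apply/qclassE; rewrite qreprK. Qed.

Let qadd x y := qclass (qrepr x + qrepr y).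
Let qopp x := qclass (- qrepr x).
Let qscale a x := qclass (a *: qrepr x).

Lemma qaddE x y : qadd (qclass x) (qclass y) = qclass (x + y).
Proof. by apply/qclassE; rewrite opprD addrACA; apply: subspaceD; exact: qreprE. Qed.
Lemma qoppE x : qopp (qclass x) = qclass (- x).
Proof. by apply/qclassE; rewrite -opprD; apply: subspaceN; exact: qreprE. Qed.
Lemma qscaleE a x : qscale a (qclass x) = qclass (a *: x).
Proof. by apply/qclassE; rewrite -scalerBr; apply: subspaceZ; exact: qreprE. Qed.
Lemma qind (P : quot_space -> Prop) : (forall x, P (qclass x)) -> forall x, P x.
Proof. by move=> H x; rewrite -[x]qreprK. Qed.

Lemma qaddA : associative qadd.
Proof. by do 3![elim/qind => ?]; rewrite !qaddE addrA. Qed.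
Lemma qaddC : commutative qadd.
Proof. by do 2![elim/qind => ?]; rewrite !qaddE addrC. Qed.
Lemma qadd0 : left_id (qclass 0) qadd.
Proof. by elim/qind => ?; rewrite !qaddE add0r. Qed.
Lemma qaddN : left_inverse (qclass 0) qopp qadd.
Proof. by elim/qind => ?; rewrite qoppE !qaddE addNr. Qed.
HB.instance Definition _ :=
  GRing.isZmodule.Build quot_space qaddA qaddC qadd0 qaddN.
Lemma qscaleA a b v : qscale a (qscale b v) = qscale (a * b) v.
Proof. by elim/qind: v => v; rewrite !qscaleE scalerA. Qed.
Lemma qscale1 : left_id 1 qscale.
Proof. by elim/qind => ?; rewrite qscaleE scale1r. Qed.
Lemma qscaleDr : right_distributive qscale +%R.
Proof.
by move=> a; do 2![elim/qind => ?]; rewrite [_ + _]qaddE !qscaleE [RHS]qaddE scalerDr.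
Qed.
Lemma qscaleDl v : {morph qscale^~ v: a b / a + b}.
Proof. by elim/qind: v => v a b; rewrite !qscaleE [RHS]qaddE scalerDl. Qed.
HB.instance Definition _ :=
  GRing.Zmodule_isLmodule.Build k quot_space qscaleA qscale1 qscaleDr qscaleDl.

Lemma qclass_linear : linear qclass.
Proof. by move=> a x y; rewrite [a *: qclass x]qscaleE [RHS]qaddE. Qed.
End Quotient.

Lemma exists_projection (S C0 : subspace) :
  (forall x, S x -> C0 x -> x = 0) ->
  exists p : {linear V -> V}, [/\ forall x, S (p x), forall x, S x -> p x = x
    & forall x, C0 x -> p x = 0].
Proof.
move=> SC0.
pose U (A : set V) x := C0 x \/ A x.
pose P (A : set V) := is_subspace (U A) /\ forall x, S x -> U A x -> x = 0.
have [F FP Ftot|A [[Asub AS] Amax]] := @Zorn_bigcup V P.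
  have Upair x y : U (\bigcup_(X in F) X)%classic x ->
      U (\bigcup_(X in F) X)%classic y -> (C0 x /\ C0 y) \/
      exists2 X, F X & U X x /\ U X y.
    move=> [Cx|[X FX Xx]] [Cy|[Y FY Yy]]; first by left.
    - by right; exists Y => //; split; [left|right].
    - by right; exists X => //; split; [right|left].
    - right; have [XY|YX] := Ftot _ _ FX FY.
        by exists Y => //; split; right => //; apply: XY.
      by exists X => //; split; right => //; apply: YX.
  have Uin X x : F X -> U X x -> U (\bigcup_(X in F) X)%classic x.
    by move=> FX [|Xx]; [left|right; exists X].
  split; first split; first by left; apply: subspace0.
    move=> a x y Ux Uy; have [[Cx Cy]|[X FX [Xx Xy]]] := Upair _ _ Ux Uy.
      by left; apply: (subspaceP C0).2.
    by apply: (Uin X) => //; apply: (FP _ FX).1.2.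
  move=> x Sx Ux; have [[Cx _]|[X FX [Xx _]]] := Upair _ _ Ux Ux.
    exact: SC0.
  exact: (FP _ FX).2 Xx.
pose C := Subspace Asub.
have Cmax w : exists s c, [/\ S s, C c & w = s + c].
  have [Cw|nCw] := pselect (C w).
    by exists 0, w; rewrite add0r; split=> //; apply: subspace0.
  pose B : set V := fun x => exists c a, C c /\ x = c + a *: w.
  have BC x : C x -> B x by move=> Cx; exists x, 0; rewrite scale0r addr0.
  have UB x : U B x <-> B x.
    by split=> [[C0x|//]|]; [apply: BC; left | right].
  have subB : is_subspace (U B).
    split; first by apply/UB/BC/(subspace0 C).
    move=> e x y /UB[c [a [Cc ->]]] /UB[c' [a' [Cc' ->]]]; apply/UB.
    exists (e *: c + c'), (e * a + a'); split; first exact: (subspaceP C).2.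
    by rewrite scalerDr scalerDl scalerA addrACA.
  have nP : ~ P B.
    apply: Amax; split; first by move=> x Ax; apply: BC; right.
    move=> BA; apply: nCw; right; apply: BA; exists 0, 1.
    by rewrite scale1r add0r; split=> //; apply: (subspace0 C).
  have [s [Ss Bs s0]] : exists s, [/\ S s, B s & s <> 0].
    apply: contrapT => H; apply: nP; split=> // x Sx /UB Bx.
    by apply: contrapT => x0; apply: H; exists x.
  case: Bs => c [a [Cc Es]].
  have a0 : a != 0.
    apply/eqP => a0; apply: s0; apply: AS => //.
    by rewrite Es a0 scale0r addr0.
  exists (a^-1 *: s), (- (a^-1 *: c)); split.
  - exact: subspaceZ.
  - by apply/(subspaceN (S := C))/(subspaceZ (S := C)).
  - by rewrite -scalerBr Es addrAC subrr add0r scalerA mulVf // scale1r.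
have Cuniq s c s' c' : S s -> C c -> S s' -> C c' -> s + c = s' + c' -> s = s'.
  move=> Ss Cc Ss' Cc' E; apply: subr0_eq; apply: AS; first exact: subspaceB.
  have -> : s - s' = c' - c.
    by apply/eqP; rewrite subr_eq addrAC eq_sym subr_eq addrC E addrC.
  exact: (subspaceB (S := C)).
pose p w := projT1 (cid (Cmax w)).
have pP w : exists c, [/\ S (p w), C c & w = p w + c].
  exact: projT2 (cid (Cmax w)).
have pE w s c : S s -> C c -> w = s + c -> p w = s.
  move=> Ss Cc E; have [c' [Sp Cc' E']] := pP w.
  by apply: (Cuniq _ c' _ c) => //; rewrite -E'.
have plin : linear p.
  move=> a x y; have [c [Sx Cc Ex]] := pP x; have [c' [Sy Cc' Ey]] := pP y.
  apply: (pE _ _ (a *: c + c')).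
  - exact: (subspaceP S).2.
  - exact: (subspaceP C).2.
  - by rewrite {1}Ex {1}Ey scalerDr addrACA.
exists (mklin plin); split=> x.
- by have [c []] := pP x.
- by move=> Sx; apply: (pE _ _ 0) => //; [exact: (subspace0 C)| rewrite addr0].
- by move=> Cx; apply: (pE _ _ x); [exact: subspace0| left| rewrite add0r].
Qed.

Lemma exists_functional (C : subspace) (v : V) : ~ C v ->
  exists phi : {linear V -> k^o}, phi v = 1 /\ forall x, C x -> phi x = 0.
Proof.
move=> nCv.
have v0 : v != 0 by apply/eqP => v0; apply: nCv; rewrite v0; apply: subspace0.
have Lsub : is_subspace (fun x => exists a, x = a *: v).
  split; first by exists 0; rewrite scale0r.
  by move=> a x y [b ->] [c ->]; exists (a * b + c); rewrite scalerDl scalerA.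
pose L := Subspace Lsub.
have [x [a ->] Ca|p [pL pid pC]] := @exists_projection L C.
  have [->|a0] := eqVneq a 0; first by rewrite scale0r.
  case: nCv; rewrite -[v]scale1r -(mulVf a0) -scalerA; exact: subspaceZ.
pose f x := projT1 (cid (pL x)).
have fE x : p x = f x *: v by exact: projT2 (cid (pL x)).
have finj a b : a *: v = b *: v -> a = b.
  move/eqP; rewrite -subr_eq0 -scalerBl scaler_eq0 (negbTE v0) orbF subr_eq0.
  by move/eqP.
have flin : linear (f : V -> k^o).
  move=> a x y; apply: finj; rewrite -fE linearP !fE.
  by rewrite [RHS]scalerDl -scalerA.
exists (mklin flin); split=> [|x Cx] /=.
  by apply: finj; rewrite -fE scale1r; apply: pid; exists 1; rewrite scale1r.
by apply: finj; rewrite -fE scale0r pC.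
Qed.

End Subspaces.

Section Tensor.
Variables (k : fieldType) (U V : lmodType k).

Definition bilin (W : lmodType k) (b : U -> V -> W) : Prop :=
  (forall v, linear (b^~ v)) /\ (forall u, linear (b u)).

Definition fsum (W : lmodType k) (b : U -> V -> W) (s : seq (U * V)) : W :=
  \sum_(x <- s) b x.1 x.2.

(* U (x) V: formal sums of pure tensors, two sums being identified when every bilinear
   map takes the same value on them *)
Definition tens_equiv (s t : seq (U * V)) : bool :=
  `[< forall (W : lmodType k) (b : U -> V -> W), bilin b -> fsum b s = fsum b t >].

Lemma tens_equiv_refl : reflexive tens_equiv.
Proof. by move=> s; apply/asboolP. Qed.
Lemma tens_equiv_sym s t : tens_equiv s t = tens_equiv t s.
Proof. by apply/asboolP/asboolP => H W b bb; rewrite H. Qed.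
Lemma tens_equiv_trans : transitive tens_equiv.
Proof.
by move=> t s r /asboolP H1 /asboolP H2; apply/asboolP => W b bb; rewrite H1 ?H2.
Qed.
Canonical tens_equiv_rel :=
  EquivRel tens_equiv tens_equiv_refl tens_equiv_sym tens_equiv_trans.

Definition tensor : Type := {eq_quot tens_equiv}.
HB.instance Definition _ := Choice.on tensor.

Let tcl (s : seq (U * V)) : tensor := \pi_{eq_quot tens_equiv} s.
Let trepr (t : tensor) : seq (U * V) := repr (t : {eq_quot tens_equiv}).

Definition pure (u : U) (v : V) : tensor := tcl [:: (u, v)].
Definition tlift (W : lmodType k) (b : U -> V -> W) (t : tensor) : W :=
  fsum b (trepr t).

Let tclP s t : tcl s = tcl t <->
  forall (W : lmodType k) (b : U -> V -> W), bilin b -> fsum b s = fsum b t.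
Proof.
split=> [/eqP|H]; first by rewrite /tcl eqmodE => /asboolP.
by apply/eqP; rewrite /tcl eqmodE; apply/asboolP.
Qed.
Let trK t : tcl (trepr t) = t. Proof. exact: reprK. Qed.
Let tliftE W b s : @bilin W b -> tlift b (tcl s) = fsum b s.
Proof. by move=> bb; apply/(tclP _ _).1 => //; rewrite trK. Qed.
Let fsum_cat W b s t : @fsum W b (s ++ t) = fsum b s + fsum b t.
Proof. by rewrite /fsum big_cat. Qed.

Let tscl (a : k) s := [seq (a *: x.1, x.2) | x : U * V <- s].
Let fsum_scl W b a s : @bilin W b -> fsum b (tscl a s) = a *: fsum b s.
Proof.
move=> [bl _]; rewrite /fsum big_map scaler_sumr; apply: eq_bigr => x _ /=.
exact: (linZ (bl x.2)).
Qed.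

Let tadd x y := tcl (trepr x ++ trepr y).
Let topp x := tcl (tscl (-1) (trepr x)).
Let tscale a x := tcl (tscl a (trepr x)).

Let taddE s t : tadd (tcl s) (tcl t) = tcl (s ++ t).
Proof.
apply/tclP => W b bb; rewrite !fsum_cat; congr (_ + _);
by apply/(tclP _ _).1 => //; rewrite trK.
Qed.
Let tscaleE a s : tscale a (tcl s) = tcl (tscl a s).
Proof.
apply/tclP => W b bb; rewrite !fsum_scl //; congr (_ *: _).
by apply/(tclP _ _).1 => //; rewrite trK.
Qed.
Let toppE s : topp (tcl s) = tcl (tscl (-1) s).
Proof. exact: tscaleE. Qed.
Let tind (P : tensor -> Prop) : (forall s, P (tcl s)) -> forall t, P t.
Proof. by move=> H t; rewrite -[t]trK. Qed.

Let taddA : associative tadd.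
Proof. by do 3![elim/tind => ?]; rewrite !taddE catA. Qed.
Let taddC : commutative tadd.
Proof.
do 2![elim/tind => ?]; rewrite !taddE; apply/tclP => W b bb.
by rewrite !fsum_cat addrC.
Qed.
Let tadd0 : left_id (tcl [::]) tadd.
Proof. by elim/tind => ?; rewrite !taddE. Qed.
Let taddN : left_inverse (tcl [::]) topp tadd.
Proof.
elim/tind => s; rewrite toppE taddE; apply/tclP => W b bb.
by rewrite fsum_cat fsum_scl // scaleN1r addNr /fsum big_nil.
Qed.
HB.instance Definition _ :=
  GRing.isZmodule.Build tensor taddA taddC tadd0 taddN.

Let tscaleA a b v : tscale a (tscale b v) = tscale (a * b) v.
Proof.
elim/tind: v => s; rewrite !tscaleE; apply/tclP => W c bc.
by rewrite !fsum_scl // scalerA.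
Qed.
Let tscale1 : left_id 1 tscale.
Proof.
elim/tind => s; rewrite !tscaleE; apply/tclP => W c bc.
by rewrite !fsum_scl // scale1r.
Qed.
Let tscaleDr : right_distributive tscale +%R.
Proof.
move=> a; elim/tind => s; elim/tind => t.
rewrite [_ + _]taddE !tscaleE [RHS]taddE; apply/tclP => W c bc.
by rewrite fsum_cat !fsum_scl // fsum_cat scalerDr.
Qed.
Let tscaleDl v : {morph tscale^~ v: a b / a + b}.
Proof.
elim/tind: v => s a b; rewrite !tscaleE [RHS]taddE; apply/tclP => W c bc.
by rewrite fsum_cat !fsum_scl // scalerDl.
Qed.
HB.instance Definition _ :=
  GRing.Zmodule_isLmodule.Build k tensor tscaleA tscale1 tscaleDr tscaleDl.

Lemma pure_bilin : bilin pure.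
Proof.
split=> [v a u u'|u a v v']; rewrite /= [a *: pure _ _]tscaleE [RHS]taddE;
  apply/tclP => W b [bl br]; rewrite /fsum big_cat /= !big_seq1 /=.
  by rewrite [LHS](bl v) (linZ (bl v)).
by rewrite [LHS](br u) (linZ (bl v)).
Qed.

Lemma tlift_linear W b : @bilin W b -> linear (tlift b).
Proof.
move=> bb a; elim/tind => s; elim/tind => t.
by rewrite [a *: _]tscaleE [_ + _]taddE !tliftE // fsum_cat fsum_scl.
Qed.

Lemma tlift_pure W b u v : @bilin W b -> tlift b (pure u v) = b u v.
Proof. by move=> bb; rewrite tliftE // /fsum big_seq1. Qed.

Lemma tensor_sum t : exists s : seq (U * V), t = \sum_(x <- s) pure x.1 x.2.
Proof.
elim/tind: t; elim=> [|[u v] s [s' E]]; first by exists [::]; rewrite big_nil.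
by exists ((u, v) :: s'); rewrite big_cons -E [RHS]taddE.
Qed.

Lemma tensor_ind (P : tensor -> Prop) :
  P 0 -> (forall t t', P t -> P t' -> P (t + t')) -> (forall u v, P (pure u v)) ->
  forall t, P t.
Proof.
move=> P0 PD Pp t; have [s ->] := tensor_sum t.
by elim/big_ind: _ => // x _.
Qed.

Lemma pure0r u : pure u 0 = 0. Proof. exact: (lin0 (pure_bilin.2 u)). Qed.
Lemma pure0l v : pure 0 v = 0.
Proof. exact: (lin0 (pure_bilin.1 v)). Qed.
Lemma pureDr u v v' : pure u (v + v') = pure u v + pure u v'.
Proof. exact: (linD (pure_bilin.2 u)). Qed.
Lemma pureDl u u' v : pure (u + u') v = pure u v + pure u' v.
Proof. exact: (linD (pure_bilin.1 v)). Qed.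
Lemma pureZr a u v : pure u (a *: v) = a *: pure u v.
Proof. exact: (linZ (pure_bilin.2 u)). Qed.
Lemma pureZl a u v : pure (a *: u) v = a *: pure u v.
Proof. exact: (linZ (pure_bilin.1 v)). Qed.
End Tensor.

Lemma tensor_ext (k : fieldType) (U V W : lmodType k) (f g : tensor U V -> W) :
  linear f -> linear g -> (forall u v, f (pure u v) = g (pure u v)) -> f =1 g.
Proof.
move=> lf lg E; apply: tensor_ind => //.
  by rewrite [LHS](lin0 lf) [RHS](lin0 lg).
move=> t t' Et Et'.
by rewrite [LHS](linD lf) [RHS](linD lg) /= Et Et'.
Qed.

Section TensorMaps.
Variable k : fieldType.

Definition tmap (U U' V V' : lmodType k) (f : U -> U') (g : V -> V') :
    tensor U V -> tensor U' V' :=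
  tlift (fun u v => pure (f u) (g v)).

Lemma tmap_bilin (U U' V V' : lmodType k) (f : U -> U') (g : V -> V') :
  linear f -> linear g -> bilin (fun u v => pure (f u) (g v)).
Proof.
move=> lf lg; split=> [v|u] a x y.
  by rewrite lf; apply: (pure_bilin _ _).1.
by rewrite lg; apply: (pure_bilin _ _).2.
Qed.

Lemma tmap_linear (U U' V V' : lmodType k) (f : U -> U') (g : V -> V') :
  linear f -> linear g -> linear (tmap f g).
Proof. by move=> lf lg; apply: tlift_linear; apply: tmap_bilin. Qed.

Lemma tmap_pure (U U' V V' : lmodType k) (f : U -> U') (g : V -> V') u v :
  linear f -> linear g -> tmap f g (pure u v) = pure (f u) (g v).
Proof. by move=> lf lg; rewrite /tmap tlift_pure //; apply: tmap_bilin. Qed.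

Lemma linear_id (U : lmodType k) : linear (@id U). Proof. by []. Qed.
Lemma linear_comp (U V W : lmodType k) (f : U -> V) (g : V -> W) :
  linear f -> linear g -> linear (g \o f).
Proof. by move=> lf lg a x y /=; rewrite lf lg. Qed.

Definition tbil (X Y Z A B C : lmodType k) (b : X -> Y -> Z) (c : A -> B -> C)
    (s : tensor X A) (t : tensor Y B) : tensor Z C :=
  tlift (fun x f => tlift (fun y g => pure (b x y) (c f g)) t) s.

Lemma tbil_bilin2 (X Y Z A B C : lmodType k) (b : X -> Y -> Z) (c : A -> B -> C) x f :
  bilin b -> bilin c -> bilin (fun y g => pure (b x y) (c f g)).
Proof.
by move=> bb bc; apply: tmap_bilin; [exact: bb.2|exact: bc.2].
Qed.

Lemma tbil_bilin1 (X Y Z A B C : lmodType k) (b : X -> Y -> Z) (c : A -> B -> C) t :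
  bilin b -> bilin c -> bilin (fun x f => tlift (fun y g => pure (b x y) (c f g)) t).
Proof.
move=> bb bc.
split=> [f|x] a u v; elim/tensor_ind: t => [|t t' E E'|y g].
- by rewrite !(lin0 (tlift_linear (tbil_bilin2 _ _ bb bc))) scaler0 addr0.
- rewrite !(linD (tlift_linear (tbil_bilin2 _ _ bb bc))) /= E E'.
  by rewrite scalerDr addrACA.
- by rewrite !tlift_pure ?bb.1 ?pureDl ?pureZl //; apply: tbil_bilin2.
- by rewrite !(lin0 (tlift_linear (tbil_bilin2 _ _ bb bc))) scaler0 addr0.
- rewrite !(linD (tlift_linear (tbil_bilin2 _ _ bb bc))) /= E E'.
  by rewrite scalerDr addrACA.
- by rewrite !tlift_pure ?bc.1 ?pureDr ?pureZr //; apply: tbil_bilin2.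
Qed.

Lemma tbil_pure (X Y Z A B C : lmodType k) (b : X -> Y -> Z) (c : A -> B -> C) x f y g :
  bilin b -> bilin c -> tbil b c (pure x f) (pure y g) = pure (b x y) (c f g).
Proof.
move=> bb bc; rewrite /tbil tlift_pure; last exact: tbil_bilin1.
by rewrite tlift_pure //; apply: tbil_bilin2.
Qed.

Lemma tbil_bilin (X Y Z A B C : lmodType k) (b : X -> Y -> Z) (c : A -> B -> C) :
  bilin b -> bilin c -> bilin (tbil b c).
Proof.
move=> bb bc; split=> [t|s]; first by apply: tlift_linear; apply: tbil_bilin1.
move=> a t t'; elim/tensor_ind: s => [|s s' E E'|x f].
- by rewrite /tbil !(lin0 (tlift_linear (tbil_bilin1 _ bb bc))) scaler0 addr0.
- rewrite /tbil !(linD (tlift_linear (tbil_bilin1 _ bb bc))) /=.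
  by rewrite -!/(tbil _ _ _ _) E E' scalerDr addrACA.
- rewrite /tbil !tlift_pure; try exact: tbil_bilin1.
  exact: (tlift_linear (tbil_bilin2 _ _ bb bc)).
Qed.

(* a tensor all of whose contractions against linear forms vanish is zero *)
Lemma tensor_separated (U V : lmodType k) (t : tensor U V) :
  (forall phi : {linear V -> k^o}, tlift (fun u v => phi v *: u) t = 0) -> t = 0.
Proof.
have cb (phi : {linear V -> k^o}) : bilin (fun (u : U) v => phi v *: u).
  split=> [v|u] a x y; first by rewrite scalerDr !scalerA mulrC.
  by rewrite linearP scalerDl scalerA.
have [s ->] := tensor_sum t; have [n] := ubnP (size s).
elim: n s => // n IH [|[u v] s]; first by rewrite big_nil.
rewrite ltnS => ns H.
have [[s' ss' Es']|nsp] := pselect (exists2 s' : seq (U * V), size s' = size s &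
  \sum_(x <- (u, v) :: s) pure x.1 x.2 = \sum_(x <- s') pure x.1 x.2).
  by rewrite Es'; apply: IH; rewrite ?ss' // => phi; rewrite -Es'.
pose C (x : V) := exists c : nat -> k,
  x = \sum_(i < size s) c i *: (nth (0, 0) s i).2.
have Csub : is_subspace C.
  split; first by exists (fun _ => 0); rewrite big1 // => i _; rewrite scale0r.
  move=> a _ _ [c ->] [d ->]; exists (fun i => a * c i + d i).
  rewrite scaler_sumr -big_split /=; apply: eq_bigr => i _.
  by rewrite scalerDl scalerA.
have iota_idx n' : index_iota 0 n' = iota 0 n' by rewrite /index_iota subn0.
have [[c Ec]|nC] := pselect (C v).
  case: nsp.
  exists [seq ((nth (0, 0) s i).1 + c i *: u, (nth (0, 0) s i).2) | i <- iota 0 (size s)].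
    by rewrite size_map size_iota.
  rewrite big_cons big_map /=.
  have -> : pure u v = \sum_(i <- iota 0 (size s)) pure (c i *: u) (nth (0, 0) s i).2.
    rewrite Ec (lin_sum ((pure_bilin _ _).2 u)) -iota_idx big_mkord.
    by apply: eq_bigr => i _; rewrite pureZr pureZl.
  have -> : \sum_(x <- s) pure x.1 x.2 =
      \sum_(i <- iota 0 (size s)) pure (nth (0, 0) s i).1 (nth (0, 0) s i).2.
    by rewrite -iota_idx (big_nth (0, 0)).
  by rewrite -big_split /=; apply: eq_bigr => i _; rewrite pureDl addrC.
have [phi [phiv phi0]] := @exists_functional k V (Subspace Csub) v nC.
have u0 : u = 0.
  have := H phi; rewrite big_cons.
  rewrite [LHS](linD (tlift_linear (cb phi))) /= tlift_pure //.
  rewrite phiv scale1r.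
  rewrite [X in _ + X](lin_sum (tlift_linear (cb phi))) /=.
  rewrite big_seq big1 ?addr0 // => x xs; rewrite tlift_pure // phi0 ?scale0r //.
  exists (fun i => (i == index x s)%:R).
  have xi : (index x s < size s)%N by rewrite index_mem.
  rewrite (bigD1 (Ordinal xi)) //= eqxx scale1r nth_index // big1 ?addr0 //.
  by move=> i ni; rewrite -[_ == index _ _]/(i == Ordinal xi) (negbTE ni) scale0r.
rewrite big_cons u0 /= pure0l add0r; apply: IH => // phi'.
by have := H phi'; rewrite big_cons u0 /= pure0l add0r.
Qed.

End TensorMaps.

Section TensorAlgebra.
Variables (k : fieldType) (A B : comAlgType k).

Lemma mul_bilin (C : comAlgType k) : bilin (@GRing.mul C).
Proof.
split=> x a u v /=; first by rewrite mulrDl scalerAl.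
by rewrite mulrDr scalerAr.
Qed.

Definition tmul : tensor A B -> tensor A B -> tensor A B := tbil *%R *%R.

Lemma tmul_bilin : bilin tmul.
Proof. by apply: tbil_bilin; apply: mul_bilin. Qed.
Lemma tmul_pure a b a' b' : tmul (pure a b) (pure a' b') = pure (a * a') (b * b').
Proof. by rewrite /tmul tbil_pure //; apply: mul_bilin. Qed.
Lemma tmulDl : left_distributive tmul +%R.
Proof. by move=> s t r; exact: (linD (tmul_bilin.1 r)). Qed.
Lemma tmulDr : right_distributive tmul +%R.
Proof. by move=> s t r; exact: (linD (tmul_bilin.2 s)). Qed.
Lemma tmulZl a s t : tmul (a *: s) t = a *: tmul s t.
Proof. exact: (linZ (tmul_bilin.1 t)). Qed.
Lemma tmul0l t : tmul 0 t = 0.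
Proof. exact: (lin0 (tmul_bilin.1 t)). Qed.
Lemma tmul0r t : tmul t 0 = 0.
Proof. exact: (lin0 (tmul_bilin.2 t)). Qed.

Lemma tmulC : commutative tmul.
Proof.
move=> s t; elim/tensor_ind: s => [|s s' E E'|a b].
- by rewrite tmul0l tmul0r.
- by rewrite tmulDl tmulDr E E'.
elim/tensor_ind: t => [|t t' E E'|a' b'].
- by rewrite tmul0l tmul0r.
- by rewrite tmulDl tmulDr E E'.
by rewrite !tmul_pure mulrC (mulrC b).
Qed.
Lemma tmulA : associative tmul.
Proof.
move=> s t r; elim/tensor_ind: s => [|s s' E E'|a b].
- by rewrite !tmul0l.
- by rewrite !tmulDl E E'.
elim/tensor_ind: t => [|t t' E E'|a' b'].
- by rewrite !(tmul0l, tmul0r).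
- by rewrite !(tmulDl, tmulDr) E E'.
elim/tensor_ind: r => [|r r' E E'|a'' b''].
- by rewrite !tmul0r.
- by rewrite !tmulDr E E'.
by rewrite !tmul_pure !mulrA.
Qed.
Lemma tmul1 : left_id (pure 1 1) tmul.
Proof.
move=> t; elim/tensor_ind: t => [|t t' E E'|a b]; first by rewrite tmul0r.
  by rewrite tmulDr E E'.
by rewrite tmul_pure !mul1r.
Qed.

Lemma one_functional (C : comAlgType k) : exists phi : {linear C -> k^o}, phi 1 = 1.
Proof.
have Zs : is_subspace (fun x : C => x = 0).
  by split=> // a x y -> ->; rewrite scaler0 addr0.
have [|phi [E _]] := @exists_functional k C (Subspace Zs) 1; last by exists phi.
by move/eqP; rewrite oner_eq0.
Qed.

Lemma tone_neq0 : pure (1 : A) (1 : B) != 0.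
Proof.
have [phi E] := one_functional A; have [psi E'] := one_functional B.
have bb : bilin (fun (a : A) (b : B) => (phi a * psi b : k^o)).
  split=> x a u v; rewrite linearP ?mulrDl ?mulrDr //=.
    by rewrite -mulrA.
  by rewrite mulrCA.
apply/eqP => /(congr1 (tlift (fun (a : A) (b : B) => (phi a * psi b : k^o)))).
rewrite [RHS](lin0 (tlift_linear bb)) tlift_pure // E E' mulr1.
by move/eqP; rewrite oner_eq0.
Qed.

HB.instance Definition _ := GRing.Zmodule_isComNzRing.Build (tensor A B)
  tmulA tmulC tmul1 tmulDl tone_neq0.
Lemma tscaleAl (a : k) (s t : tensor A B) : a *: (s * t) = a *: s * t.
Proof. by rewrite [RHS]tmulZl. Qed.
HB.instance Definition _ := GRing.Lmodule_isLalgebra.Build k (tensor A B) tscaleAl.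
HB.instance Definition _ := GRing.Lalgebra_isComAlgebra.Build k (tensor A B).

Lemma pureM (a a' : A) (b b' : B) : pure a b * pure a' b' = pure (a * a') (b * b').
Proof. exact: tmul_pure. Qed.
End TensorAlgebra.


Section AlgebraMaps.
Variables (k : fieldType) (A B C : comAlgType k).

Definition mkalg (A' B' : comAlgType k) (f : A' -> B') (lf : linear f)
    (f1 : f 1 = 1) (fM : {morph f : x y / x * y}) : {lrmorphism A' -> B'} :=
  HB.pack f (GRing.isLinear.Build k A' B' *:%R f lf)
    (GRing.isMonoidMorphism.Build A' B' f (f1, fM)).

Definition tinl (a : A) : tensor A B := pure a 1.
Definition tinr (b : B) : tensor A B := pure 1 b.

Lemma tinl_linear : linear tinl. Proof. exact: (pure_bilin _ _).1. Qed.
Lemma tinlM : {morph tinl : x y / x * y}.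
Proof. by move=> x y; rewrite [RHS]pureM mulr1. Qed.
Lemma tinr_linear : linear tinr. Proof. exact: (pure_bilin _ _).2. Qed.
Lemma tinrM : {morph tinr : x y / x * y}.
Proof. by move=> x y; rewrite [RHS]pureM mulr1. Qed.
Lemma tinl1 : tinl 1 = 1. Proof. by []. Qed.
Lemma tinr1 : tinr 1 = 1. Proof. by []. Qed.

HB.instance Definition _ :=
  GRing.isLinear.Build k A (tensor A B) *:%R tinl tinl_linear.
HB.instance Definition _ :=
  GRing.isMonoidMorphism.Build A (tensor A B) tinl (tinl1, tinlM).
HB.instance Definition _ :=
  GRing.isLinear.Build k B (tensor A B) *:%R tinr tinr_linear.
HB.instance Definition _ :=
  GRing.isMonoidMorphism.Build B (tensor A B) tinr (tinr1, tinrM).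

Lemma pure_tin a b : pure a b = tinl a * tinr b.
Proof. by rewrite pureM mulr1 mul1r. Qed.

Section Lift.
Variables (f : {lrmorphism A -> C}) (g : {lrmorphism B -> C}).
Definition tcopair : tensor A B -> C := tlift (fun a b => f a * g b).
Lemma tcopair_bilin : bilin (fun a b => f a * g b).
Proof.
split=> [b|a] c x y; first by rewrite linearP mulrDl scalerAl.
by rewrite linearP mulrDr scalerAr.
Qed.
Lemma tcopair_pure a b : tcopair (pure a b) = f a * g b.
Proof. by rewrite /tcopair tlift_pure //; apply: tcopair_bilin. Qed.
Lemma tcopair_linear : linear tcopair.
Proof. by apply: tlift_linear; apply: tcopair_bilin. Qed.
Lemma tcopair1 : tcopair 1 = 1.
Proof. by rewrite tcopair_pure !rmorph1 mulr1. Qed.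
Lemma tcopairM : {morph tcopair : s t / s * t}.
Proof.
move=> s t; elim/tensor_ind: s => [|s s' E E'|a b].
- by rewrite mul0r (lin0 tcopair_linear) mul0r.
- by rewrite mulrDl !(linD tcopair_linear) E E' mulrDl.
elim/tensor_ind: t => [|t t' E E'|a' b'].
- by rewrite mulr0 (lin0 tcopair_linear) mulr0.
- by rewrite mulrDr !(linD tcopair_linear) E E' mulrDr.
by rewrite pureM !tcopair_pure !rmorphM mulrACA.
Qed.
HB.instance Definition _ :=
  GRing.isLinear.Build k (tensor A B) C *:%R tcopair tcopair_linear.
HB.instance Definition _ :=
  GRing.isMonoidMorphism.Build (tensor A B) C tcopair (tcopair1, tcopairM).
Lemma tcopair_inl a : tcopair (tinl a) = f a.
Proof. by rewrite tcopair_pure rmorph1 mulr1. Qed.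
Lemma tcopair_inr b : tcopair (tinr b) = g b.
Proof. by rewrite tcopair_pure rmorph1 mul1r. Qed.
End Lift.
End AlgebraMaps.

Section CoordinateRing.
Variable k : fieldType.

(* k[G] is k[a,b,c,d]/(ad - bc - 1); the variables 'X_0, ..., 'X_3 are the entries
   a, b, c, d of the generic matrix, in row-major order *)
Definition gen_mx : 'M[{mpoly k[2 * 2]}]_2 := vec_mx (\row_i 'X_i).
Definition det_ideal : {pred {mpoly k[2 * 2]}} :=
  fun p => `[< exists q, p = q * (\det gen_mx - 1) >].

Definition peval (A : comAlgType k) (g : 'M[A]_2) (p : {mpoly k[2 * 2]}) : A :=
  mmap (in_alg A) (fun i => mxvec g 0 i) p.

Section Peval.
Variables (A : comAlgType k) (g : 'M[A]_2).
Lemma peval_linear : linear (peval g).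
Proof. by move=> a p q; rewrite /peval mmapD mmapZ mulr_algl. Qed.
Lemma pevalM : {morph peval g : p q / p * q}.
Proof. by move=> p q; rewrite /peval mmap_is_multiplicative. Qed.
Lemma peval1 : peval g 1 = 1.
Proof. by rewrite /peval rmorph1. Qed.
HB.instance Definition _ :=
  GRing.isLinear.Build k {mpoly k[2 * 2]} A *:%R (peval g) peval_linear.
HB.instance Definition _ :=
  GRing.isMonoidMorphism.Build {mpoly k[2 * 2]} A (peval g) (peval1, pevalM).
Lemma peval_gen : map_mx (peval g) gen_mx = g.
Proof.
apply/matrixP => i j; rewrite !mxE /peval mmapX mmap1U.
by rewrite mxvecE.
Qed.
Lemma peval_det : peval g (\det gen_mx - 1) = \det g - 1.
Proof. by rewrite rmorphB rmorph1 -det_map_mx peval_gen. Qed.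
End Peval.

Lemma det_ideal_closed : idealr_closed det_ideal.
Proof.
split.
- by apply/asboolP; exists 0; rewrite mul0r.
- apply/asboolP => -[q /(congr1 (peval (1%:M : 'M[k^o]_2)))].
  rewrite rmorphM /= peval_det det1 subrr mulr0 rmorph1.
  by move/eqP; rewrite oner_eq0.
- move=> a p q /asboolP[p' ->] /asboolP[q' ->]; apply/asboolP.
  by exists (a * p' + q'); rewrite mulrDl mulrA.
Qed.
HB.instance Definition _ := isIdealr.Build {mpoly k[2 * 2]} det_ideal det_ideal_closed.

Definition kG : Type := {ideal_quot det_ideal}.
HB.instance Definition _ := GRing.ComNzRing.on kG.

Definition kG_class (p : {mpoly k[2 * 2]}) : kG := \pi_{ideal_quot det_ideal} p.
Definition kG_repr (f : kG) : {mpoly k[2 * 2]} := repr (f : {ideal_quot det_ideal}).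

Lemma kG_reprK f : kG_class (kG_repr f) = f. Proof. exact: reprK. Qed.
Lemma kG_classE p q : kG_class p = kG_class q -> exists r, p - q = r * (\det gen_mx - 1).
Proof. by move/eqP; rewrite -Quotient.idealrBE => /asboolP. Qed.
Lemma kG_classD p q : kG_class (p + q) = kG_class p + kG_class q.
Proof. by rewrite /kG_class raddfD. Qed.
Lemma kG_classM p q : kG_class (p * q) = kG_class p * kG_class q.
Proof. by rewrite /kG_class rmorphM. Qed.
Lemma kG_class1 : kG_class 1 = 1.
Proof. by rewrite /kG_class rmorph1. Qed.
Lemma kG_ind (P : kG -> Prop) : (forall p, P (kG_class p)) -> forall f, P f.
Proof. by move=> H f; rewrite -[f]kG_reprK. Qed.

Definition kG_scale (a : k) (f : kG) : kG := kG_class a%:MP * f.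
Fact kG_scaleA a b f : kG_scale a (kG_scale b f) = kG_scale (a * b) f.
Proof. by rewrite /kG_scale mulrA -kG_classM mpolyCM. Qed.
Fact kG_scale1 : left_id 1 kG_scale.
Proof. by move=> f; rewrite /kG_scale mpolyC1 kG_class1 mul1r. Qed.
Fact kG_scaleDr : right_distributive kG_scale +%R.
Proof. by move=> a f g; rewrite /kG_scale mulrDr. Qed.
Fact kG_scaleDl f : {morph kG_scale^~ f : a b / a + b}.
Proof. by move=> a b; rewrite /kG_scale mpolyCD kG_classD mulrDl. Qed.
HB.instance Definition _ :=
  GRing.Zmodule_isLmodule.Build k kG kG_scaleA kG_scale1 kG_scaleDr kG_scaleDl.
Fact kG_scaleAl (a : k) (f g : kG) : a *: (f * g) = a *: f * g.
Proof. exact: mulrA. Qed.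
HB.instance Definition _ := GRing.Lmodule_isLalgebra.Build k kG kG_scaleAl.
HB.instance Definition _ := GRing.Lalgebra_isComAlgebra.Build k kG.

Lemma kG_classZ a p : kG_class (a *: p) = a *: kG_class p.
Proof. by rewrite -mul_mpolyC kG_classM. Qed.

Definition univ_mx : 'M[kG]_2 := map_mx kG_class gen_mx.

(* f(g) for g in SL_2(A); only meaningful when \det g = 1, since it evaluates a chosen
   representative of f *)
Definition ev (A : comAlgType k) (g : 'M[A]_2) (f : kG) : A := peval g (kG_repr f).

Lemma ev_class (A : comAlgType k) (g : 'M[A]_2) p :
  \det g = 1 -> ev g (kG_class p) = peval g p.
Proof.
move=> dg; have [r E] := kG_classE (kG_reprK (kG_class p)).
apply/eqP; rewrite -subr_eq0 -rmorphB E rmorphM /= peval_det dg subrr mulr0 //.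
Qed.

Section Ev.
Variables (A : comAlgType k) (g : 'M[A]_2) (dg : \det g = 1).
Lemma ev_linear : linear (ev g).
Proof.
move=> a; elim/kG_ind => p; elim/kG_ind => q.
by rewrite -kG_classZ -kG_classD !ev_class // linearP.
Qed.
Lemma evM : {morph ev g : f h / f * h}.
Proof.
by elim/kG_ind => p; elim/kG_ind => q; rewrite -kG_classM !ev_class // rmorphM.
Qed.
Lemma ev1 : ev g 1 = 1.
Proof. by rewrite -kG_class1 ev_class // rmorph1. Qed.
Definition ev_alg : {lrmorphism kG -> A} := mkalg ev_linear ev1 evM.
Lemma ev_univ : map_mx (ev g) univ_mx = g.
Proof.
rewrite -[RHS]peval_gen; apply/matrixP => i j.
by rewrite !mxE ev_class.
Qed.
End Ev.

Lemma ev_map (A B : comAlgType k) (phi : {lrmorphism A -> B}) (g : 'M[A]_2) f :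
  phi (ev g f) = ev (map_mx phi g) f.
Proof.
rewrite /ev; elim/mpolyind: (kG_repr f) => [|c m p _ _ E]; first by rewrite !rmorph0.
rewrite !peval_linear [LHS]linearP /= E; congr (_ *: _ + _).
rewrite /peval !mmapX /mmap1 rmorph_prod; apply: eq_bigr => i _.
by rewrite rmorphXn -map_mxvec mxE.
Qed.

Lemma det_univ : \det univ_mx = 1.
Proof.
have cM : {morph kG_class : x y / x * y} by exact: kG_classM.
have -> : \det univ_mx = kG_class (\det gen_mx).
  rewrite /determinant /kG_class rmorph_sum; apply: eq_bigr => s _.
  rewrite rmorphM rmorph_prod rmorphXn rmorphN1; congr (_ * _).
  by apply: eq_bigr => i _; rewrite mxE.
rewrite -kG_class1; apply/eqP; rewrite /kG_class -Quotient.idealrBE.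
by apply/asboolP; exists 1; rewrite mul1r.
Qed.

Lemma ev_id f : ev univ_mx f = f.
Proof.
elim/kG_ind: f => p; rewrite ev_class ?det_univ //.
elim/mpolyind: p => [|c m p _ _ E].
  by rewrite rmorph0 /kG_class rmorph0.
rewrite peval_linear E kG_classD kG_classZ; congr (_ *: _ + _).
rewrite /peval mmapX /mmap1 [in RHS](mpolyXE_id _ m) /kG_class rmorph_prod; apply: eq_bigr => i _.
rewrite rmorphXn; congr (_ ^+ _).
case/mxvec_indexP: i => a b; by rewrite mxvecE !mxE.
Qed.
End CoordinateRing.

Section RationalModules.
Variable k : fieldType.
Local Notation kG := (kG k).

Section Action.
Variables (M : lmodType k) (rho : M -> tensor M kG) (A : comAlgType k).

(* g.m in M (x) A, for g in SL_2(A) and m in M *)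
Definition act (g : 'M[A]_2) (m : M) : tensor M A := tmap id (ev g) (rho m).

(* the A-linear extension of act g to M (x) A *)
Definition act_ext (g : 'M[A]_2) : tensor M A -> tensor M A :=
  tlift (fun m a => tmap id ( *%R a) (act g m)).
End Action.

(* Rational G-modules: comodules over k[G].  The comodule axioms are stated as: the maps
   act_ext define, for every A, an action of the group SL_2(A) on M (x) A. *)
Record ratmod := RatMod {
  rm_sort :> lmodType k;
  coact : {linear rm_sort -> tensor rm_sort kG};
  act1 : forall (A : comAlgType k) (m : rm_sort),
    act coact (1%:M : 'M[A]_2) m = pure m 1;
  actM : forall (A : comAlgType k) (g h : 'M[A]_2) (m : rm_sort),
    \det g = 1 -> \det h = 1 ->
    act coact (g *m h) m = act_ext coact g (act coact h m) }.

Record hom (M N : ratmod) := Hom {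
  hom_fun :> {linear M -> N};
  homP : forall m, coact N (hom_fun m) = tmap hom_fun id (coact M m) }.

(* b induces a morphism of G-modules X (x) Y -> Z *)
Definition equivariant2 (X Y Z : ratmod) (b : X -> Y -> Z) : Prop :=
  forall x y, coact Z (b x y) = tbil b *%R (coact X x) (coact Y y).

Fact trivial_coact_linear : linear (fun c : k^o => pure c (1 : kG)).
Proof. exact: (pure_bilin _ _).1. Qed.

Definition trivial_coact : {linear k^o -> tensor k^o kG} := mklin trivial_coact_linear.

Fact trivial_actE (A : comAlgType k) (g : 'M[A]_2) (m : k^o) :
  \det g = 1 -> act trivial_coact g m = pure m 1.
Proof. by move=> dg; rewrite /act tmap_pure ?ev1 //; exact: ev_linear. Qed.

Fact mull_linear (A : comAlgType k) (a : A) : linear ( *%R a).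
Proof. exact: (mul_bilin A).2. Qed.

Fact act_ext_bilin (M : lmodType k) (rho : M -> tensor M kG) (A : comAlgType k)
    (g : 'M[A]_2) : linear rho -> \det g = 1 ->
  bilin (fun m a => tmap id ( *%R a) (act rho g m)).
Proof.
move=> lr dg; split=> [a|m].
  move=> c x y; rewrite /act lr.
  rewrite (tmap_linear (@linear_id _ _) (ev_linear dg)).
  by rewrite (tmap_linear (@linear_id _ _) (mull_linear a)).
move=> c a a'; elim/tensor_ind: (act rho g m) => [|t t' E E'|x y].
- by rewrite !(lin0 (tmap_linear (@linear_id _ _) (mull_linear _))) scaler0 addr0.
- rewrite !(linD (tmap_linear (@linear_id _ _) (mull_linear _))) E E'.
  by rewrite scalerDr addrACA.
- rewrite !tmap_pure; try exact: linear_id; try exact: mull_linear.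
  by rewrite mulrDl pureDr -scalerAl pureZr.
Qed.

Fact trivial_act1 (A : comAlgType k) (m : k^o) :
  act trivial_coact (1%:M : 'M[A]_2) m = pure m 1.
Proof. by apply: trivial_actE; rewrite det1. Qed.
Fact trivial_actM (A : comAlgType k) (g h : 'M[A]_2) (m : k^o) :
  \det g = 1 -> \det h = 1 ->
  act trivial_coact (g *m h) m = act_ext trivial_coact g (act trivial_coact h m).
Proof.
move=> dg dh; rewrite !trivial_actE ?det_mulmx ?dg ?dh ?mulr1 //.
rewrite /act_ext tlift_pure; last exact: (act_ext_bilin trivial_coact_linear).
rewrite trivial_actE // tmap_pure ?mulr1 //; exact: mull_linear.
Qed.

Definition trivial_mod : ratmod := RatMod trivial_act1 trivial_actM.

Definition is_subcomodule (M : ratmod) (S : subspace M) : Prop :=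
  forall m, S m -> exists t : tensor (sub_space S) kG, tmap val id t = coact M m.

Section Submodule.
Variables (M : ratmod) (S : subspace M) (stS : is_subcomodule S).
Local Notation W := (sub_space S).

Fact val_linear : linear (val : W -> M).
Proof. by move=> a x y; rewrite linearP. Qed.

Fact sub_retraction : exists r : {linear M -> W}, cancel val r.
Proof.
have Zs : is_subspace (fun x : M => x = 0).
  by split=> // a x y -> ->; rewrite scaler0 addr0.
have [//|p [pS pid _]] := @exists_projection k M S (Subspace Zs).
have pl : linear (fun x => to_sub (pS x)).
  by move=> a x y; apply: val_inj; rewrite /= linearP.
exists (mklin pl) => x; apply: val_inj; rewrite /= pid //; exact: sub_spaceP.
Qed.

Fact sub_tensor_inj (A : lmodType k) : injective (tmap val id : tensor W A -> tensor M A).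
Proof.
have [r rK] := sub_retraction.
have rl : linear r by exact: linearP.
have vl := val_linear; have il := @linear_id k A.
apply: (can_inj (g := tmap r id)); apply: tensor_ind.
- by rewrite (lin0 (tmap_linear vl il)) (lin0 (tmap_linear rl il)).
- by move=> t t' E E'; rewrite (linD (tmap_linear vl il)) (linD (tmap_linear rl il)) E E'.
- by move=> u v; rewrite !tmap_pure // rK.
Qed.

Definition sub_coact_fun (x : W) : tensor W kG := projT1 (cid (stS (sub_spaceP x))).
Fact sub_coactE x : tmap val id (sub_coact_fun x) = coact M (val x).
Proof. exact: projT2 (cid (stS (sub_spaceP x))). Qed.
Fact sub_coact_linear : linear sub_coact_fun.
Proof.
move=> a x y; apply: sub_tensor_inj.
rewrite (tmap_linear val_linear (@linear_id _ _)) !sub_coactE.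
by rewrite val_linear linearP.
Qed.
Definition sub_coact : {linear W -> tensor W kG} := mklin sub_coact_linear.

Fact sub_actE (A : comAlgType k) (g : 'M[A]_2) (x : W) : \det g = 1 ->
  tmap val id (act sub_coact g x) = act (coact M) g (val x).
Proof.
move=> dg; rewrite /act -[in RHS]sub_coactE.
have el := ev_linear dg; have vl := val_linear.
apply: (tensor_ext (f := tmap val id \o tmap id (ev g)) (g := tmap id (ev g) \o tmap val id)).
- by apply: linear_comp; apply: tmap_linear.
- by apply: linear_comp; apply: tmap_linear.
- by move=> u v; rewrite /= !tmap_pure.
Qed.

Fact sub_act1 (A : comAlgType k) (x : W) :
  act sub_coact (1%:M : 'M[A]_2) x = pure x 1.
Proof.
by apply: sub_tensor_inj; rewrite sub_actE ?det1 // act1 tmap_pure.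
Qed.
Fact sub_actM (A : comAlgType k) (g h : 'M[A]_2) (x : W) :
  \det g = 1 -> \det h = 1 ->
  act sub_coact (g *m h) x = act_ext sub_coact g (act sub_coact h x).
Proof.
move=> dg dh; apply: sub_tensor_inj.
rewrite sub_actE ?det_mulmx ?dg ?dh ?mulr1 // actM // -sub_actE //.
have vl := val_linear; have cl : linear (coact M) by exact: linearP.
have b1 := act_ext_bilin cl dg; have b2 := act_ext_bilin sub_coact_linear dg.
have e1 := tlift_linear b1; have e2 := tlift_linear b2.
apply: (tensor_ext (f := act_ext (coact M) g \o tmap val id)
  (g := tmap val id \o act_ext sub_coact g)).
- by apply: linear_comp => //; apply: tmap_linear.
- by apply: linear_comp => //; apply: tmap_linear.
move=> u a; rewrite /= tmap_pure // /act_ext !tlift_pure // -sub_actE //.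
have ml := mull_linear a.
apply: (tensor_ext (f := tmap id ( *%R a) \o tmap val id)
  (g := tmap val id \o tmap id ( *%R a))).
- by apply: linear_comp; apply: tmap_linear.
- by apply: linear_comp; apply: tmap_linear.
- by move=> w b; rewrite /= !tmap_pure.
Qed.

Definition sub_ratmod : ratmod := RatMod sub_act1 sub_actM.
End Submodule.

(* the left regular representation (g.f)(x) = f(g^-1 x): in k[G] (x) k[G] the first
   factor is the ring of functions of x and the second that of functions of g; the
   inverse of a matrix of determinant 1 is its adjugate *)
Definition lreg_coact_fun (f : kG) : tensor kG kG :=
  ev (map_mx (@tinr k kG kG) (\adj (univ_mx k)) *m map_mx (@tinl k kG kG) (univ_mx k)) f.

Fact det_adj2 (A : comAlgType k) (g : 'M[A]_2) : \det g = 1 -> \det (\adj g) = 1.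
Proof.
move=> dg; have := congr1 determinant (mul_mx_adj g).
by rewrite det_mulmx dg mul1r det1.
Qed.

Fact det_act (A B : comAlgType k) (g : 'M[A]_2) (h : 'M[B]_2) :
  \det g = 1 -> \det h = 1 ->
  \det (map_mx (@tinr k B A) (\adj g) *m map_mx (@tinl k B A) h) = 1.
Proof.
move=> dg dh; rewrite det_mulmx !det_map_mx det_adj2 // dh.
by rewrite !rmorph1 mulr1.
Qed.

Fact lreg_coact_linear : linear lreg_coact_fun.
Proof. by apply: ev_linear; apply: det_act; rewrite det_univ. Qed.
Definition lreg_coact : {linear kG -> tensor kG kG} := mklin lreg_coact_linear.

Section TmapAlg.
Variables (A A' B B' : comAlgType k) (f : {lrmorphism A -> A'}) (g : {lrmorphism B -> B'}).
Definition tmap_alg : {lrmorphism tensor A B -> tensor A' B'} :=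
  tcopair (@tinl k A' B' \o f) (@tinr k A' B' \o g).
Fact tmap_algE : tmap_alg =1 tmap f g.
Proof.
apply: tensor_ext; try exact: linearP.
  by apply: tmap_linear; exact: linearP.
move=> a b; rewrite [LHS]tcopair_pure tmap_pure; try exact: linearP.
by rewrite /= -pure_tin.
Qed.
End TmapAlg.

Fact eq_ev (A : comAlgType k) (g h : 'M[A]_2) (f : kG) : g = h -> ev g f = ev h f.
Proof. by move=> ->. Qed.

Fact lreg_actE (A : comAlgType k) (g : 'M[A]_2) (f : kG) : \det g = 1 ->
  act lreg_coact g f =
  ev (map_mx (@tinr k kG A) (\adj g) *m map_mx (@tinl k kG A) (univ_mx k)) f.
Proof.
move=> dg; rewrite /act -[X in tmap X]/(idfun : kG -> kG).
rewrite -[tmap _ _ _](tmap_algE (idfun : {lrmorphism kG -> kG}) (ev_alg dg)).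
apply: (etrans (ev_map _ _ _)); rewrite map_mxM -!map_mx_comp; apply: eq_ev; congr (_ *m _).
  transitivity (map_mx (@tinr k kG A) (map_mx (ev g) (\adj (univ_mx k)))).
    rewrite -map_mx_comp; apply/eq_map_mx => x /=.
    by rewrite tcopair_inr.
  by rewrite -[ev g]/(ev_alg dg : _ -> _) map_mx_adj /= (ev_univ dg).
by apply/eq_map_mx => x /=; rewrite tcopair_inl.
Qed.

Fact adjM2 (A : comAlgType k) (g h : 'M[A]_2) : \det g = 1 -> \det h = 1 ->
  \adj (g *m h) = \adj h *m \adj g.
Proof.
move=> dg dh.
have gK := mul_mx_adj (g *m h).
have dgh : \det (g *m h) = 1 by rewrite det_mulmx dg dh mulr1.
have -> : \adj (g *m h) = \adj h *m \adj g *m (g *m h) *m \adj (g *m h).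
  rewrite -!mulmxA [\adj g *m _]mulmxA mul_adj_mx dg mul1mx.
  by rewrite [\adj h *m _]mulmxA mul_adj_mx dh mul1mx.
by rewrite -mulmxA gK dgh mulmx1.
Qed.

Fact lreg_act1 (A : comAlgType k) (f : kG) :
  act lreg_coact (1%:M : 'M[A]_2) f = pure f 1.
Proof.
rewrite lreg_actE ?det1 //.
have -> : \adj (1%:M : 'M[A]_2) = 1%:M.
  by rewrite -[LHS]mulmx1 mul_adj_mx det1.
by rewrite map_scalar_mx rmorph1 mul1mx -ev_map ev_id.
Qed.
Fact lreg_actM (A : comAlgType k) (g h : 'M[A]_2) (f : kG) :
  \det g = 1 -> \det h = 1 ->
  act lreg_coact (g *m h) f = act_ext lreg_coact g (act lreg_coact h f).
Proof.
move=> dg dh.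
pose Eg := ev_alg (det_act dg (det_univ k)).
pose Phi : {lrmorphism tensor kG A -> tensor kG A} := tcopair Eg (@tinr k kG A).
have PhiE : act_ext lreg_coact g =1 Phi.
  apply: tensor_ext; last 1 first.
  - move=> u a; rewrite [RHS]tcopair_pure /act_ext tlift_pure; last first.
      exact: (act_ext_bilin lreg_coact_linear).
    rewrite lreg_actE // -[Eg u]/(ev _ u).
    elim/tensor_ind: (ev _ u) => [|t t' E E'|x y].
    + by rewrite mul0r (lin0 (tmap_linear (@linear_id _ _) (mull_linear _))).
    + rewrite (linD (tmap_linear (@linear_id _ _) (mull_linear _))) E E'.
      by rewrite mulrDl.
    + rewrite tmap_pure //; last exact: mull_linear.
      by rewrite [RHS]pureM mulr1 mulrC.
  - by apply: tlift_linear; exact: (act_ext_bilin lreg_coact_linear).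
  - exact: linearP.
rewrite PhiE !lreg_actE ?det_mulmx ?dg ?dh ?mulr1 //.
apply: (etrans _ (esym (ev_map _ _ _))); rewrite map_mxM; apply: eq_ev.
rewrite (adjM2 dg dh) map_mxM -mulmxA; congr (_ *m _).
  by rewrite -map_mx_comp; apply/eq_map_mx => x /=; rewrite tcopair_inr.
transitivity (map_mx Eg (univ_mx k)).
  by symmetry; exact: (ev_univ (det_act dg (det_univ k))).
by rewrite -[RHS]map_mx_comp; apply/eq_map_mx => x /=; rewrite tcopair_inl.
Qed.

Definition lreg : ratmod := RatMod lreg_act1 lreg_actM.

(* a subfunctor of SL_2, described on points in commutative k-algebras *)
Record subfun := Subfun {
  points :> forall A : comAlgType k, 'M[A]_2 -> Prop;
  points_det : forall (A : comAlgType k) (h : 'M[A]_2), points h -> \det h = 1;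
  points_map : forall (A B : comAlgType k) (phi : {lrmorphism A -> B}) (h : 'M[A]_2),
    points h -> points (map_mx phi h) }.

Section Homogeneous.
Variable H : subfun.

Definition right_invariant (f : kG) : Prop :=
  forall (A : comAlgType k) (g h : 'M[A]_2), \det g = 1 -> H A h ->
    ev (g *m h) f = ev g f.

Fact right_invariant_subspace : is_subspace right_invariant.
Proof.
split=> [A g h dg Hh|a f f' If If' A g h dg Hh];
  have dgh : \det (g *m h) = 1 by rewrite det_mulmx dg (points_det Hh) mulr1.
  by rewrite (lin0 (ev_linear dg)) (lin0 (ev_linear dgh)).
by rewrite (ev_linear dg) (ev_linear dgh) If // If'.
Qed.
Definition kG_inv : subspace (kG : lmodType k) := Subspace right_invariant_subspace.

Definition contract (U V : lmodType k) (phi : {linear V -> k^o}) : tensor U V -> U :=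
  tlift (fun u v => phi v *: u).
Fact contract_bilin (U V : lmodType k) (phi : {linear V -> k^o}) :
  bilin (fun (u : U) v => phi v *: u).
Proof.
split=> [v|u] a x y; first by rewrite scalerDr !scalerA mulrC.
by rewrite linearP scalerDl scalerA.
Qed.

Fact contract_inv (f : kG) (phi : {linear kG -> k^o}) :
  right_invariant f -> right_invariant (contract phi (lreg_coact f)).
Proof.
move=> If A g h dg Hh.
have dgh : \det (g *m h) = 1 by rewrite det_mulmx dg (points_det Hh) mulr1.
have cl (U : lmodType k) : linear (@contract U _ phi).
  by apply: tlift_linear; apply: contract_bilin.
have E x (dx : \det x = 1) : ev x (contract phi (lreg_coact f)) =
    contract phi (ev (map_mx (@tinr k A kG) (\adj (univ_mx k)) *m map_mx (@tinl k A kG) x) f).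
  transitivity (contract phi (tmap (ev x) id (lreg_coact f))).
    have xl := ev_linear dx.
    apply: (tensor_ext (f := ev x \o contract phi) (g := contract phi \o tmap (ev x) id)).
    - exact: (linear_comp (cl _) xl).
    - exact: (linear_comp (tmap_linear xl (@linear_id _ _)) (cl _)).
    - move=> u v; rewrite /= tmap_pure // /contract !tlift_pure; try exact: contract_bilin.
      by rewrite (linZ xl).
  congr contract; rewrite -[X in tmap _ X]/(idfun : kG -> kG).
  rewrite -[tmap _ _ _](tmap_algE (ev_alg dx) (idfun : {lrmorphism kG -> kG})).
  apply: (etrans (ev_map _ _ _)); rewrite map_mxM; apply: eq_ev; congr (_ *m _).
    by rewrite -map_mx_comp; apply/eq_map_mx => y /=; rewrite tcopair_inr.
  transitivity (map_mx (@tinl k A kG) (map_mx (ev x) (univ_mx k))).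
    rewrite -[LHS]map_mx_comp -[RHS]map_mx_comp.
    by apply/eq_map_mx => y /=; rewrite tcopair_inl.
  by rewrite (ev_univ dx).
apply: (etrans (E _ dgh)); apply: (etrans _ (esym (E _ dg))); apply: (congr1 (contract phi)).
rewrite (map_mxM (@tinl k A kG)) mulmxA.
apply: (If (tensor A kG)); first exact: (det_act (det_univ k) dg).
exact: (points_map (@tinl k A kG) Hh).
Qed.

Fact kG_inv_subcomodule : @is_subcomodule lreg kG_inv.
Proof.
move=> f If.
have Zs : is_subspace (fun x : kG => x = 0).
  by split=> // a x y -> ->; rewrite scaler0 addr0.
have [//|p [pS pid _]] := @exists_projection k kG kG_inv (Subspace Zs).
have pl : linear (fun x => to_sub (pS x)).
  by move=> a x y; apply: val_inj; rewrite /= linearP.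
have vl := @val_linear lreg kG_inv.
exists (tmap (fun x => to_sub (pS x)) id (lreg_coact f)).
apply: subr0_eq; apply: tensor_separated => phi; rewrite -/(contract _ _).
have cl (U : lmodType k) : linear (@contract U _ phi).
  by apply: tlift_linear; apply: contract_bilin.
rewrite (linB (cl _)).
have -> : contract phi (tmap val id (tmap (fun x => to_sub (pS x)) id (lreg_coact f))) =
    p (contract phi (lreg_coact f)).
  apply: (tensor_ext (f := contract phi \o (tmap val id \o tmap (fun x => to_sub (pS x)) id))
    (g := p \o contract phi)).
  - exact: (linear_comp (linear_comp (tmap_linear pl (@linear_id _ _))
      (tmap_linear vl (@linear_id _ _))) (cl _)).
  - exact: (linear_comp (cl _) (linearP p)).
  - move=> u v; rewrite /= !tmap_pure // /contract !tlift_pure; try exact: contract_bilin.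
    by rewrite linearZZ.
rewrite pid ?subrr //; exact: contract_inv.
Qed.

Definition kGmod : ratmod := sub_ratmod kG_inv_subcomodule.

Fact right_invariantM (f f' : kG) :
  right_invariant f -> right_invariant f' -> right_invariant (f * f').
Proof.
move=> If If' A g h dg Hh.
have dgh : \det (g *m h) = 1 by rewrite det_mulmx dg (points_det Hh) mulr1.
by rewrite !evM // If // If'.
Qed.
Fact right_invariant1 : right_invariant 1.
Proof.
move=> A g h dg Hh.
have dgh : \det (g *m h) = 1 by rewrite det_mulmx dg (points_det Hh) mulr1.
by rewrite !ev1.
Qed.

Definition kGmod_val (x : kGmod) : kG := val (x : sub_space kG_inv).
Definition kGmod_mul (x y : kGmod) : kGmod :=
  @to_sub _ _ kG_inv (kGmod_val x * kGmod_val y)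
    (right_invariantM (sub_spaceP x) (sub_spaceP y)).
Definition kGmod_one : kGmod := @to_sub _ _ kG_inv 1 right_invariant1.
End Homogeneous.

Fact torus_map (A B : comAlgType k) (phi : {lrmorphism A -> B}) (h : 'M[A]_2) :
  \det h = 1 /\ is_diag_mx h -> \det (map_mx phi h) = 1 /\ is_diag_mx (map_mx phi h).
Proof.
move=> [dh /is_diag_mxP Dh]; split; first by rewrite det_map_mx dh rmorph1.
by apply/is_diag_mxP => i j ij; rewrite mxE Dh ?rmorph0.
Qed.
Definition torus : subfun :=
  @Subfun (fun A h => \det h = 1 /\ is_diag_mx h) (fun A h => @proj1 _ _) torus_map.

(* g normalizes H(B) for every A-algebra B *)
Definition normalizes (H : subfun) (A : comAlgType k) (g : 'M[A]_2) : Prop :=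
  \det g = 1 /\
  forall (B : comAlgType k) (phi : {lrmorphism A -> B}) (h : 'M[B]_2),
    \det h = 1 -> (H B (map_mx phi g *m h *m \adj (map_mx phi g)) <-> H B h).

Fact normalizes_map H (A B : comAlgType k) (phi : {lrmorphism A -> B}) (g : 'M[A]_2) :
  normalizes H g -> normalizes H (map_mx phi g).
Proof.
move=> [dg Ng]; split; first by rewrite det_map_mx dg rmorph1.
move=> C psi h dh; rewrite -map_mx_comp; exact: (Ng C (psi \o phi)).
Qed.
Definition normalizer (H : subfun) : subfun :=
  @Subfun (normalizes H) (fun A g => @proj1 _ _) (@normalizes_map H).

End RationalModules.

Section RationalCohomology.
Variable k : fieldType.
Local Notation ratmod := (ratmod k).

Definition injective_mod (Q : ratmod) : Prop :=
  forall (X Y : ratmod) (i : hom X Y) (f : hom X Q), injective i ->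
    exists g : hom Y Q, forall x, g (i x) = f x.

Record ses (B X A : ratmod) := Ses {
  ses_inc : hom B X;
  ses_prj : hom X A;
  ses_inj : injective ses_inc;
  ses_surj : forall a, exists x, ses_prj x = a;
  ses_exact : forall x, ses_prj x = 0 <-> exists b, x = ses_inc b }.

Record inj_res (M : ratmod) := InjRes {
  res :> nat -> ratmod;
  res_d : forall n, hom (res n) (res n.+1);
  res_aug : hom M (res 0);
  res_injective : forall n, injective_mod (res n);
  res_aug_inj : injective res_aug;
  res_exact0 : forall x, res_d 0 x = 0 <-> exists m, x = res_aug m;
  res_exact : forall n x, res_d n.+1 x = 0 <-> exists y, x = res_d n y }.

Definition is_invariant (M : ratmod) (m : M) : Prop := coact M m = pure m 1.

Fact is_invariant_subspace (M : ratmod) : is_subspace (@is_invariant M).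
Proof.
split=> [|a x y]; rewrite /is_invariant; first by rewrite linear0 pure0l.
by move=> Ix Iy; rewrite linearP Ix Iy pureDl pureZl.
Qed.
Definition invariants (M : ratmod) : subspace M := Subspace (is_invariant_subspace M).

Section Cohomology.
Variables (M : ratmod) (J : inj_res M).

Definition is_cocycle n (x : J n) : Prop := is_invariant x /\ res_d J n x = 0.
Definition is_coboundary n : J n -> Prop :=
  match n with
  | 0 => fun x => x = 0
  | n'.+1 => fun x => exists y : J n', is_invariant y /\ x = res_d J n' y
  end.

Fact is_cocycle_subspace n : is_subspace (@is_cocycle n).
Proof.
split=> [|a x y [Ix dx] [Iy dy]].
  by split; [exact: (subspace0 (invariants _)) | rewrite linear0].
split; first exact: ((subspaceP (invariants _)).2).
by rewrite linearP dx dy scaler0 addr0.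
Qed.
Definition cocycles n : subspace (J n) := Subspace (@is_cocycle_subspace n).

Fact is_coboundary_subspace n : is_subspace (@is_coboundary n).
Proof.
case: n => [|n] /=; split=> //.
- by move=> a x y -> ->; rewrite scaler0 addr0.
- by exists 0; split; [exact: (subspace0 (invariants _)) | rewrite linear0].
move=> a _ _ [x [Ix ->]] [y [Iy ->]]; exists (a *: x + y); split.
  exact: ((subspaceP (invariants _)).2).
by rewrite linearP.
Qed.

Fact coboundaries_subspace n :
  is_subspace (fun x : sub_space (cocycles n) => is_coboundary (val x)).
Proof.
have [b0 bP] := is_coboundary_subspace n.
by split=> [|a x y bx by_]; rewrite ?linear0 ?linearP //; apply: bP.
Qed.
Definition coboundaries n : subspace (sub_space (cocycles n)) :=
  Subspace (@coboundaries_subspace n).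

(* H^n(G, M), the n-th right derived functor of M |-> M^G, computed from J *)
Definition Hn n : Type := quot_space (coboundaries n).
HB.instance Definition _ n := GRing.Lmodule.on (Hn n).

Definition Hclass n (x : J n) (cx : is_cocycle x) : Hn n :=
  qclass (coboundaries n) (@to_sub _ _ (cocycles n) x cx).
Definition Hrepr n (x : Hn n) : J n := val (qrepr x).
Fact HreprP n (x : Hn n) : is_cocycle (Hrepr x).
Proof. exact: (@sub_spaceP _ _ (cocycles n) (qrepr x)). Qed.

(* If c is a cocycle representing a class in Ext^n(B, M), computed from the resolution J,
   then z represents, up to a sign convention, its Yoneda product with the class of
   0 -> B -> X -> A -> 0 in Ext^1(A, B). *)
Definition yoneda_step (B X A : ratmod) (E : ses B X A) n
    (c : hom B (J n)) (z : hom A (J n.+1)) : Prop :=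
  exists h : hom X (J n),
    (forall b, h (ses_inc E b) = c b) /\
    (forall x, res_d J n (h x) = z (ses_prj E x)).
End Cohomology.

(* z represents in Ext^n(A, A) the splice of n copies of E *)
Fixpoint yoneda_power (A X : ratmod) (E : ses A X A) (J : inj_res A) (n : nat) :
    hom A (J n) -> Prop :=
  match n return hom A (J n) -> Prop with
  | 0 => fun z => forall a, z a = res_aug J a
  | n'.+1 => fun z => exists c : hom A (J n'), yoneda_power E c /\ yoneda_step E c z
  end.

(* x is the Yoneda product in Ext^n(k, A) = H^n(G, A) of f : k -> A and n copies of E;
   Hom_G(k, -) is identified with (-)^G by evaluation at 1 *)
Definition yoneda_class (A X : ratmod) (E : ses A X A) (f : hom (trivial_mod k) A)
    (J : inj_res A) (n : nat) (x : Hn J n) : Prop :=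
  exists (z : hom A (J n)) (cz : is_cocycle (z (f 1))),
    yoneda_power E z /\ x = Hclass cz.

Section CupProduct.
Variables (M : ratmod) (mu : M -> M -> M) (J : inj_res M).

(* A morphism of complexes of G-modules J (x) J -> J lifting mu, given by its
   components J^p (x) J^q -> J^n for p + q = n.  It induces the cup product. *)
Record pairing := Pairing {
  pr : forall p q n, (p + q = n)%N -> J p -> J q -> J n;
  pr_bilin : forall p q n (e : (p + q = n)%N), bilin (pr e);
  pr_equivariant : forall p q n (e : (p + q = n)%N), equivariant2 (pr e);
  pr_leibniz : forall p q n (e : (p + q = n)%N) (e1 : (p.+1 + q = n.+1)%N)
      (e2 : (p + q.+1 = n.+1)%N) (x : J p) (y : J q),
    res_d J n (pr e x y) =
    pr e1 (res_d J p x) y + (-1) ^+ p *: pr e2 x (res_d J q y);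
  pr_aug : forall (e : (0 + 0 = 0)%N) (a b : M),
    pr e (res_aug J a) (res_aug J b) = res_aug J (mu a b) }.

Variable P : pairing.

Fact pr_cocycle p q n (e : (p + q = n)%N) (x : J p) (y : J q) :
  is_cocycle x -> is_cocycle y -> is_cocycle (pr P e x y).
Proof.
move=> [Ix dx] [Iy dy]; split.
  rewrite /is_invariant pr_equivariant Ix Iy tbil_pure ?mulr1 //.
    exact: pr_bilin.
  exact: mul_bilin.
have e1 : (p.+1 + q = n.+1)%N by rewrite addSn e.
have e2 : (p + q.+1 = n.+1)%N by rewrite addnS e.
rewrite (pr_leibniz P e e1 e2) dx dy (lin0 ((pr_bilin P e1).1 y)).
by rewrite (lin0 ((pr_bilin P e2).2 x)) scaler0 addr0.
Qed.

Definition cup p q n (e : (p + q = n)%N) (x : Hn J p) (y : Hn J q) : Hn J n :=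
  Hclass (pr_cocycle e (HreprP x) (HreprP y)).

Fact pr_coboundaryl p q n (e : (p + q = n)%N) (x : J p) (y : J q) :
  is_coboundary x -> is_cocycle y -> is_coboundary (pr P e x y).
Proof.
case: p e x => [|p] e x /=.
  move=> -> _; rewrite (lin0 ((pr_bilin P e).1 y)).
  exact: (is_coboundary_subspace J n).1.
move=> [x' [Ix ->]] [Iy dy]; case: n e => // n e.
have e0 : (p + q = n)%N by exact: succn_inj e.
exists (pr P e0 x' y); split.
  rewrite /is_invariant pr_equivariant Ix Iy tbil_pure ?mulr1 //.
    exact: pr_bilin.
  exact: mul_bilin.
have e2 : (p + q.+1 = n.+1)%N by rewrite addnS e0.
by rewrite (pr_leibniz P e0 e e2) dy (lin0 ((pr_bilin P e2).2 _)) scaler0 addr0.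
Qed.
Fact pr_coboundaryr p q n (e : (p + q = n)%N) (x : J p) (y : J q) :
  is_cocycle x -> is_coboundary y -> is_coboundary (pr P e x y).
Proof.
case: q e y => [|q] e y /=.
  move=> _ ->; rewrite (lin0 ((pr_bilin P e).2 x)).
  exact: (is_coboundary_subspace J n).1.
move=> [Ix dx] [y' [Iy ->]]; case: n e => [|n] e; first by have := esym (addnS p q); rewrite e.
have e0 : (p + q = n)%N by apply: succn_inj; rewrite -e addnS.
exists ((-1) ^+ p *: pr P e0 x y'); split.
  apply: (subspaceZ (S := invariants _)).
  rewrite /= /is_invariant pr_equivariant Ix Iy tbil_pure ?mulr1 //.
    exact: pr_bilin.
  exact: mul_bilin.
have e1 : (p.+1 + q = n.+1)%N by rewrite addSn e0.
rewrite linearZZ (pr_leibniz P e0 e1 e) dx (lin0 ((pr_bilin P e1).1 _)) add0r.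
by rewrite scalerA -expr2 sqrr_sign scale1r.
Qed.

Lemma cupE p q n (e : (p + q = n)%N) (x : J p) (y : J q)
    (cx : is_cocycle x) (cy : is_cocycle y) :
  cup e (Hclass cx) (Hclass cy) = Hclass (pr_cocycle e cx cy).
Proof.
have Bx : is_coboundary (Hrepr (Hclass cx) - x) := qreprE (coboundaries J p) _.
have By : is_coboundary (Hrepr (Hclass cy) - y) := qreprE (coboundaries J q) _.
apply/qclassE.
suff: is_coboundary (pr P e (Hrepr (Hclass cx)) (Hrepr (Hclass cy)) - pr P e x y) by [].
rewrite -[X in X - _](subrK (pr P e x (Hrepr (Hclass cy)))).
rewrite -(linB ((pr_bilin P e).1 _)) -addrA -(linB ((pr_bilin P e).2 _)).
apply: (subspaceD (S := Subspace (is_coboundary_subspace J n))) => /=.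
  by apply: pr_coboundaryl => //; exact: HreprP.
exact: pr_coboundaryr.
Qed.

(* the direct sum of the H^n *)
Record Hstar := mkHstar {
  Hcomp :> forall n, Hn J n;
  Hcomp_fin : exists b, forall n, (b <= n)%N -> Hcomp n = 0 }.

Fact Hstar_eq (h h' : Hstar) : (forall n, h n = h' n) -> h = h'.
Proof.
case: h h' => [h hf] [h' hf'] /= E.
have {}E : h = h' by apply: functional_extensionality_dep.
by case: _ / E hf' => hf'; congr mkHstar; exact: Prop_irrelevance.
Qed.

HB.instance Definition _ := gen_eqMixin Hstar.
HB.instance Definition _ := gen_choiceMixin Hstar.

Fact Hadd_fin (h h' : Hstar) : exists b, forall n, (b <= n)%N -> h n + h' n = 0.
Proof.
have [b bP] := Hcomp_fin h; have [b' bP'] := Hcomp_fin h'.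
exists (maxn b b') => n; rewrite geq_max => /andP[bn bn'].
by rewrite bP // bP' // addr0.
Qed.
Definition Hadd (h h' : Hstar) : Hstar := mkHstar (Hadd_fin h h').
Fact Hzero_fin : exists b, forall n, (b <= n)%N -> (0 : Hn J n) = 0.
Proof. by exists 0. Qed.
Definition Hzero : Hstar := mkHstar Hzero_fin.
Fact Hscale_fin (a : k) (h : Hstar) : exists b, forall n, (b <= n)%N -> a *: h n = 0.
Proof.
by have [b bP] := Hcomp_fin h; exists b => n bn; rewrite bP // scaler0.
Qed.
Definition Hscale (a : k) (h : Hstar) : Hstar := mkHstar (Hscale_fin a h).
Definition Hopp (h : Hstar) : Hstar := Hscale (-1) h.

Fact HaddA : associative Hadd.
Proof. by move=> x y z; apply: Hstar_eq => n /=; rewrite addrA. Qed.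
Fact HaddC : commutative Hadd.
Proof. by move=> x y; apply: Hstar_eq => n /=; rewrite addrC. Qed.
Fact Hadd0 : left_id Hzero Hadd.
Proof. by move=> x; apply: Hstar_eq => n /=; rewrite add0r. Qed.
Fact HaddN : left_inverse Hzero Hopp Hadd.
Proof. by move=> x; apply: Hstar_eq => n /=; rewrite scaleN1r addNr. Qed.
HB.instance Definition _ := GRing.isZmodule.Build Hstar HaddA HaddC Hadd0 HaddN.
Fact HscaleA a b v : Hscale a (Hscale b v) = Hscale (a * b) v.
Proof. by apply: Hstar_eq => n /=; rewrite scalerA. Qed.
Fact Hscale1 : left_id 1 Hscale.
Proof. by move=> x; apply: Hstar_eq => n /=; rewrite scale1r. Qed.
Fact HscaleDr : right_distributive Hscale +%R.
Proof. by move=> a x y; apply: Hstar_eq => n /=; rewrite scalerDr. Qed.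
Fact HscaleDl v : {morph Hscale^~ v : a b / a + b}.
Proof. by move=> a b; apply: Hstar_eq => n /=; rewrite scalerDl. Qed.
HB.instance Definition _ :=
  GRing.Zmodule_isLmodule.Build k Hstar HscaleA Hscale1 HscaleDr HscaleDl.

Fact Hclass_coboundary n (x : J n) (cx : is_cocycle x) :
  is_coboundary x -> Hclass cx = 0.
Proof.
move=> bx; rewrite -[RHS](lin0 (qclass_linear (coboundaries J n))).
by apply/qclassE; rewrite /= subr0.
Qed.
Fact Hrepr0 n : is_coboundary (Hrepr (0 : Hn J n)).
Proof.
have := qreprE (coboundaries J n) 0.
by rewrite (lin0 (qclass_linear (coboundaries J n))) subr0.
Qed.
Fact cup0l p q n (e : (p + q = n)%N) (y : Hn J q) : cup e 0 y = 0.
Proof. by apply: Hclass_coboundary; apply: pr_coboundaryl; [exact: Hrepr0|exact: HreprP]. Qed.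
Fact cup0r p q n (e : (p + q = n)%N) (x : Hn J p) : cup e x 0 = 0.
Proof. by apply: Hclass_coboundary; apply: pr_coboundaryr; [exact: HreprP|exact: Hrepr0]. Qed.

Fact Hmul_fin (h h' : Hstar) : exists b, forall n, (b <= n)%N ->
  \sum_(i < n.+1) cup (subnKC (leq_ord i)) (h i) (h' (n - i)%N) = 0.
Proof.
have [b bP] := Hcomp_fin h; have [b' bP'] := Hcomp_fin h'.
exists (b + b')%N => n bn; rewrite big1 // => i _.
have [bi|ib] := leqP b i; first by rewrite bP // cup0l.
rewrite (bP' (n - i)%N) ?cup0r // leq_subRL; last by rewrite -ltnS.
by apply: leq_trans bn; rewrite leq_add2r ltnW.
Qed.
Definition Hmul (h h' : Hstar) : Hstar := mkHstar (Hmul_fin h h').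

Fact Hconst_cocycle (u : M) : is_invariant u -> is_cocycle (res_aug J u).
Proof.
move=> Iu; split; last by apply/res_exact0; exists u.
rewrite /is_invariant homP Iu tmap_pure //; exact: linearP.
Qed.

(* the class of an invariant element of M in H^0 *)
Definition Hconst_comp (u : M) (Iu : is_invariant u) (n : nat) : Hn J n :=
  match n with 0 => Hclass (Hconst_cocycle Iu) | _ => 0 end.
Fact Hconst_fin u (Iu : is_invariant u) :
  exists b, forall n, (b <= n)%N -> Hconst_comp Iu n = 0.
Proof. by exists 1%N; case. Qed.
Definition Hconst u (Iu : is_invariant u) : Hstar := mkHstar (Hconst_fin Iu).
End CupProduct.

Section Statement.
Variable H : subfun k.

Fact kGmod_one_invariant : is_invariant (kGmod_one H).
Proof.
apply: (@sub_tensor_inj k (lreg k) (kG_inv H)).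
have vl := @val_linear k (lreg k) (kG_inv H).
rewrite [LHS]sub_coactE (tmap_pure _ _ vl (@linear_id _ _)).
rewrite /= /lreg_coact_fun ev1 //; apply: det_act; exact: det_univ.
Qed.

Fact const_linear : linear (fun c : k^o => c *: kGmod_one H).
Proof. by move=> a x y; rewrite scalerDl scalerA. Qed.
Fact const_equivariant (c : k^o) :
  coact (kGmod H) (mklin const_linear c) =
  tmap (mklin const_linear) id (coact (trivial_mod k) c).
Proof.
rewrite [RHS](tmap_pure _ _ const_linear (@linear_id _ _)).
rewrite [LHS](linZ (linearP (coact (kGmod H)))) kGmod_one_invariant.
by rewrite [RHS]pureZl.
Qed.
Definition const_hom : hom (trivial_mod k) (kGmod H) :=
  @Hom _ (trivial_mod k) (kGmod H) (mklin const_linear) const_equivariant.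
End Statement.

Definition kG_mod_T : ratmod := kGmod (torus k).
Definition kG_mod_N : ratmod := kGmod (normalizer (torus k)).

(* E is k[G/N] -> k[G/T] -> k[G/N], the inclusion followed by x + y ad |-> y *)
Definition is_calE (E : ses kG_mod_N kG_mod_T kG_mod_N) : Prop :=
  (forall x, kGmod_val (ses_inc E x) = kGmod_val x) /\
  (forall (x y : kG_mod_N) (w : kG_mod_T),
    kGmod_val w = kGmod_val x + kGmod_val y * (univ_mx k 0 0 * univ_mx k 1 1) ->
    ses_prj E w = y).

End RationalCohomology.

(* Main.v *)
From HB Require Import structures.
From mathcomp Require Import all_boot all_order all_algebra.
From mathcomp Require Import boolp mpoly ring.
Require Import Defs.
Import GRing.Theory.
Local Open Scope ring_scope.

Set Implicit Arguments.
Unset Strict Implicit.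
Unset Printing Implicit Defensive.

(** Write [X = k[G/T]] and [A = k[G/N]].  Right translation by [sigma] acts on [X], with
    fixed ring [A], and [D = 1 + sigma] satisfies [D (ad) = 1] in characteristic two; so
    [D] maps [X] onto [A] with kernel [A] ([calE]), and splicing these sequences gives
    a resolution [A -> X -> X -> ...] in which every differential is [D] ([per_res]).

    This resolution is injective.  The regular representation [k[G]] is injective by
    Frobenius reciprocity ([lreg_injective]), and [X] is its direct summand of weight zero
    for right translation by the torus ([weight_zero_hom]).  The invariants of [X] are the
    constants, which [D] kills; hence every cohomology group is spanned by the class of
    the constant function one.  Chain maps between [per_res] and an arbitrary injective
    resolution carry this over ([gen_span], [gen_free]); restricted to [A], such a chain
    map represents up to homotopy the splices of copies of the extension
    ([yoneda_power_homotopic]).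

    As for the cup product, the cochains of a group of order two suggest the pairing
    [(x, y) |-> x * sigma^p y] on [per_res] ([per_pairing]), from which a pairing on any
    resolution is obtained by transport.  Conversely any pairing can be transported to
    [per_res], and it remains to see that it sends the pair of constants [(1, 1)] to [1] in
    all degrees.  When the first degree is zero, the pairing restricted to [A] is a chain
    map on [A (x) per_res] lifting the multiplication of [A], hence homotopic to the
    multiplication map ([pairing_one_right]).  When the second argument is the constant
    one, the pairing is then a chain map in the first argument homotopic to the identity
    ([pairing_one]).  So the generators multiply like the powers of one variable. *)

(** * Morphisms of rational modules *)

Section Morphisms.
Variable k : fieldType.
Implicit Types M N Q : ratmod k.

Lemma hom_linear M N (f : hom M N) : linear f.
Proof. exact: linearP. Qed.

Lemma tmap_comp (U U' U'' V V' V'' : lmodType k) (f : U -> U') (f' : U' -> U'')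
    (g : V -> V') (g' : V' -> V'') t :
  linear f -> linear f' -> linear g -> linear g' ->
  tmap f' g' (tmap f g t) = tmap (f' \o f) (g' \o g) t.
Proof.
move=> lf lf' lg lg'.
apply: (tensor_ext (f := tmap f' g' \o tmap f g)).
- by apply: linear_comp; apply: tmap_linear.
- by apply: tmap_linear; apply: linear_comp.
- move=> u v; rewrite /= !tmap_pure //; exact: linear_comp.
Qed.

Lemma tmap_ext (U U' V V' : lmodType k) (f f' : U -> U') (g g' : V -> V') :
  f =1 f' -> g =1 g' -> tmap f g =1 tmap f' g'.
Proof. by move=> /funext -> /funext ->. Qed.

Lemma tmap_id (U V : lmodType k) (t : tensor U V) : tmap id id t = t.
Proof.
apply: (tensor_ext (f := tmap id id) (g := id)) => //.
  by apply: tmap_linear; apply: linear_id.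
by move=> u v; rewrite tmap_pure //; apply: linear_id.
Qed.

Lemma tmapD (U U' V : lmodType k) (f g : U -> U') (t : tensor U V) :
  linear f -> linear g ->
  tmap (fun x => f x + g x) id t = tmap f id t + tmap g id t.
Proof.
move=> lf lg; have lh : linear (fun x => f x + g x).
  by move=> a x y; rewrite lf lg scalerDr addrACA.
elim/tensor_ind: t => [|t t' E E'|u v].
- by rewrite !(lin0 (tmap_linear _ (@linear_id _ V))) ?addr0.
- by rewrite !(linD (tmap_linear _ (@linear_id _ V))) // E E' addrACA.
- by rewrite !tmap_pure ?pureDl.
Qed.

Lemma tmapZ (U U' V : lmodType k) (a : k) (f : U -> U') (t : tensor U V) :
  linear f -> tmap (fun x => a *: f x) id t = a *: tmap f id t.
Proof.
move=> lf; have lh : linear (fun x => a *: f x).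
  by move=> b x y; rewrite lf scalerDr !scalerA mulrC.
elim/tensor_ind: t => [|t t' E E'|u v].
- by rewrite !(lin0 (tmap_linear _ (@linear_id _ V))) ?scaler0.
- by rewrite !(linD (tmap_linear _ (@linear_id _ V))) // E E' scalerDr.
- by rewrite !tmap_pure ?pureZl.
Qed.

Definition mkhom M N (f : M -> N) (lf : linear f)
    (ef : forall m, coact N (f m) = tmap f id (coact M m)) : hom M N :=
  @Hom k M N (mklin lf) ef.

Fact hom_id_eq M m : coact M (id m) = tmap id id (coact M m).
Proof. by rewrite tmap_id. Qed.
Definition hom_id M : hom M M := mkhom (@linear_id k M) (@hom_id_eq M).

Fact hom_comp_eq M N Q (g : hom N Q) (f : hom M N) m :
  coact Q ((g \o f) m) = tmap (g \o f) id (coact M m).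
Proof.
rewrite /= !homP (tmap_comp _ (hom_linear f) (hom_linear g)) //; exact: linear_id.
Qed.
Definition hom_comp M N Q (g : hom N Q) (f : hom M N) : hom M Q :=
  mkhom (linear_comp (hom_linear f) (hom_linear g)) (@hom_comp_eq M N Q g f).

Fact hom_lc_linear M N (a : k) (f g : hom M N) : linear (fun x => f x + a *: g x).
Proof.
by move=> b x y; rewrite !linearP !scalerDr addrACA !scalerA mulrC.
Qed.
Fact hom_lc_eq M N (a : k) (f g : hom M N) m :
  coact N (f m + a *: g m) = tmap (fun x => f x + a *: g x) id (coact M m).
Proof.
have gl : linear (fun x => a *: g x).
  by move=> b x y; rewrite linearP scalerDr !scalerA mulrC.
rewrite (tmapD _ (hom_linear f) gl) (tmapZ _ _ (hom_linear g)) -!homP.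
by rewrite linearD linearZZ.
Qed.
Definition hom_lc M N (a : k) (f g : hom M N) : hom M N :=
  mkhom (@hom_lc_linear M N a f g) (@hom_lc_eq M N a f g).
Definition hom_sub M N (f g : hom M N) : hom M N := hom_lc (-1) f g.

Lemma hom_subE M N (f g : hom M N) x : hom_sub f g x = f x - g x.
Proof. by rewrite /= scaleN1r. Qed.

Lemma hom_invariant M N (f : hom M N) m : is_invariant m -> is_invariant (f m).
Proof.
move=> Im; rewrite /is_invariant homP Im tmap_pure //; exact: hom_linear.
Qed.

Section Submodules.
Variables (N : ratmod k) (S : subspace N) (stS : is_subcomodule S).

Definition sub_incl : hom (sub_ratmod stS) N :=
  @mkhom (sub_ratmod stS) N val (@val_linear k N S) (fun x => esym (sub_coactE stS x)).

Section Corestriction.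
Variables (M : ratmod k) (f : hom M N) (Sf : forall m, S (f m)).
Let r (m : M) : sub_ratmod stS := to_sub (Sf m).
Fact corestrict_linear : linear r.
Proof. by move=> a x y; apply: val_inj; rewrite /= linearP. Qed.
Fact corestrict_eq m : coact (sub_ratmod stS) (r m) = tmap r id (coact M m).
Proof.
apply: (@sub_tensor_inj k N S); rewrite [LHS]sub_coactE /= homP.
by rewrite (tmap_comp _ corestrict_linear (@val_linear k N S)) //; apply: linear_id.
Qed.
Definition corestrict : hom M (sub_ratmod stS) :=
  mkhom corestrict_linear corestrict_eq.
End Corestriction.
End Submodules.

(** * Injective modules and the comparison of complexes *)

Lemma injective_retract (Q N : ratmod k) (i : hom N Q) (r : hom Q N) :
  (forall x, r (i x) = x) -> injective_mod Q -> injective_mod N.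
Proof.
move=> ri IQ X Y j f jinj.
have [g gP] := IQ X Y j (hom_comp i f) jinj.
by exists (hom_comp r g) => x; rewrite /= gP /= ri.
Qed.

Section Image.
Variables (M N : ratmod k) (d : hom M N).
Fact image_is_subspace : is_subspace (fun y : N => exists x, y = d x).
Proof.
split; first by exists 0; rewrite linear0.
by move=> a _ _ [x ->] [y ->]; exists (a *: x + y); rewrite linearP.
Qed.
Definition image : subspace N := Subspace image_is_subspace.
Fact image_subcomodule : is_subcomodule image.
Proof.
move=> _ [x ->].
have Sd m : image (d m) by exists m.
have rl : linear (fun m => to_sub (Sd m) : sub_space image).
  by move=> a u v; apply: val_inj; rewrite /= linearP.
exists (tmap (fun m => to_sub (Sd m)) id (coact M x)).
rewrite (tmap_comp _ rl (@val_linear k N image)) ?homP //; exact: linear_id.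
Qed.
End Image.

(** The quotient of [M] by the kernel of [d] is the image of [d], a submodule of [N];
    hence maps out of it extend to [N]. *)
Lemma injective_factor (Q M N : ratmod k) (d : hom M N) (f : hom M Q) :
  injective_mod Q -> (forall x, d x = 0 -> f x = 0) ->
  exists g : hom N Q, forall x, g (d x) = f x.
Proof.
move=> IQ df.
have fE x y : d x = d y -> f x = f y.
  move=> E; apply/subr0_eq; rewrite -linearB; apply: df.
  by rewrite linearB E subrr.
pose W := sub_ratmod (@image_subcomodule M N d).
have pre (w : W) : exists x, val w = d x by exact: (@sub_spaceP _ _ (image d) w).
pose s w := projT1 (cid (pre w)).
have sP w : val w = d (s w) by exact: projT2 (cid (pre w)).
have fl : linear (fun w => f (s w)).
  move=> a x y; rewrite -linearP; apply: fE.
  by rewrite linearP -!sP (@val_linear k N (image d)).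
have Sd x : image d (d x) by exists x.
pose c : hom M W := corestrict (@image_subcomodule M N d) Sd.
have fc x : f (s (c x)) = f x by apply: fE; rewrite -sP.
have fe w : coact Q (f (s w)) = tmap (fun w => f (s w)) id (coact W w).
  rewrite homP -(tmap_ext fc (frefl _)).
  rewrite -(tmap_comp (g := id) (g' := id) _ (hom_linear c) fl) ?linear_id //.
  rewrite -homP; congr (tmap _ _ (coact W _)).
  by apply: val_inj; exact: (esym (sP w)).
have [g gP] := IQ W N (sub_incl (@image_subcomodule M N d)) (mkhom fl fe) val_inj.
exists g => x; exact: (etrans (gP (c x)) (fc x)).
Qed.

Section Complexes.
Variables (K L : nat -> ratmod k).
Variables (dK : forall n, hom (K n) (K n.+1)) (dL : forall n, hom (L n) (L n.+1)).
Hypothesis exactK : forall n x, dK n.+1 x = 0 -> exists y, x = dK n y.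
Hypothesis dLL : forall n x, dL n.+1 (dL n x) = 0.
Hypothesis injL : forall n, injective_mod (L n).

(** The lift of [f0] is extended one degree at a time by [injective_factor], carrying
    along the property that cocycles are sent to cocycles. *)
Lemma chain_lift (f0 : hom (K 0) (L 0)) :
  (forall x, dK 0 x = 0 -> dL 0 (f0 x) = 0) ->
  exists F : forall n, hom (K n) (L n),
    (F 0 = f0) /\ forall n x, F n.+1 (dK n x) = dL n (F n x).
Proof.
move=> f0P.
pose T n := {f : hom (K n) (L n) | forall x, dK n x = 0 -> dL n (f x) = 0}.
have step n (f : T n) : {g : T n.+1 | forall x, sval g (dK n x) = dL n (sval f x)}.
  case: f => f fP; apply: cid.
  have [g gP] := @injective_factor _ _ _ (dK n) (hom_comp (dL n) f) (@injL n.+1) fP.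
  have gP' x : dK n.+1 x = 0 -> dL n.+1 (g x) = 0.
    by move=> /exactK[y ->]; rewrite gP /= dLL.
  by exists (exist _ g gP').
pose G := nat_rect T (exist _ f0 f0P) (fun n f => sval (step n f)).
exists (fun n => sval (G n)); split=> // n x.
exact: (svalP (step n (G n))).
Qed.

(** In each degree the part of [F] not yet accounted for vanishes on cocycles, which are
    the coboundaries of the exact complex, so it factors through the differential. *)
Lemma chain_homotopy (F : forall n, hom (K n) (L n)) :
  (forall n x, F n.+1 (dK n x) = dL n (F n x)) ->
  (forall x, dK 0 x = 0 -> F 0 x = 0) ->
  exists s : forall n, hom (K n.+1) (L n),
    (forall x, F 0 x = s 0 (dK 0 x)) /\
    (forall n x, F n.+1 x = dL n (s n x) + s n.+1 (dK n.+1 x)).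
Proof.
move=> FP F0.
pose T n := {s : hom (K n.+1) (L n) |
  forall x, dK n.+1 x = 0 -> F n.+1 x = dL n (s x)}.
have [s0 s0P] := @injective_factor _ _ _ (dK 0) (F 0) (@injL 0) F0.
have s0P' x : dK 1 x = 0 -> F 1 x = dL 0 (s0 x).
  by move=> /exactK[y ->]; rewrite FP s0P.
have step n (s : T n) : {t : T n.+1 |
    forall x, F n.+1 x = dL n (sval s x) + sval t (dK n.+1 x)}.
  case: s => s sP; apply: cid.
  have [t tP] : exists t : hom (K n.+2) (L n.+1),
      forall x, t (dK n.+1 x) = hom_sub (F n.+1) (hom_comp (dL n) s) x.
    apply: injective_factor => // x dx.
    by rewrite hom_subE /= sP // subrr.
  have tP' x : dK n.+2 x = 0 -> F n.+2 x = dL n.+1 (t x).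
    move=> /exactK[y ->]; rewrite FP tP hom_subE /= linearB /= dLL subr0 //.
  by exists (exist _ t tP') => x; rewrite tP hom_subE /= addrC subrK.
pose G := nat_rect T (exist _ s0 s0P') (fun n s => sval (step n s)).
exists (fun n => sval (G n)); split=> [x|n x]; first by rewrite s0P.
exact: (svalP (step n (G n))).
Qed.
End Complexes.

End Morphisms.

(** * The regular representation is injective *)

Section Regular.
Variable k : fieldType.
Local Notation kG := (kG k).
Local Notation univ := (univ_mx k).

Lemma ord2 (i : 'I_2) : i = 0 \/ i = 1.
Proof. by case: i => [[|[|//]] ?]; [left|right]; apply: val_inj. Qed.

Lemma adj2E (A : comNzRingType) (h : 'M[A]_2) :
  [/\ (\adj h) 0 0 = h 1 1, (\adj h) 0 1 = - h 0 1,
      (\adj h) 1 0 = - h 1 0 & (\adj h) 1 1 = h 0 0].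
Proof.
have c0 : lift (0 : 'I_2) (0 : 'I_1) = 1 by apply: val_inj.
have c1 : lift (1 : 'I_2) (0 : 'I_1) = 0 by apply: val_inj.
by split; rewrite mxE /cofactor det_mx11 !mxE ?c0 ?c1
  /= ?expr0 ?expr1 ?mul1r ?mulN1r // -signr_odd expr0 mul1r.
Qed.

Lemma det2E (A : comNzRingType) (h : 'M[A]_2) :
  \det h = h 0 0 * h 1 1 - h 0 1 * h 1 0.
Proof.
have [a b c d] := adj2E h.
have := congr1 (fun x : 'M[A]_2 => x 0 0) (mul_mx_adj h).
rewrite /= [RHS]mxE eqxx mulr1n => <-; rewrite mxE big_ord_recl big_ord1.
rewrite (_ : lift _ _ = 1) ?a ?c ?mulrN //; exact: val_inj.
Qed.

Lemma adjK2 (A : comNzRingType) (g : 'M[A]_2) : \adj (\adj g) = g.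
Proof.
have [a b c d] := adj2E g; have [a' b' c' d'] := adj2E (\adj g).
apply/matrixP => i j; case: (ord2 i) => ->; case: (ord2 j) => ->.
- by rewrite a' d.
- by rewrite b' b opprK.
- by rewrite c' c opprK.
- by rewrite d' a.
Qed.

Definition lcontract (M : lmodType k) (A : comAlgType k) (psi : M -> k^o) :
    tensor M A -> A := tlift (fun m a => psi m *: a).

Lemma lcontract_bilin (M : lmodType k) (A : comAlgType k) (psi : M -> k^o) :
  linear psi -> bilin (fun m (a : A) => psi m *: a).
Proof.
move=> lp; split=> [a|m] c x y; first by rewrite lp scalerDl scalerA.
by rewrite scalerDr !scalerA mulrC.
Qed.

Lemma lcontract_linear (M : lmodType k) (A : comAlgType k) (psi : M -> k^o) :
  linear psi -> linear (@lcontract M A psi).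
Proof. by move=> lp; apply/tlift_linear/lcontract_bilin. Qed.

Lemma lcontract_pure (M : lmodType k) (A : comAlgType k) (psi : M -> k^o) m (a : A) :
  linear psi -> lcontract psi (pure m a) = psi m *: a.
Proof. by move=> lp; rewrite /lcontract tlift_pure //; apply: lcontract_bilin. Qed.

Lemma lcontract_tmap (M N : lmodType k) (A B : comAlgType k) (psi : N -> k^o)
    (f : M -> N) (g : A -> B) (t : tensor M A) :
  linear psi -> linear f -> linear g ->
  lcontract psi (tmap f g t) = g (lcontract (psi \o f) t).
Proof.
move=> lp lf lg; have lpf := linear_comp lf lp.
apply: (tensor_ext (f := lcontract psi \o tmap f g) (g := g \o lcontract (psi \o f))).
- apply: linear_comp; [exact: tmap_linear|exact: lcontract_linear].
- by apply: linear_comp => //; apply: lcontract_linear.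
- by move=> u v; rewrite /= tmap_pure // !lcontract_pure // (linZ lg).
Qed.

Lemma hom_act (M N : ratmod k) (f : hom M N) (A : comAlgType k) (g : 'M[A]_2) m :
  \det g = 1 -> act (coact N) g (f m) = tmap f id (act (coact M) g m).
Proof.
move=> dg; have lf := hom_linear f; have le := ev_linear dg.
rewrite /act homP !tmap_comp //; exact: linear_id.
Qed.

Lemma act_map (M : ratmod k) (A B : comAlgType k) (phi : {lrmorphism A -> B})
    (g : 'M[A]_2) (m : M) : \det g = 1 ->
  tmap id phi (act (coact M) g m) = act (coact M) (map_mx phi g) m.
Proof.
move=> dg; have lp : linear phi by exact: linearP.
rewrite /act tmap_comp //; try exact: linear_id; try exact: ev_linear.
by apply: tmap_ext => // f /=; rewrite ev_map.
Qed.

Definition kG_eps (f : kG) : k^o := ev (1%:M : 'M[k^o]_2) f.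
Lemma kG_eps_linear : linear kG_eps.
Proof. by apply: ev_linear; rewrite det1. Qed.

(** The matrix coefficient attached to [psi] and [y], the function [x |-> psi(x^-1 y)]. *)
Definition mcoef (M : ratmod k) (psi : M -> k^o) (y : M) : kG :=
  lcontract psi (act (coact M) (\adj univ) y).

Lemma det_adj_univ : \det (\adj univ) = 1.
Proof. by apply: det_adj2; rewrite det_univ. Qed.

Lemma act_linear (M : ratmod k) (A : comAlgType k) (g : 'M[A]_2) :
  \det g = 1 -> linear (act (coact M) g).
Proof.
move=> dg a x y; rewrite /act linearP.
by rewrite (tmap_linear (@linear_id k M) (ev_linear dg)).
Qed.

Lemma mcoef_linear (M : ratmod k) (psi : M -> k^o) : linear psi -> linear (mcoef psi).
Proof.
move=> lp; exact: (linear_comp (act_linear det_adj_univ) (lcontract_linear lp)).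
Qed.

Lemma ev_mcoef (M : ratmod k) (psi : M -> k^o) (A : comAlgType k) (g : 'M[A]_2) y :
  linear psi -> \det g = 1 ->
  ev g (mcoef psi y) = lcontract psi (act (coact M) (\adj g) y).
Proof.
move=> lp dg; rewrite /mcoef.
have := lcontract_tmap (f := id) (act (coact M) (\adj univ) y) lp
  (@linear_id _ _) (ev_linear dg).
move=> <-; rewrite -[ev g]/(ev_alg dg : _ -> _) act_map ?det_adj_univ //.
by rewrite map_mx_adj (ev_univ dg).
Qed.

Lemma act_univ (M : ratmod k) (A : comAlgType k) (phi : {lrmorphism kG -> A}) (y : M) :
  act (coact M) (map_mx phi univ) y = tmap id phi (coact M y).
Proof.
by apply: tmap_ext => // f; rewrite -ev_map ev_id.
Qed.

(** Both sides are the function [(x, g) |-> psi(x^-1 g y)]; the points [l] and [r] below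
    are the universal [x] and [g]. *)
Lemma mcoef_coact (M : ratmod k) (psi : M -> k^o) (y : M) : linear psi ->
  coact (lreg k) (mcoef psi y) = tmap (mcoef psi) id (coact M y).
Proof.
move=> lp; rewrite [LHS]/(lreg_coact_fun _).
set l := map_mx (@tinl k kG kG) univ; set r := map_mx (@tinr k kG kG) univ.
have dl : \det l = 1 by rewrite det_map_mx det_univ rmorph1.
have dr : \det r = 1 by rewrite det_map_mx det_univ rmorph1.
have dal : \det (\adj l) = 1 by exact: det_adj2.
rewrite /lreg_coact_fun map_mx_adj -/l -/r.
rewrite ev_mcoef ?det_mulmx ?det_adj2 ?dl ?dr ?mulr1 //.
rewrite adjM2 ?det_adj2 // adjK2 actM // act_univ.
have lc := linearP (coact M).
have lt : linear (@tinr k kG kG) by exact: linearP.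
have lm := mcoef_linear lp.
have li := @linear_id k.
have be := act_ext_bilin lc dal.
apply: (tensor_ext
  (f := lcontract psi \o (act_ext (coact M) (\adj l) \o tmap id (@tinr k kG kG)))).
- apply: linear_comp; last exact: lcontract_linear.
  apply: linear_comp; first exact: tmap_linear.
  exact: tlift_linear.
- exact: tmap_linear.
- move=> u f; rewrite /= !tmap_pure // /act_ext tlift_pure //.
  rewrite (lcontract_tmap _ lp (@linear_id _ _) (mull_linear _)) -ev_mcoef //.
  by rewrite -ev_map ev_id [RHS]pure_tin mulrC.
Qed.

Definition mcoef_hom (M : ratmod k) (psi : M -> k^o) (lp : linear psi) : hom M (lreg k) :=
  @mkhom k M (lreg k) (mcoef psi) (mcoef_linear lp) (fun y => mcoef_coact y lp).

(** Frobenius reciprocity: evaluating at [x^-1 y] gives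
    [(f y)(x) = (x^-1 . f y)(1) = f(x^-1 y)(1)]. *)
Lemma hom_lreg_mcoef (M : ratmod k) (f : hom M (lreg k)) (y : M) :
  f y = mcoef (kG_eps \o f) y.
Proof.
have le := kG_eps_linear; have lf := hom_linear f.
have := lcontract_tmap (f := f) (g := id) (act (coact M) (\adj univ) y) le lf
  (@linear_id k kG).
rewrite -hom_act ?det_adj_univ // /mcoef => <-.
rewrite lreg_actE ?det_adj_univ // adjK2.
have e1 : \det (1%:M : 'M[k^o]_2) = 1 by rewrite det1.
have cl : linear (fun a : k^o => (a : k) *: (1 : kG)).
  by move=> a x z; rewrite scalerDl scalerA.
have cM : {morph (fun a : k^o => (a : k) *: (1 : kG)) : x y / x * y}.
  by move=> x z /=; rewrite -scalerAl mul1r scalerA.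
pose c : {lrmorphism k^o -> kG} := mkalg cl (scale1r _) cM.
pose e : {lrmorphism kG -> kG} := c \o ev_alg e1.
pose C : {lrmorphism tensor kG kG -> kG} := tcopair e (idfun : {lrmorphism kG -> kG}).
have CE : lcontract kG_eps =1 C.
  apply: tensor_ext; [exact: lcontract_linear|exact: linearP|move=> u v].
  by rewrite lcontract_pure // [RHS]tcopair_pure /= /kG_eps -scalerAl mul1r.
rewrite CE; symmetry; apply: (etrans (ev_map _ _ _)).
rewrite -[RHS](ev_id (f y)); apply: eq_ev.
rewrite map_mxM -[RHS]mulmx1; congr (_ *m _).
  by apply/matrixP => i j; rewrite 2!mxE; apply: tcopair_inr.
transitivity (map_mx c (map_mx (ev (1%:M : 'M[k^o]_2)) univ)).
  rewrite -[LHS]map_mx_comp -[RHS]map_mx_comp; apply/eq_map_mx => x; exact: tcopair_inl.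
by rewrite (ev_univ e1) map_scalar_mx rmorph1.
Qed.

Lemma linear_retraction (X Y : lmodType k) (i : X -> Y) :
  linear i -> injective i -> exists2 r : Y -> X, linear r & cancel i r.
Proof.
move=> li ii.
have Isub : is_subspace (fun y => exists x, y = i x).
  split; first by exists 0; rewrite (lin0 li).
  by move=> a _ _ [x ->] [y ->]; exists (a *: x + y); rewrite li.
have Zs : is_subspace (fun x : Y => x = 0).
  by split=> // a x y -> ->; rewrite scaler0 addr0.
have [//|p [pS pid _]] := @exists_projection k Y (Subspace Isub) (Subspace Zs).
pose r y := projT1 (cid (pS y)).
have rP y : p y = i (r y) by exact: projT2 (cid (pS y)).
exists r => [a x y|x]; apply: ii; first by rewrite -rP linearP li -!rP.
by rewrite -rP pid //; exists x.
Qed.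

(** By Frobenius reciprocity extending a morphism to [k[G]] amounts to extending a linear
    form, which a linear retraction does. *)
Lemma lreg_injective : injective_mod (lreg k).
Proof.
move=> X Y i f ii.
have [r lr rK] := linear_retraction (hom_linear i) ii.
have lpsi : linear ((kG_eps \o f) \o r).
  exact: (linear_comp lr (linear_comp (hom_linear f) (@kG_eps_linear))).

exists (mcoef_hom lpsi) => x; rewrite [RHS]hom_lreg_mcoef /= /mcoef hom_act ?det_adj_univ //.
rewrite (lcontract_tmap _ lpsi (hom_linear i) (@linear_id _ _)) /=.
by congr lcontract; apply/funext => z /=; rewrite rK.
Qed.

Lemma lreg_invariant (f : lreg k) : is_invariant f -> f = (kG_eps f : k) *: (1 : kG).
Proof.
move=> If; have e1 : \det (1%:M : 'M[k^o]_2) = 1 by rewrite det1.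
rewrite [LHS](hom_lreg_mcoef (hom_id (lreg k))) /= /mcoef /act [coact _ _]If.
rewrite tmap_pure; [|exact: linear_id|exact: ev_linear det_adj_univ].
rewrite lcontract_pure ?ev1 ?det_adj_univ //; exact: kG_eps_linear.
Qed.
End Regular.

(** * Right translations and the weight-zero projection *)

Section RationalFunctions.
Variable k : fieldType.

(** [k(t)] with its structure of [k]-algebra: it contains the coordinate ring
    [k[t, t^-1]] of the torus, hence a generic point of the torus. *)
Definition ratfun : Type := {fraction {poly k}}.
HB.instance Definition _ := GRing.ComNzRing.on ratfun.
Definition ratfun_scale (a : k) (x : ratfun) : ratfun := FracField.tofrac a%:P * x.
Fact ratfun_scaleA a b x : ratfun_scale a (ratfun_scale b x) = ratfun_scale (a * b) x.
Proof. by rewrite /ratfun_scale mulrA -tofracM polyCM. Qed.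
Fact ratfun_scale1 : left_id 1 ratfun_scale.
Proof. by move=> x; rewrite /ratfun_scale polyC1 tofrac1 mul1r. Qed.
Fact ratfun_scaleDr : right_distributive ratfun_scale +%R.
Proof. by move=> a x y; rewrite /ratfun_scale mulrDr. Qed.
Fact ratfun_scaleDl x : {morph ratfun_scale^~ x : a b / a + b}.
Proof. by move=> a b; rewrite /ratfun_scale polyCD tofracD mulrDl. Qed.
HB.instance Definition _ := GRing.Zmodule_isLmodule.Build k ratfun
  ratfun_scaleA ratfun_scale1 ratfun_scaleDr ratfun_scaleDl.
Fact ratfun_scaleAl (a : k) (x y : ratfun) : a *: (x * y) = a *: x * y.
Proof. exact: mulrA. Qed.
HB.instance Definition _ := GRing.Lmodule_isLalgebra.Build k ratfun ratfun_scaleAl.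
HB.instance Definition _ := GRing.Lalgebra_isComAlgebra.Build k ratfun.

Definition tvar : ratfun := FracField.tofrac 'X.
Definition tinv : ratfun := (FracField.tofrac ('X : {poly k}))^-1.

Lemma tvarV : tvar * tinv = 1.
Proof. by rewrite /tvar /tinv mulfV // tofrac_eq0 polyX_eq0. Qed.

Lemma tvarXV n : tvar ^+ n * tinv ^+ n = 1.
Proof. by rewrite -exprMn tvarV expr1n. Qed.

(** The linear form extracting the constant term of a Laurent polynomial, extended to
    [k(t)]; it is the invariant integral on the torus. *)
Lemma constant_term : exists phi : {linear ratfun -> k^o},
  phi 1 = 1 /\ forall i j, i != j -> phi (tvar ^+ i * tinv ^+ j) = 0.
Proof.
pose C (x : ratfun) := exists n (p : {poly k}),
  p`_n = 0 /\ x = FracField.tofrac p * tinv ^+ n.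
have Csub : is_subspace C.
  split; first by exists 0%N, 0; rewrite coef0 tofrac0 mul0r.
  move=> a _ _ [n [p [p0 ->]]] [m [q [q0 ->]]].
  exists (n + m)%N, (a *: p * 'X^m + q * 'X^n); split.
    rewrite coefD !coefMXn coefZ -{1}addnBA // subnn addn0 addKn p0 q0 mulr0.
    by rewrite !if_same addr0.
  (* common denominator [tvar ^+ (n + m)] *)
  have shift (x : ratfun) i j : x * tinv ^+ i = x * tvar ^+ j * tinv ^+ (i + j).
    by rewrite exprD mulrACA tvarXV mulr1.
  rewrite tofracD mulrDl !tofracM !tofracXn -/tvar -shift addnC -shift.
  by rewrite -mul_polyC tofracM -mulrA.
have [|phi [phi1 phi0]] := @exists_functional k ratfun (Subspace Csub) 1.
  move=> [n [p [p0 E]]].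
  have : FracField.tofrac ('X^n : {poly k}) = FracField.tofrac p.
    rewrite tofracXn -[LHS]mulr1 [X in _ * X]E mulrCA -/tvar tvarXV mulr1 //.
  move/eqP; rewrite tofrac_eq => /eqP E'.
  by move: p0; rewrite -E' coefXn eqxx => /eqP; rewrite oner_eq0.
exists phi; split=> // i j ij; apply: phi0; exists j, 'X^i; split.
  by rewrite coefXn eq_sym (negbTE ij).
by rewrite tofracXn.
Qed.
End RationalFunctions.

Section Translation.
Variable k : fieldType.
Local Notation kG := (kG k).
Local Notation univ := (univ_mx k).

Lemma contract_linear (U V : lmodType k) (phi : {linear V -> k^o}) :
  linear (@contract k U V phi).
Proof. by apply/tlift_linear/contract_bilin. Qed.

Lemma contract_pure (U V : lmodType k) (phi : {linear V -> k^o}) (u : U) v :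
  contract phi (pure u v) = (phi v : k) *: u.
Proof. by rewrite /contract tlift_pure //; apply: contract_bilin. Qed.

Lemma contract_tmap (U U' V : lmodType k) (phi : {linear V -> k^o}) (f : U -> U')
    (t : tensor U V) : linear f -> contract phi (tmap f id t) = f (contract phi t).
Proof.
move=> lf; have li := @linear_id k V.
apply: (tensor_ext (f := contract phi \o tmap f id) (g := f \o contract phi)).
- exact: (linear_comp (tmap_linear lf li) (contract_linear phi)).
- exact: (linear_comp (contract_linear phi) lf).
- by move=> u v; rewrite /= tmap_pure // !contract_pure (linZ lf).
Qed.

Lemma det_lr (A B : comAlgType k) (g : 'M[A]_2) (x : 'M[B]_2) :
  \det g = 1 -> \det x = 1 ->
  \det (map_mx (@tinl k A B) g *m map_mx (@tinr k A B) x) = 1.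
Proof. by move=> dg dx; rewrite det_mulmx !det_map_mx dg dx !rmorph1 mulr1. Qed.

Section Rtrans.
Variables (B : comAlgType k) (x : 'M[B]_2) (dx : \det x = 1).

Definition rtrans_mx : 'M[tensor kG B]_2 :=
  map_mx (@tinl k kG B) univ *m map_mx (@tinr k kG B) x.
Lemma det_rtrans : \det rtrans_mx = 1.
Proof. exact: det_lr (det_univ k) dx. Qed.

(** The right translate [f(_ x)] of [f] by a point [x] over [B], with coefficients
    in [B]. *)
Definition rtrans : {lrmorphism kG -> tensor kG B} := ev_alg det_rtrans.

(** Right translations commute with the left action.  After [th] reorders the tensor
    factors, both sides evaluate [f] at [g^-1 y x], with [g] and [y] the universal points. *)
Lemma rtrans_coact (phi : {linear B -> k^o}) (f : kG) :
  coact (lreg k) (contract phi (rtrans f)) =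
  tmap (contract phi \o rtrans) id (coact (lreg k) f).
Proof.
pose dl := det_act (det_univ k) (det_univ k).
pose lam : {lrmorphism kG -> tensor kG kG} := ev_alg dl.
pose idB : {lrmorphism B -> B} := idfun.
pose idG : {lrmorphism kG -> kG} := idfun.
pose th : {lrmorphism tensor (tensor kG B) kG -> tensor (tensor kG kG) B} :=
  tcopair (tcopair (@tinl k (tensor kG kG) B \o @tinl k kG kG) (@tinr k (tensor kG kG) B))
    (@tinl k (tensor kG kG) B \o @tinr k kG kG).
have lr : linear rtrans by exact: linearP.
have lc := contract_linear (U := kG) phi.
have li := @linear_id k kG.
have thE t : tmap (contract phi) id t = contract phi (th t).
  apply: (tensor_ext (g := contract phi \o th)).
  - exact: tmap_linear.
  - exact: (linear_comp (linearP th) (contract_linear phi)).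
  move=> u c; rewrite tmap_pure //.
  rewrite [RHS](congr1 (contract phi) (tcopair_pure _ _ _ _)).
  elim/tensor_ind: u => [|u u' E E'|a b].
  - by rewrite (lin0 lc) pure0l rmorph0 mul0r (lin0 (contract_linear _)).
  - by rewrite (linD lc) pureDl E E' rmorphD mulrDl (linD (contract_linear _)).
  rewrite contract_pure pureZl [X in X * _]tcopair_pure /= /tinl /tinr !pureM contract_pure.
  by rewrite !mulr1 !mul1r.
rewrite -(tmap_comp _ lr lc li li) thE.
rewrite -[LHS](contract_tmap phi (rtrans f) (linearP lam)); congr contract.
rewrite -[LHS](tmap_algE lam idB) -[X in _ = th X](tmap_algE rtrans idG).
rewrite [LHS]ev_map; symmetry.
rewrite [coact _ _]/(lreg_coact_fun _) /lreg_coact_fun.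
rewrite [X in th X]ev_map [LHS]ev_map; apply: eq_ev.
pose adj_mx := map_mx (@tinl k (tensor kG kG) B \o @tinr k kG kG) (\adj univ).
pose uni_mx := map_mx (@tinl k (tensor kG kG) B \o @tinl k kG kG) univ.
pose xm := map_mx (@tinr k (tensor kG kG) B) x.
transitivity (adj_mx *m (uni_mx *m xm)).
  rewrite !map_mxM; congr (_ *m _).
    rewrite -2![LHS]map_mx_comp; apply/eq_map_mx => b /=.
    by rewrite [X in th X]tcopair_inr /= tcopair_inr.
  transitivity (map_mx th (map_mx (@tinl k (tensor kG B) kG) (map_mx rtrans univ))).
    rewrite -2![LHS]map_mx_comp -2![RHS]map_mx_comp; apply/eq_map_mx => b /=.
    by rewrite [X in th X]tcopair_inl.
  rewrite [X in map_mx _ (map_mx _ X)](ev_univ det_rtrans) !map_mxM; congr (_ *m _).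
    rewrite -2![LHS]map_mx_comp; apply/eq_map_mx => b /=.
    by rewrite tcopair_inl [LHS]tcopair_inl.
  rewrite -2![LHS]map_mx_comp; apply/eq_map_mx => b /=.
  by rewrite tcopair_inl [LHS]tcopair_inr.
rewrite map_mxM mulmxA; congr (_ *m _); last first.
  rewrite -[RHS]map_mx_comp; apply/eq_map_mx => b /=.
  by rewrite [RHS]tcopair_inr.
transitivity (map_mx (@tinl k (tensor kG kG) B) (map_mx lam univ)).
  rewrite [in RHS](ev_univ dl) [RHS]map_mxM; congr (_ *m _); exact: (map_mx_comp _ _ _).
rewrite -[LHS]map_mx_comp -[RHS]map_mx_comp; apply/eq_map_mx => b.
by rewrite [RHS]tcopair_inl.
Qed.
End Rtrans.

Definition diag2 (A : comAlgType k) (t s : A) : 'M[A]_2 :=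
  \matrix_(i, j) (if i == j then if j == 0 then t else s else 0).

Lemma diag2_mx (A : comAlgType k) (t s : A) :
  diag2 t s = diag_mx (\row_j (if j == 0 then t else s)).
Proof. by apply/matrixP => i j; rewrite !mxE mulrb; case: eqVneq => [->|]. Qed.

Lemma det_diag2 (A : comAlgType k) (t s : A) : \det (diag2 t s) = t * s.
Proof.
by rewrite diag2_mx det_diag big_ord_recl big_ord1 !mxE.
Qed.

Lemma diag2P (A : comAlgType k) (h : 'M[A]_2) :
  is_diag_mx h -> h = diag2 (h 0 0) (h 1 1).
Proof.
move/is_diag_mxP => Dh; apply/matrixP => i j; rewrite mxE.
case: eqVneq => [->|ij]; last exact: Dh.
by case: (ord2 j) => ->.
Qed.

Lemma mul_diag2 (A : comAlgType k) (g : 'M[A]_2) (t s : A) i j :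
  (g *m diag2 t s) i j = g i j * (if j == 0 then t else s).
Proof. by rewrite diag2_mx mul_mx_diag !mxE. Qed.

Lemma torus_diag2 (A : comAlgType k) (t s : A) : t * s = 1 -> torus k A (diag2 t s).
Proof.
move=> ts; split; first by rewrite det_diag2.
by rewrite diag2_mx diag_mx_is_diag.
Qed.

(** The scalars [t] and [s] are arbitrary, not inverse to each other, so that monomials
    have two well-defined exponents; the weight for the torus is [m - n]. *)
Definition biweight (m n : nat) (p : {mpoly k[2 * 2]}) : Prop :=
  forall (A : comAlgType k) (g : 'M[A]_2) (t s : A),
    peval (g *m diag2 t s) p = t ^+ m * s ^+ n * peval g p.

Lemma biweightM m n m' n' p p' :
  biweight m n p -> biweight m' n' p' -> biweight (m + m') (n + n') (p * p').
Proof.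
by move=> wp wp' A g t s; rewrite !pevalM wp wp' !exprD mulrACA [_ * (_ * s ^+ n')]mulrACA.
Qed.

Lemma biweight1 : biweight 0 0 1.
Proof. by move=> A g t s; rewrite !peval1 mul1r mulr1. Qed.

Lemma biweight_monomial (u : 'X_{1..2 * 2}) : exists m n, biweight m n 'X_[u].
Proof.
rewrite mpolyXE_id.
elim/big_ind: _ => [|p q [m [n wp]] [m' [n' wq]]|i _].
- by exists 0%N, 0%N; exact: biweight1.
- by exists (m + m')%N, (n + n')%N; exact: biweightM.
have [m [n wi]] : exists m n, biweight m n 'X_i.
  case/mxvec_indexP: i => a b.
  exists (nat_of_bool (b == 0)), (nat_of_bool (b != 0)) => A g t s.
  rewrite /peval !mmapX !mmap1U !mxvecE mul_diag2 mulrC.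
  by case: eqP => _ /=; rewrite ?expr1 ?expr0 ?mulr1 ?mul1r.
elim: (u i) => [|e [m' [n' we]]].
  by exists 0%N, 0%N; rewrite expr0; exact: biweight1.
by exists (m + m')%N, (n + n')%N; rewrite exprS; exact: biweightM.
Qed.

Lemma torus_invariantP (m : nat) (p : {mpoly k[2 * 2]}) :
  biweight m m p -> right_invariant (torus k) (kG_class p).
Proof.
move=> wp A g h dg Th; have dh := points_det Th.
rewrite !ev_class // ?det_mulmx ?dg ?dh ?mulr1 //.
have hh : h 0 0 * h 1 1 = 1 by rewrite -det_diag2 -(diag2P Th.2).
by rewrite (diag2P Th.2) wp -exprMn hh expr1n mul1r.
Qed.

(** Averaging over right translations by the torus, with [phi] as invariant integral. *)
Section WeightZero.
Variables (phi : {linear ratfun k -> k^o}) (phi1 : phi 1 = 1).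
Hypothesis phi0 : forall i j, i != j -> phi (tvar k ^+ i * tinv k ^+ j) = 0.

Definition gen_torus : 'M[ratfun k]_2 := diag2 (tvar k) (tinv k).
Lemma det_gen_torus : \det gen_torus = 1.
Proof. by rewrite det_diag2 tvarV. Qed.

Definition weight_zero (f : kG) : kG := contract phi (rtrans det_gen_torus f).

Lemma weight_zero_linear : linear weight_zero.
Proof. exact: (linear_comp (linearP (rtrans det_gen_torus)) (contract_linear phi)). Qed.

Lemma weight_zero_biweight m n p : biweight m n p ->
  weight_zero (kG_class p) = ((m == n)%:R : k) *: kG_class p.
Proof.
move=> wp; rewrite /weight_zero /= ev_class ?det_rtrans ?det_gen_torus //.
have -> : rtrans_mx gen_torus = map_mx (@tinl k kG (ratfun k)) univ *m
    diag2 (tinr kG (tvar k)) (tinr kG (tinv k)).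
  congr (_ *m _); apply/matrixP => i j; rewrite !mxE.
  by case: eqP => _; rewrite ?rmorph0 //; case: eqP.
rewrite wp -2!(rmorphXn (@tinr k kG (ratfun k))) -(rmorphM (@tinr k kG (ratfun k))) mulrC /=.
have -> : peval (map_mx (@tinl k kG (ratfun k)) univ) p = tinl (ratfun k) (kG_class p).
  rewrite -(ev_class p (_ : \det _ = 1)); last by rewrite (det_map_mx (@tinl k kG _)) det_univ rmorph1.
  by rewrite -[X in tinl _ X]ev_id; symmetry; exact: ev_map.
rewrite -[X in contract _ X]pure_tin contract_pure; congr (_ *: _).
case: eqVneq => [->|]; last exact: phi0.
by rewrite tvarXV.
Qed.

(** The classes of the monomials span [k[G]]; each of them has a biweight, and only those
    whose two exponents are equal survive the projection. *)
Lemma weight_zero_invariant f : right_invariant (torus k) (weight_zero f).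
Proof.
elim/kG_ind: f => p; elim/mpolyind: p => [|c u p _ _ IH].
  rewrite /kG_class rmorph0 (lin0 weight_zero_linear).
  exact: (subspace0 (kG_inv (torus k))).
rewrite kG_classD kG_classZ weight_zero_linear.
apply: (subspaceD (S := kG_inv (torus k))); last exact: IH.
apply: (subspaceZ (S := kG_inv (torus k))).
have [m [n wu]] := biweight_monomial u; rewrite (weight_zero_biweight wu).
case: eqP => [E|_]; last by rewrite scale0r; apply: (subspace0 (kG_inv (torus k))).
rewrite scale1r; move: wu; rewrite E; exact: torus_invariantP.
Qed.

Lemma weight_zero_id f : right_invariant (torus k) f -> weight_zero f = f.
Proof.
move=> If; rewrite /weight_zero /= /rtrans_mx.
have dl : \det (map_mx (@tinl k kG (ratfun k)) univ) = 1.
  by rewrite (det_map_mx (@tinl k kG _)) det_univ rmorph1.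
rewrite If //; last first.
  by apply: (points_map (@tinr k kG _)); apply: torus_diag2; apply: tvarV.
by rewrite -(ev_map (@tinl k kG _)) ev_id contract_pure phi1 scale1r.
Qed.
End WeightZero.

Lemma weight_zero_hom : exists r : hom (lreg k) (kG_mod_T k),
  forall x : kG_mod_T k, r (kGmod_val x) = x.
Proof.
have [phi [phi1 phi0]] := constant_term k.
pose w : hom (lreg k) (lreg k) := @mkhom k (lreg k) (lreg k) _
  (@weight_zero_linear phi) (rtrans_coact det_gen_torus phi).
exists (corestrict (f := w) (@kG_inv_subcomodule k (torus k))
  (weight_zero_invariant phi1 phi0)) => x.
by apply: val_inj; apply: (weight_zero_id phi1); exact: (sub_spaceP x).
Qed.

(** Induction from the linearly reductive group [T] turns the injective [T]-module [k]
    into an injective [G]-module. *)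
Lemma kG_mod_T_injective : injective_mod (kG_mod_T k).
Proof.
have [r rK] := weight_zero_hom.
exact: (injective_retract (i := sub_incl (@kG_inv_subcomodule k (torus k))) rK (@lreg_injective k)).
Qed.
End Translation.

(** * Functions invariant under the normalizer of the torus *)

Section Normalizer.
Variable k : fieldType.
Hypothesis char2 : 2%N \in [pchar k].
Local Notation kG := (kG k).
Local Notation univ := (univ_mx k).
Local Notation T := (torus k).
Local Notation N := (normalizer (torus k)).

Lemma addvv_char2 (V : lmodType k) (x : V) : x + x = 0.
Proof. by rewrite -[x]scale1r -scalerDl -[1 + 1]/(2%:R) (pcharf0 char2) scale0r. Qed.

Lemma oppv_char2 (V : lmodType k) (x : V) : - x = x.
Proof. by apply/eqP; rewrite eq_sym -subr_eq0 opprK addvv_char2. Qed.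

Definition sigma_mx (A : comAlgType k) : 'M[A]_2 := \matrix_(i, j) (i != j)%:R.

Lemma mul_sigma_mx (A : comAlgType k) (g : 'M[A]_2) i :
  (g *m sigma_mx A) i 0 = g i 1 /\ (g *m sigma_mx A) i 1 = g i 0.
Proof.
by split; rewrite mxE big_ord_recl big_ord1 !mxE /= ?mulr0 ?mulr1 ?add0r ?addr0 //;
  congr (g _ _); apply: val_inj.
Qed.

Lemma sigma_mxK (A : comAlgType k) : sigma_mx A *m sigma_mx A = 1%:M.
Proof.
apply/matrixP => i j; have [E0 E1] := mul_sigma_mx (sigma_mx A) i.
by case: (ord2 j) => ->; rewrite ?E0 ?E1 !mxE; case: (ord2 i) => ->.
Qed.

Lemma det_sigma_mx (A : comAlgType k) : \det (sigma_mx A) = 1.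
Proof.
rewrite det2E !mxE /= mul0r mulr1 add0r.
exact: (@oppv_char2 A).
Qed.

Lemma map_sigma_mx (A B : comAlgType k) (phi : {lrmorphism A -> B}) :
  map_mx phi (sigma_mx A) = sigma_mx B.
Proof. by apply/matrixP => i j; rewrite !mxE rmorph_nat. Qed.

Lemma adj_sigma_mx (A : comAlgType k) : \adj (sigma_mx A) = sigma_mx A.
Proof. by rewrite -[LHS]mulmx1 -(sigma_mxK A) mulmxA mul_adj_mx det_sigma_mx mul1mx. Qed.

Lemma sig_diag2 (A : comAlgType k) (t s : A) :
  sigma_mx A *m diag2 t s *m sigma_mx A = diag2 s t.
Proof.
apply/matrixP => i j.
have [E0 E1] := mul_sigma_mx (sigma_mx A *m diag2 t s) i.
by case: (ord2 j) => ->; rewrite ?E0 ?E1 mul_diag2 !mxE; case: (ord2 i) => -> /=;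
  rewrite ?mul0r ?mul1r.
Qed.

Lemma torus_sig (A : comAlgType k) (x : 'M[A]_2) : T A x -> T A (sigma_mx A *m x *m sigma_mx A).
Proof.
move=> [dx Dx]; rewrite (diag2P Dx) sig_diag2; apply: torus_diag2.
by rewrite mulrC -det_diag2 -(diag2P Dx).
Qed.

Lemma diag2M (A : comAlgType k) (t s t' s' : A) :
  diag2 t s *m diag2 t' s' = diag2 (t * t') (s * s').
Proof.
apply/matrixP => i j; rewrite mul_diag2 !mxE.
by case: (ord2 i) => ->; case: (ord2 j) => ->; rewrite /= ?mul0r.
Qed.

Lemma adj_diag2 (A : comAlgType k) (t s : A) : t * s = 1 -> \adj (diag2 t s) = diag2 s t.
Proof.
move=> ts; rewrite -[LHS]mulmx1.
have -> : 1%:M = diag2 t s *m diag2 s t.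
  rewrite diag2M (mulrC s) ts; apply/matrixP => i j; rewrite !mxE.
  by case: (ord2 i) => ->; case: (ord2 j) => ->.
by rewrite mulmxA mul_adj_mx det_diag2 ts mul1mx.
Qed.

Lemma torus_conj (A : comAlgType k) (x h : 'M[A]_2) :
  T A h -> T A x -> T A (h *m x *m \adj h).
Proof.
move=> [dh Dh] [dx Dx]; move: dh dx.
rewrite (diag2P Dh) (diag2P Dx) !det_diag2 => hh xx.
rewrite adj_diag2 // !diag2M; apply: torus_diag2.
have -> : h 0 0 * x 0 0 * h 1 1 * (h 1 1 * x 1 1 * h 0 0) =
    (h 0 0 * h 1 1) * (x 0 0 * x 1 1) * (h 0 0 * h 1 1) by ring.
by rewrite hh xx !mulr1.
Qed.

Lemma conjK (A : comAlgType k) (x h : 'M[A]_2) : \det h = 1 ->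
  \adj h *m (h *m x *m \adj h) *m h = x.
Proof.
move=> dh; rewrite !mulmxA mul_adj_mx dh mul1mx -mulmxA mul_adj_mx dh.
by rewrite mulmx1.
Qed.

Lemma torus_normalizer (A : comAlgType k) (h : 'M[A]_2) : T A h -> N A h.
Proof.
move=> Th; split=> [|B phi x dx]; first exact: points_det Th.
have {Th} Th := points_map phi Th; set g := map_mx phi h in Th *.
have dg := points_det Th.
have Tag : T B (\adj g).
  move: dg; rewrite (diag2P Th.2) det_diag2 => gg.
  by rewrite adj_diag2 //; apply: torus_diag2; rewrite mulrC.
split; last exact: torus_conj.
by move=> /(torus_conj Tag); rewrite adjK2 conjK.
Qed.

Lemma sig_normalizer (A : comAlgType k) : N A (sigma_mx A).
Proof.
split=> [|B phi x dx]; first exact: det_sigma_mx.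
rewrite map_sigma_mx adj_sigma_mx; split; last exact: torus_sig.
by move/torus_sig; rewrite !mulmxA sigma_mxK mul1mx -mulmxA sigma_mxK mulmx1.
Qed.

Let conj_entry_aux (B : comNzRingType) (a b t s : B) :
  t * s = 1 -> a * t * b + b * s * a = 0 -> a * b * (t ^+ 2 + 1) = 0.
Proof.
move=> ts E; rewrite -[RHS](mul0r t) -E -ts; ring.
Qed.

(** Conjugating the generic point of the torus by a point of the normalizer shows that
    the latter is locally diagonal or antidiagonal. *)
Lemma normalizer_entries (A : comAlgType k) (h : 'M[A]_2) : N A h ->
  h 0 0 * h 0 1 = 0 /\ h 1 0 * h 1 1 = 0.
Proof.
move=> [dh Nh]; have [phi [phi1 phi0]] := constant_term k.
pose R := ratfun k.
pose B := tensor A R; pose g := map_mx (@tinl k A R) h.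
pose t : B := tinr A (tvar k); pose s : B := tinr A (tinv k).
have ts : t * s = 1 by rewrite -(rmorphM (@tinr k A R)) tvarV rmorph1.
have Tx := torus_diag2 ts.
have [_ /is_diag_mxP Dg] := (Nh B (@tinl k A R) _ (points_det Tx)).2 Tx.
have [a00 a01 a10 a11] := adj2E g.
have key (a b : A) : tinl R a * t * tinl R b + tinl R b * s * tinl R a = 0 -> a * b = 0.
  move=> E.
  have {E} : pure (a * b) (tvar k ^+ 2 * tinv k ^+ 0 + 1) = 0.
    have -> : tvar k ^+ 2 * tinv k ^+ 0 + 1 = tvar k ^+ 2 + 1 by rewrite expr0 mulr1.
    have E2 : tinr A (tvar k ^+ 2 + 1) = t ^+ 2 + 1.
      by rewrite (rmorphD (@tinr k A R)) (rmorphXn (@tinr k A R)).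
    rewrite pure_tin E2 (rmorphM (@tinl k A R)); exact: conj_entry_aux ts E.
  move/(congr1 (contract phi)); rewrite contract_pure (lin0 (contract_linear _)).
  by rewrite linearD phi0 // add0r phi1 scale1r.
have row2 i j : (g *m diag2 t s *m \adj g) i j =
    g i 0 * t * (\adj g) 0 j + g i 1 * s * (\adj g) 1 j.
  rewrite mxE big_ord_recl big_ord1 !mul_diag2 /=.
  by rewrite (_ : lift _ _ = 1 :> 'I_2) //; apply: val_inj.
split; apply: key.
  have := Dg 0 1 isT; rewrite row2 a01 a11 mulrN (oppv_char2 (_ : B)) !mxE => <-.
  by [].
have := Dg 1 0 isT; rewrite row2 a00 a10 mulrN (oppv_char2 (_ : B)) !mxE => <-.
by [].
Qed.

(** Points that are congruent modulo the annihilator of [e] have congruent values. *)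
Lemma ev_congr (A : comAlgType k) (e : A) (g g' : 'M[A]_2) (f : kG) :
  \det g = 1 -> \det g' = 1 -> (forall i j, e * g i j = e * g' i j) ->
  e * ev g f = e * ev g' f.
Proof.
move=> dg dg' E; elim/kG_ind: f => p; rewrite !ev_class //.
elim/mpolyind: p => [|c u p _ _ IH]; first by rewrite !rmorph0.
rewrite !peval_linear !mulrDr IH -!scalerAr; congr (c *: _ + _).
rewrite /peval !mmapX /mmap1; elim/big_rec2: _ => [//|i x y _ Exy].
have Ei : e * mxvec g 0 i = e * mxvec g' 0 i.
  by case/mxvec_indexP: i => a b; rewrite !mxvecE.
elim: (u i) => [|n IHn]; first by rewrite !expr0 !mul1r.
by rewrite !exprS -!mulrA [LHS]mulrA Ei -mulrA [LHS]mulrCA IHn [RHS]mulrCA.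
Qed.

Lemma mulmx_congr (A : comAlgType k) (e : A) (g h h' : 'M[A]_2) :
  (forall i j, e * h i j = e * h' i j) ->
  forall i j, e * (g *m h) i j = e * (g *m h') i j.
Proof.
move=> E i j; rewrite !mxE !mulr_sumr; apply: eq_bigr => l _.
by rewrite mulrCA E mulrCA.
Qed.

Definition sigma_translate (f : kG) : kG := ev (univ *m sigma_mx kG) f.
Local Notation rs := sigma_translate.

Lemma det_univ_sigma : \det (univ *m sigma_mx kG) = 1.
Proof. by rewrite det_mulmx det_univ det_sigma_mx mulr1. Qed.
Lemma rs_linear : linear rs. Proof. exact: ev_linear det_univ_sigma. Qed.
Lemma rsM : {morph rs : f f' / f * f'}. Proof. exact: evM det_univ_sigma. Qed.
Lemma rs1 : rs 1 = 1. Proof. exact: ev1 det_univ_sigma. Qed.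

Lemma ev_rs (A : comAlgType k) (g : 'M[A]_2) f : \det g = 1 ->
  ev g (rs f) = ev (g *m sigma_mx A) f.
Proof.
move=> dg; apply: (etrans (ev_map (ev_alg dg) _ f)); apply: eq_ev.
by rewrite map_mxM map_sigma_mx; congr (_ *m _); exact: (ev_univ dg).
Qed.

Lemma rsK f : rs (rs f) = f.
Proof.
by rewrite {1}/sigma_translate ev_rs ?det_univ_sigma // -mulmxA sigma_mxK mulmx1 ev_id.
Qed.

Lemma rs_coact (f : kG) : coact (lreg k) (rs f) = tmap rs id (coact (lreg k) f).
Proof.
pose R : {lrmorphism kG -> kG} := ev_alg det_univ_sigma.
pose dl := det_act (det_univ k) (det_univ k).
rewrite [LHS](ev_rs _ dl) -[tmap rs id _](tmap_algE R (idfun : {lrmorphism kG -> kG})).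
rewrite [RHS](ev_map _ _ _); apply: eq_ev.
rewrite [RHS]map_mxM -mulmxA; congr (_ *m _).
  rewrite -[RHS]map_mx_comp; apply/eq_map_mx => x.
  by rewrite [RHS]tcopair_inr.
transitivity (map_mx (@tinl k kG kG) (map_mx R univ)).
  rewrite [X in _ = map_mx _ X](ev_univ det_univ_sigma) [RHS]map_mxM.
  by congr (_ *m _); symmetry; exact: map_sigma_mx.
rewrite -[LHS]map_mx_comp -[RHS]map_mx_comp; apply/eq_map_mx => x.
by rewrite [RHS]tcopair_inl.
Qed.

Lemma rs_torus f : right_invariant T f -> right_invariant T (rs f).
Proof.
move=> If A g h dg Th; have dh := points_det Th.
rewrite !ev_rs ?det_mulmx ?dg ?dh ?mulr1 //.
have -> : g *m h *m sigma_mx A = (g *m sigma_mx A) *m (sigma_mx A *m h *m sigma_mx A).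
  by rewrite !mulmxA -[g *m sigma_mx A *m sigma_mx A]mulmxA sigma_mxK mulmx1.
by apply: If; rewrite ?det_mulmx ?dg ?det_sigma_mx ?mulr1 //; exact: torus_sig.
Qed.

Lemma normalizer_torus f : right_invariant N f -> right_invariant T f.
Proof. by move=> If A g h dg Th; apply: If => //; exact: torus_normalizer. Qed.

(** Since [pq = rs = 0] and [ps + qr = 1] for a point of [N] with rows [(p, q)] and
    [(r, s)], the elements [ps] and [qr] are complementary idempotents: the point is
    diagonal where [ps] is one and antidiagonal where [qr] is one. *)
Lemma normalizer_invariantP f :
  right_invariant N f <-> right_invariant T f /\ rs f = f.
Proof.
split=> [If|[If rf] A g h dg Nh].
  split; first exact: normalizer_torus.
  rewrite -[LHS]ev_id ev_rs ?det_univ // If ?ev_id ?det_univ //; exact: sig_normalizer.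
have dh := points_det Nh; have [E0 E1] := normalizer_entries Nh.
have dgh : \det (g *m h) = 1 by rewrite det_mulmx dg dh mulr1.
move: E0 E1 (dh).
set p := h 0 0; set q := h 0 1; set r := h 1 0; set s := h 1 1 => pq rs0.
rewrite det2E -/p -/q -/r -/s (@oppv_char2 A) => ee1.
pose e := p * s; pose e' := q * r.
have ee' : e * e' = 0.
  have -> : e * e' = p * q * (s * r) by rewrite /e /e'; ring.
  by rewrite pq mul0r.
have ee : e * e = e by rewrite -[LHS]addr0 -ee' -mulrDr ee1 mulr1.
have e'e' : e' * e' = e' by rewrite -[LHS]add0r -ee' -mulrDl ee1 mul1r.
have er : e * r = 0.
  have -> : e * r = p * (r * s) by rewrite /e; ring.
  by rewrite rs0 mulr0.
have eq : e * q = 0.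
  have -> : e * q = p * q * s by rewrite /e; ring.
  by rewrite pq mul0r.
have e'p : e' * p = 0.
  have -> : e' * p = p * q * r by rewrite /e'; ring.
  by rewrite pq mul0r.
have e's : e' * s = 0.
  have -> : e' * s = q * (r * s) by rewrite /e'; ring.
  by rewrite rs0 mulr0.
(* [x * e + y * e'] is the element equal to [x] on the component of [e] and to [y] on
   that of [e'] *)
have mix x y : e * (x * e + y * e') = e * x /\ e' * (x * e + y * e') = e' * y.
  have -> : e * (x * e + y * e') = x * (e * e) + y * (e * e') by ring.
  have -> : e' * (x * e + y * e') = x * (e * e') + y * (e' * e') by ring.
  by rewrite ee e'e' ee' !mulr0 addr0 add0r ![_ * e]mulrC ![_ * e']mulrC.
have mixM x y x' y' : (x * e + y * e') * (x' * e + y' * e') =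
    x * x' * e + y * y' * e'.
  have -> : (x * e + y * e') * (x' * e + y' * e') =
    x * x' * (e * e) + (x * y' + y * x') * (e * e') + y * y' * (e' * e') by ring.
  by rewrite ee e'e' ee' mulr0 addr0.
have esum : e + e' = 1 by exact: ee1.
(* [h] agrees on the component of [e] with the diagonal matrix of entries [p], [s], and on
   the component of [e'] with [sigma] times the diagonal matrix of entries [r], [q] *)
have T1 : T A (diag2 (p * e + 1 * e') (s * e + 1 * e')).
  apply: torus_diag2; rewrite mixM -/e ee !mul1r; exact: esum.
have T2 : T A (diag2 (1 * e + r * e') (1 * e + q * e')).
  by apply: torus_diag2; rewrite mixM !mul1r [r * q]mulrC -/e' e'e'.
have d1 := points_det T1; have d2 := points_det T2.
have dgs : \det (g *m sigma_mx A) = 1 by rewrite det_mulmx dg det_sigma_mx mulr1.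
have F1 : e * ev (g *m h) f = e * ev g f.
  rewrite -(If _ _ _ dg T1); apply: ev_congr => //; first by rewrite det_mulmx dg d1 mulr1.
  apply: mulmx_congr => i j; rewrite [in RHS]mxE.
  case: (ord2 i) => ->; case: (ord2 j) => -> /=; rewrite ?mulr0 ?(mix _ _).1 //.
have F2 : e' * ev (g *m h) f = e' * ev g f.
  rewrite -[in RHS]rf ev_rs // -(If _ _ _ dgs T2).
  apply: ev_congr => //; first by rewrite det_mulmx dgs d2 mulr1.
  rewrite -mulmxA; apply: mulmx_congr => i j; rewrite mul_diag2.
  case: (ord2 i) => ->; case: (ord2 j) => -> /=; rewrite mxE /= ?mul0r ?mul1r ?mulr0.
  - exact: e'p.
  - by have := (mix 1 q).2; rewrite mul1r => ->.
  - by have := (mix 1 r).2; rewrite mul1r => ->.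
  - exact: e's.
by rewrite -[LHS]mul1r -[RHS]mul1r -esum !mulrDl F1 F2.
Qed.

(** * The extension of [k[G/N]] by itself *)

Lemma univ_sig_entries i : rs (univ i 0) = univ i 1 /\ rs (univ i 1) = univ i 0.
Proof.
have E j : rs (univ i j) = (univ *m sigma_mx kG) i j.
  by rewrite -[in RHS](ev_univ det_univ_sigma) [RHS]mxE.
by rewrite !E; exact: mul_sigma_mx.
Qed.

Definition ad : kG := univ 0 0 * univ 1 1.

Lemma rs_ad : rs ad = ad + 1.
Proof.
rewrite rsM (univ_sig_entries 0).1 (univ_sig_entries 1).2.
have := det_univ k; rewrite det2E -/ad (@oppv_char2 kG) => <-.
by rewrite addrA (@addvv_char2 kG) add0r.
Qed.

Lemma ad_invariant : right_invariant T ad.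
Proof.
move=> A g h dg Th; have dh := points_det Th.
have dgh : \det (g *m h) = 1 by rewrite det_mulmx dg dh mulr1.
have E (x : 'M[A]_2) : \det x = 1 -> ev x ad = x 0 0 * x 1 1.
  by move=> dx; rewrite evM //; congr (_ * _);
    rewrite -[in RHS](ev_univ dx) [RHS]mxE.
rewrite !E // (diag2P Th.2) !mul_diag2 /= mulrACA.
have hh : h 0 0 * h 1 1 = 1 by rewrite -det_diag2 -(diag2P Th.2).
by rewrite hh mulr1.
Qed.

Local Notation X := (kG_mod_T k).
Local Notation A := (kG_mod_N k).

Lemma kGmod_val_inj (H : subfun k) : injective (@kGmod_val k H).
Proof. exact: val_inj. Qed.
Lemma kGmod_val_linear (H : subfun k) : linear (@kGmod_val k H).
Proof. exact: (@val_linear k (lreg k) (kG_inv H)). Qed.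
Lemma kGmod_valP (H : subfun k) (x : kGmod H) : right_invariant H (kGmod_val x).
Proof. exact: (sub_spaceP x). Qed.

Definition val_hom (H : subfun k) : hom (kGmod H) (lreg k) :=
  sub_incl (@kG_inv_subcomodule k H).
Definition rs_hom : hom (lreg k) (lreg k) :=
  @mkhom k (lreg k) (lreg k) rs rs_linear rs_coact.

Definition sigX : hom X X :=
  corestrict (f := hom_comp rs_hom (val_hom T)) (@kG_inv_subcomodule k T)
    (fun x => rs_torus (kGmod_valP x)).
Lemma sigXE x : kGmod_val (sigX x) = rs (kGmod_val x).
Proof. by []. Qed.

Definition calE_inc : hom A X :=
  corestrict (f := val_hom N) (@kG_inv_subcomodule k T)
    (fun x => normalizer_torus (kGmod_valP x)).

Fact calE_prj_subproof (x : X) :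
  right_invariant N (hom_lc 1 (val_hom T) (hom_comp rs_hom (val_hom T)) x).
Proof.
apply/normalizer_invariantP; rewrite /= scale1r; split.
  apply: (subspaceD (S := kG_inv T)); first exact: kGmod_valP.
  by apply: rs_torus; exact: kGmod_valP.
by rewrite (linD rs_linear) rsK addrC.
Qed.
Definition calE_prj : hom X A :=
  corestrict (@kG_inv_subcomodule k N) calE_prj_subproof.
Lemma calE_prjE x : kGmod_val (calE_prj x) = kGmod_val x + rs (kGmod_val x).
Proof. by rewrite -[rs _]scale1r. Qed.

(** A preimage of [a] under [1 + sigma], since [sigma ad = ad + 1]. *)
Definition ad_mul (a : A) : X :=
  @to_sub _ _ (kG_inv T) (kGmod_val a * ad)
    (right_invariantM (normalizer_torus (kGmod_valP a)) ad_invariant).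

Lemma rs_val (a : A) : rs (kGmod_val a) = kGmod_val a.
Proof. exact: (proj1 (normalizer_invariantP _) (kGmod_valP a)).2. Qed.

Lemma calE_prj_dec (x y : A) (w : X) :
  kGmod_val w = kGmod_val x + kGmod_val y * ad -> calE_prj w = y.
Proof.
move=> E; apply: kGmod_val_inj; rewrite calE_prjE E.
rewrite (linD rs_linear) rsM rs_ad !rs_val mulrDr mulr1.
by rewrite addrACA (@addvv_char2 kG) add0r addrA (@addvv_char2 kG) add0r.
Qed.

Lemma calE_prj_ad a : calE_prj (ad_mul a) = a.
Proof.
apply: (@calE_prj_dec 0); by rewrite (lin0 (@kGmod_val_linear N)) add0r.
Qed.

Lemma calE_exact x : calE_prj x = 0 <-> exists a, x = calE_inc a.
Proof.
split=> [E|[a ->]].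
  have Nx : right_invariant N (kGmod_val x).
    apply/normalizer_invariantP; split; first exact: kGmod_valP.
    have := congr1 (@kGmod_val k N) E; rewrite calE_prjE (lin0 (@kGmod_val_linear N)).
    by move/eqP; rewrite addrC addr_eq0 (@oppv_char2 kG) => /eqP.
  by exists (@to_sub _ _ (kG_inv N) _ Nx); apply: kGmod_val_inj.
apply: (@calE_prj_dec a 0); rewrite (lin0 (@kGmod_val_linear N)) mul0r addr0 //.
Qed.

Lemma calE_inc_inj : injective calE_inc.
Proof. by move=> a b /(congr1 (@kGmod_val k T)) E; apply: kGmod_val_inj. Qed.

Definition calE : ses A X A :=
  Ses calE_inc_inj (fun a => ex_intro _ _ (calE_prj_ad a)) calE_exact.

Lemma calE_is_calE : is_calE calE.
Proof. by split=> // x y w; exact: calE_prj_dec. Qed.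

(** The conditions on [E] determine its two maps; the projection is [1 + sigma]. *)
Lemma is_calE_prj (E : ses A X A) : is_calE E ->
  forall w, ses_inc E (ses_prj E w) = w + sigX w.
Proof.
move=> [Einc Eprj] w; apply: kGmod_val_inj; rewrite Einc.
rewrite (linD (@kGmod_val_linear T)) sigXE.
rewrite -calE_prjE; congr kGmod_val.
(* [w = (w + y * ad) + y * ad], where both [w + y * ad] and [y] are invariant under [N] *)
pose y := calE_prj w.
have Nx : calE_prj (w + ad_mul y) = 0.
  by rewrite linearD calE_prj_ad (@addvv_char2 A).
have [x Ex] := (calE_exact _).1 Nx.
apply: (Eprj x); rewrite -[kGmod_val x]/(kGmod_val (calE_inc x)) -Ex.
by rewrite (linD (@kGmod_val_linear T)) -addrA (@addvv_char2 kG) addr0.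
Qed.

End Normalizer.

(** * Tensor products of rational modules *)

Section TensorModules.
Variable k : fieldType.
Implicit Types M Y Z : ratmod k.

Lemma tmap_tbil (U V W U' V' W' : lmodType k) (A B : comAlgType k)
    (b : U -> V -> W) (b' : U' -> V' -> W') (f : U -> U') (g : V -> V') (h : W -> W')
    (phi : {lrmorphism A -> B}) (s : tensor U A) (t : tensor V A) :
  bilin b -> bilin b' -> linear f -> linear g -> linear h ->
  (forall x y, h (b x y) = b' (f x) (g y)) ->
  tmap h phi (tbil b *%R s t) = tbil b' *%R (tmap f phi s) (tmap g phi t).
Proof.
move=> bb bb' lf lg lh E; have lp : linear phi by exact: linearP.
have B1 := tbil_bilin bb (mul_bilin A); have B2 := tbil_bilin bb' (mul_bilin B).
have lm := tmap_linear lh lp.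
have lf' := tmap_linear lf lp; have lg' := tmap_linear lg lp.
elim/tensor_ind: s => [|s s' Es Es'|x a].
- by rewrite (lin0 (B1.1 t)) (lin0 lm) (lin0 lf') (lin0 (B2.1 _)).
- by rewrite (linD (B1.1 t)) (linD lm) (linD lf') (linD (B2.1 _)) /= Es Es'.
elim/tensor_ind: t => [|t t' Et Et'|y c].
- by rewrite (lin0 (B1.2 _)) (lin0 lm) (lin0 lg') (lin0 (B2.2 _)).
- by rewrite (linD (B1.2 _)) (linD lm) (linD lg') (linD (B2.2 _)) /= Et Et'.
rewrite !tmap_pure // !tbil_pure //; try exact: mul_bilin.
by rewrite tmap_pure // E rmorphM.
Qed.

Section Construction.
Variables M Y : ratmod k.

Definition tens_coact_fun : tensor M Y -> tensor (tensor M Y) (kG k) :=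
  tlift (fun m y => tbil (@pure k M Y) *%R (coact M m) (coact Y y)).

Fact tens_coact_bilin :
  bilin (fun m y => tbil (@pure k M Y) *%R (coact M m) (coact Y y)).
Proof.
have B := tbil_bilin (pure_bilin M Y) (mul_bilin (kG k)).
by split=> [y|m] a x z; rewrite linearP; [exact: B.1 | exact: B.2].
Qed.

Fact tens_coact_linear : linear tens_coact_fun.
Proof. exact: tlift_linear tens_coact_bilin. Qed.
Definition tens_coact : {linear tensor M Y -> tensor (tensor M Y) (kG k)} :=
  mklin tens_coact_linear.

Fact tens_coact_pure m y :
  tens_coact (pure m y) = tbil (@pure k M Y) *%R (coact M m) (coact Y y).
Proof. exact: (tlift_pure _ _ tens_coact_bilin). Qed.

Fact tens_act_linear (A : comAlgType k) (g : 'M[A]_2) :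
  \det g = 1 -> linear (act tens_coact g).
Proof.
move=> dg; exact: (linear_comp tens_coact_linear
  (tmap_linear (@linear_id _ _) (ev_linear dg))).
Qed.

Fact tens_act_pure (A : comAlgType k) (g : 'M[A]_2) m y : \det g = 1 ->
  act tens_coact g (pure m y) =
  tbil (@pure k M Y) *%R (act (coact M) g m) (act (coact Y) g y).
Proof.
move=> dg; rewrite /act tens_coact_pure.
exact: (tmap_tbil (ev_alg dg) _ _ (pure_bilin M Y) (pure_bilin M Y)
  (@linear_id _ _) (@linear_id _ _) (@linear_id _ _)).
Qed.

Fact tens_act1 (A : comAlgType k) (t : tensor M Y) :
  act tens_coact (1%:M : 'M[A]_2) t = pure t 1.
Proof.
have d1 : \det (1%:M : 'M[A]_2) = 1 by rewrite det1.
apply: (tensor_ext (g := fun t => pure t 1)); first exact: tens_act_linear.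
  exact: (pure_bilin _ _).1.
move=> m y; rewrite tens_act_pure // !act1 tbil_pure ?mulr1 //.
  exact: pure_bilin.
exact: mul_bilin.
Qed.

(** By bilinearity over [A] it suffices to compare on pure tensors, where [G] acts
    diagonally by definition. *)
Fact tens_act_ext (A : comAlgType k) (g : 'M[A]_2) (s : tensor M A) (t : tensor Y A) :
  \det g = 1 ->
  act_ext tens_coact g (tbil (@pure k M Y) *%R s t) =
  tbil (@pure k M Y) *%R (act_ext (coact M) g s) (act_ext (coact Y) g t).
Proof.
move=> dg; have bM := act_ext_bilin (linearP (coact M)) dg.
have bY := act_ext_bilin (linearP (coact Y)) dg.
have bT := act_ext_bilin tens_coact_linear dg.
have eM := tlift_linear bM; have eY := tlift_linear bY; have eT := tlift_linear bT.
have B := tbil_bilin (pure_bilin M Y) (mul_bilin A).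
elim/tensor_ind: s => [|s s' Es Es'|m a].
- by rewrite (lin0 (B.1 t)) [LHS](lin0 eT) [act_ext (coact M) g 0](lin0 eM) (lin0 (B.1 _)).
- rewrite (linD (B.1 t)) [LHS](linD eT) [act_ext (coact M) g _](linD eM) (linD (B.1 _)).
  by rewrite -[LHS]/(act_ext _ _ _ + act_ext _ _ _) Es Es'.
elim/tensor_ind: t => [|t t' Et Et'|y c].
- by rewrite (lin0 (B.2 _)) [LHS](lin0 eT) [act_ext (coact Y) g 0](lin0 eY) (lin0 (B.2 _)).
- rewrite (linD (B.2 _)) [LHS](linD eT) [act_ext (coact Y) g _](linD eY) (linD (B.2 _)).
  by rewrite -[LHS]/(act_ext _ _ _ + act_ext _ _ _) Et Et'.
rewrite tbil_pure; [|exact: pure_bilin|exact: mul_bilin].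
rewrite /act_ext !tlift_pure // tens_act_pure //.
have tm (U : lmodType k) e : linear (tmap id ( *%R e) : tensor U A -> tensor U A).
  by apply: tmap_linear; [exact: linear_id|exact: mull_linear].
elim/tensor_ind: (act (coact M) g m) => [|s s' Es Es'|x e].
- by rewrite (lin0 (B.1 _)) [LHS](lin0 (tm _ _)) (lin0 (tm M a)) (lin0 (B.1 _)).
- rewrite (linD (B.1 _)) [LHS](linD (tm _ _)) (linD (tm M a)) (linD (B.1 _)).
  by rewrite /= Es Es'.
elim/tensor_ind: (act (coact Y) g y) => [|t t' Et Et'|z f].
- by rewrite (lin0 (B.2 _)) [LHS](lin0 (tm _ _)) (lin0 (tm Y c)) (lin0 (B.2 _)).
- rewrite (linD (B.2 _)) [LHS](linD (tm _ _)) (linD (tm Y c)) (linD (B.2 _)).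
  by rewrite /= Et Et'.
have bp := pure_bilin M Y; have bm := mul_bilin A; have li := @linear_id k.
rewrite tbil_pure // !tmap_pure //; try exact: mull_linear.
by rewrite tbil_pure // mulrACA.
Qed.

Fact tens_actM (A : comAlgType k) (g h : 'M[A]_2) (t : tensor M Y) :
  \det g = 1 -> \det h = 1 ->
  act tens_coact (g *m h) t = act_ext tens_coact g (act tens_coact h t).
Proof.
move=> dg dh; have dgh : \det (g *m h) = 1 by rewrite det_mulmx dg dh mulr1.
apply: (tensor_ext (g := act_ext tens_coact g \o act tens_coact h)).
- exact: tens_act_linear.
- apply: (linear_comp (tens_act_linear dh)).
  exact: (tlift_linear (act_ext_bilin tens_coact_linear dg)).
by move=> m y; rewrite /= !tens_act_pure // !actM // tens_act_ext.
Qed.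

Definition tens_mod : ratmod k := RatMod tens_act1 tens_actM.
End Construction.

Section TensorHom.
Variables (M Y Z : ratmod k) (b : M -> Y -> Z) (bb : bilin b) (eb : equivariant2 b).

Fact tens_hom_eq (t : tens_mod M Y) :
  coact Z (tlift b t) = tmap (tlift b) id (coact (tens_mod M Y) t).
Proof.
have lb := tlift_linear bb; have li := @linear_id k.
apply: (tensor_ext (f := coact Z \o tlift b)
  (g := tmap (tlift b) id \o @tens_coact M Y)).
- exact: (linear_comp lb (linearP (coact Z))).
- exact: (linear_comp (@tens_coact_linear M Y) (tmap_linear lb (li _))).
move=> m y; rewrite -[LHS]/(coact Z (tlift b (pure m y))) tlift_pure // eb.
rewrite -[RHS]/(tmap (tlift b) id (tens_coact M Y (pure m y))) tens_coact_pure.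
rewrite (tmap_tbil (idfun : {lrmorphism kG k -> kG k}) _ _ (pure_bilin M Y) bb (li _) (li _) lb).
  by rewrite !tmap_id.
by move=> x z; rewrite tlift_pure.
Qed.
Definition tens_hom : hom (tens_mod M Y) Z :=
  @mkhom k (tens_mod M Y) Z (tlift b) (tlift_linear bb) tens_hom_eq.
Lemma tens_homE m y : tens_hom (pure m y) = b m y.
Proof. exact: (tlift_pure _ _ bb). Qed.
End TensorHom.

Section TensorRight.
Variables (M Y Z : ratmod k) (d : hom Y Z).
Let b (m : M) (y : Y) : tens_mod M Z := pure m (d y).
Fact tens_right_bilin : bilin b.
Proof. exact: (tmap_bilin (@linear_id _ _) (hom_linear d)). Qed.
Fact tens_right_equivariant : equivariant2 b.
Proof.
move=> m y; rewrite [LHS]tens_coact_pure homP.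
rewrite -[RHS]tmap_id -{1}[coact M m]tmap_id; symmetry.
exact: (tmap_tbil (idfun : {lrmorphism kG k -> kG k}) _ _ tens_right_bilin
  (pure_bilin M Z) (@linear_id _ _) (hom_linear d) (@linear_id _ _)).
Qed.
Definition tens_right : hom (tens_mod M Y) (tens_mod M Z) :=
  tens_hom tens_right_bilin tens_right_equivariant.
Lemma tens_rightE m y : tens_right (pure m y) = pure m (d y).
Proof. exact: tens_homE. Qed.
End TensorRight.

Section EquivariantComp.
Variables (M N Y Z M' N' : ratmod k) (b : M -> N -> Y) (bb : bilin b).
Variables (f : hom M' M) (g : hom N' N) (h : hom Y Z).

Lemma bilin_comp : bilin (fun x y => h (b (f x) (g y))).
Proof.
by split=> [y|x] a u v; rewrite /= linearP ?[b _ _]bb.1 ?[b _ _]bb.2 linearP.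
Qed.

Lemma equivariant2_comp : equivariant2 b -> equivariant2 (fun x y => h (b (f x) (g y))).
Proof.
move=> eb x y; rewrite homP eb !homP.
pose idG : {lrmorphism kG k -> kG k} := idfun.
have lf := hom_linear f; have lg := hom_linear g; have lh := hom_linear h.
have bfg : bilin (fun x y => b (f x) (g y)).
  by split=> [v|u] a u' v'; rewrite /= linearP ?[b _ _]bb.1 ?[b _ _]bb.2.
have E1 := tmap_tbil (h := id) idG (coact M' x) (coact N' y) bfg bb lf lg
  (@linear_id k _) (fun _ _ => erefl).
have E2 := tmap_tbil (f := id) (g := id) idG (coact M' x) (coact N' y) bfg bilin_comp
  (@linear_id k _) (@linear_id k _) lh (fun _ _ => erefl).
by rewrite -E1 tmap_id E2 !tmap_id.
Qed.

(** With bilinearity this makes [b^~ n] a morphism of modules. *)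
Lemma invariant_right (n : N) : equivariant2 b -> is_invariant n ->
  forall m, coact Y (b m n) = tmap (b^~ n) id (coact M m).
Proof.
move=> eb In m; rewrite eb In; have bm := mul_bilin (kG k).
have B := tbil_bilin bb bm.
have lb : linear (b^~ n) by exact: bb.1.
apply: (tensor_ext (f := (tbil b *%R)^~ (pure n 1)) (g := tmap (b^~ n) id)).
- exact: B.1.
- by apply: tmap_linear; [exact: lb | exact: linear_id].
- by move=> u a; rewrite tbil_pure // mulr1 tmap_pure //; exact: linear_id.
Qed.
End EquivariantComp.

(** * Multiplication of invariant functions *)

Section Multiplication.
Variable H : subfun k.

Lemma kGmod_mul_bilin : bilin (@kGmod_mul k H).
Proof.
have vl := @kGmod_val_linear k H.
split=> z a x y; apply: kGmod_val_inj; rewrite [RHS]vl.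
  transitivity (kGmod_val (a *: x + y) * kGmod_val z) => //.
  by rewrite vl mulrDl -scalerAl.
transitivity (kGmod_val z * kGmod_val (a *: x + y)) => //.
by rewrite vl mulrDr -scalerAr.
Qed.

Lemma kGmod_mul_equivariant : equivariant2 (@kGmod_mul k H).
Proof.
move=> x y; apply: (@sub_tensor_inj k (lreg k) (kG_inv H)).
rewrite [LHS](sub_coactE (@kG_inv_subcomodule k H)).
have vl := @kGmod_val_linear k H.
rewrite [RHS](tmap_tbil (b' := *%R) (f := @kGmod_val k H) (g := @kGmod_val k H)
  (idfun : {lrmorphism kG k -> kG k}) _ _ kGmod_mul_bilin (mul_bilin _) vl vl vl) //.
rewrite ![tmap _ _ (coact _ _)](sub_coactE (@kG_inv_subcomodule k H)).
exact: (evM (det_act (det_univ k) (det_univ k))).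
Qed.
End Multiplication.
End TensorModules.

(** * Cohomology from injective resolutions *)

Section Resolutions.
Variable k : fieldType.

Lemma res_dd (M : ratmod k) (J : inj_res M) n (x : J n) : res_d J n.+1 (res_d J n x) = 0.
Proof. by apply/res_exact; exists x. Qed.

Lemma res_d_aug (M : ratmod k) (J : inj_res M) (m : M) : res_d J 0 (res_aug J m) = 0.
Proof. by apply/res_exact0; exists m. Qed.

(** The components of the null homotopy are morphisms, so they send the invariant cocycle
    [x] to an invariant whose differential is [F n x]. *)
Lemma chain_null (M N : ratmod k) (K : inj_res M) (J : inj_res N)
    (F : forall n, hom (K n) (J n)) :
  (forall n x, F n.+1 (res_d K n x) = res_d J n (F n x)) ->
  (forall m, F 0 (res_aug K m) = 0) ->
  forall n x, is_cocycle x -> is_coboundary (F n x).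
Proof.
move=> FP F0.
have F0' x : res_d K 0 x = 0 -> F 0 x = 0 by move=> /res_exact0[m ->].
have exK n (x : K n.+1) : res_d K n.+1 x = 0 -> exists y, x = res_d K n y.
  by move=> /res_exact.
have [s [s0 sS]] := chain_homotopy exK (@res_dd N J) (@res_injective k N J) FP F0'.
move=> [|n] x [Ix dx]; first by rewrite /= s0 dx linear0.
exists (s n x); split; first exact: hom_invariant.
by rewrite sS dx linear0 addr0.
Qed.

Lemma comparison (M : ratmod k) (K J : inj_res M) :
  exists F : forall n, hom (K n) (J n),
    (forall m, F 0 (res_aug K m) = res_aug J m) /\
    forall n x, F n.+1 (res_d K n x) = res_d J n (F n x).
Proof.
have [f0 f0P] := @res_injective k M J 0 _ _ (res_aug K) (res_aug J) (@res_aug_inj k M K).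
have exK n (x : K n.+1) : res_d K n.+1 x = 0 -> exists y, x = res_d K n y.
  by move=> /res_exact.
have f0d x : res_d K 0 x = 0 -> res_d J 0 (f0 x) = 0.
  by move=> /res_exact0[m ->]; rewrite f0P res_d_aug.
have [F [F0 FS]] := chain_lift exK (@res_dd M J) (@res_injective k M J) f0d.
by exists F; split=> // m; rewrite F0.
Qed.

Lemma hom_cocycle (M M' : ratmod k) (K : inj_res M) (L : inj_res M')
    (H : forall n, hom (K n) (L n)) :
  (forall n x, H n.+1 (res_d K n x) = res_d L n (H n x)) ->
  forall n x, is_cocycle x -> is_cocycle (H n x).
Proof.
move=> HS n x [Ix dx]; split; first exact: hom_invariant.
by rewrite -HS dx linear0.
Qed.

(** The difference with the identity vanishes on [M], so [chain_null] applies. *)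
Lemma homotopic_id (M : ratmod k) (K : inj_res M) (H : forall n, hom (K n) (K n)) :
  (forall n x, H n.+1 (res_d K n x) = res_d K n (H n x)) ->
  (forall m, H 0 (res_aug K m) = res_aug K m) ->
  forall n x, is_cocycle x -> is_coboundary (H n x - x).
Proof.
move=> HS H0 n x cx; rewrite -[_ - _](hom_subE (H n) (hom_id (K n))).
apply: (chain_null (F := fun n => hom_sub (H n) (hom_id (K n)))) => // [m y|m].
  by rewrite !hom_subE /= HS linearB.
by rewrite hom_subE /= H0 subrr.
Qed.

Section Classes.
Variables (M : ratmod k) (J : inj_res M).

Lemma HclassE n (x y : J n) (cx : is_cocycle x) (cy : is_cocycle y) :
  Hclass cx = Hclass cy <-> is_coboundary (x - y).
Proof. by split=> [/qclassE //|H]; apply/qclassE. Qed.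

Lemma Hclass_repr n (h : Hn J n) : Hclass (HreprP h) = h.
Proof.
rewrite -[RHS]qreprK /Hclass; congr (qclass _ _); exact: val_inj.
Qed.

Lemma cocycleZ n (c : k) (x : J n) : is_cocycle x -> is_cocycle (c *: x).
Proof. exact: (subspaceZ (S := cocycles J n)). Qed.

Lemma HclassZ n (c : k) (x : J n) (cx : is_cocycle x) :
  c *: Hclass cx = Hclass (cocycleZ c cx).
Proof.
rewrite /Hclass -(linZ (qclass_linear (coboundaries J n))).
by congr (qclass _ _); exact: val_inj.
Qed.

Lemma coboundaryB n (x y : J n) : is_coboundary (x - y) -> is_coboundary (y - x).
Proof.
move=> /(subspaceN (S := Subspace (is_coboundary_subspace J n))).
by rewrite opprB.
Qed.
End Classes.

Section Transport.
Variables (M : ratmod k) (mu : M -> M -> M) (K J : inj_res M) (P : pairing mu J).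
Variables (F : forall n, hom (K n) (J n)) (G : forall n, hom (J n) (K n)).
Hypothesis F0 : forall m, F 0 (res_aug K m) = res_aug J m.
Hypothesis G0 : forall m, G 0 (res_aug J m) = res_aug K m.
Hypothesis FS : forall n x, F n.+1 (res_d K n x) = res_d J n (F n x).
Hypothesis GS : forall n x, G n.+1 (res_d J n x) = res_d K n (G n x).

Let Q p q n (e : (p + q = n)%N) (x : K p) (y : K q) : K n := G n (pr P e (F p x) (F q y)).

Fact transport_leibniz p q n (e : (p + q = n)%N) (e1 : (p.+1 + q = n.+1)%N)
    (e2 : (p + q.+1 = n.+1)%N) (x : K p) (y : K q) :
  res_d K n (Q e x y) = Q e1 (res_d K p x) y + (-1) ^+ p *: Q e2 x (res_d K q y).
Proof. by rewrite /Q -GS (pr_leibniz P e e1 e2) linearD linearZZ !FS. Qed.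

Fact transport_aug (e : (0 + 0 = 0)%N) (a b : M) :
  Q e (res_aug K a) (res_aug K b) = res_aug K (mu a b).
Proof. by rewrite /Q !F0 pr_aug G0. Qed.

Definition transport : pairing mu K := Pairing
  (fun p q n e => bilin_comp (pr_bilin P e) (F p) (F q) (G n))
  (fun p q n e => equivariant2_comp (pr_bilin P e) (F p) (F q) (G n)
    (pr_equivariant P e))
  transport_leibniz transport_aug.
End Transport.
End Resolutions.

(** * The periodic resolution of [k[G/N]] *)

Section Periodic.
Variables (k : fieldType) (char2 : 2%N \in [pchar k]).
Local Notation X := (kG_mod_T k).
Local Notation A := (kG_mod_N k).
Local Notation N := (normalizer (torus k)).
Local Notation T := (torus k).
Local Notation sigX := (sigX char2).
Variables (E : ses A X A) (calE_E : is_calE E).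
Local Notation inc := (ses_inc E).
Local Notation prj := (ses_prj E).

Definition perD : hom X X := hom_comp inc prj.

Lemma perDE x : perD x = x + sigX x.
Proof. exact: is_calE_prj. Qed.

Lemma perD0 x : perD x = 0 <-> exists a, x = inc a.
Proof.
split=> [H|/(ses_exact E) H]; last by rewrite /= H linear0.
by apply/ses_exact/(@ses_inj _ _ _ _ E); rewrite linear0.
Qed.

Lemma perD_exact x : perD x = 0 <-> exists y, x = perD y.
Proof.
split=> [/perD0[a ->]|[y ->]]; last by apply/perD0; exists (prj y).
by have [y <-] := ses_surj E a; exists y.
Qed.

Definition per_res : inj_res A := @InjRes k A (fun _ => X) (fun _ => perD) inc
  (fun _ => @kG_mod_T_injective k) (@ses_inj _ _ _ _ E) perD0 (fun _ => perD_exact).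
Local Notation I := per_res.

Local Notation one := (kGmod_one T : X).

Lemma one_invariant : is_invariant one.
Proof. exact: kGmod_one_invariant. Qed.

Lemma inc_one : inc (kGmod_one N) = one.
Proof. by apply: kGmod_val_inj; rewrite calE_E.1. Qed.

Lemma perD_one : perD one = 0.
Proof. by apply/perD0; exists (kGmod_one N); rewrite inc_one. Qed.

Lemma X_invariants (x : X) : is_invariant x -> exists c : k, x = c *: one.
Proof.
move=> Ix; have Ex := lreg_invariant (hom_invariant (val_hom T) Ix).
exists (kG_eps (kGmod_val x)); apply: kGmod_val_inj.
by rewrite (linZ (@kGmod_val_linear k T)).
Qed.

Lemma perD_invariant (x : X) : is_invariant x -> perD x = 0.
Proof. by move=> /X_invariants[c ->]; rewrite linearZZ perD_one scaler0. Qed.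

Lemma one_cocycle n : @is_cocycle k A I n one.
Proof. by split; [exact: one_invariant | exact: perD_one]. Qed.

Lemma per_coboundary n (x : X) : @is_coboundary k A I n x -> x = 0.
Proof. by case: n => [//|n] [y [Iy ->]]; exact: perD_invariant. Qed.

Local Notation mulX := (@kGmod_mul k T).
Local Notation mulA := (@kGmod_mul k N).

Lemma inc_mul a b : inc (mulA a b) = mulX (inc a) (inc b).
Proof.
apply: kGmod_val_inj; rewrite calE_E.1.
transitivity (kGmod_val (inc a) * kGmod_val (inc b)) => //.
by rewrite !calE_E.1.
Qed.

Lemma sig_mul x y : sigX (mulX x y) = mulX (sigX x) (sigX y).
Proof. apply: kGmod_val_inj; exact: (rsM char2). Qed.

Lemma mulX_one x : mulX x one = x.
Proof. by apply: kGmod_val_inj; exact: mulr1. Qed.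

Lemma sig_inc a : sigX (inc a) = inc a.
Proof.
have /eqP : perD (inc a) = 0 by apply/perD0; exists a.
by rewrite perDE addrC addr_eq0 (oppv_char2 char2) => /eqP.
Qed.

(** A linear homotopy, not a morphism of modules, that contracts [perD].  It still does
    after tensoring with a module, whence the exactness of [A (x) per_res]. *)
Definition contr (x : X) : X :=
  sigX (@to_sub _ _ (kG_inv T) (kGmod_val x * ad k)
    (right_invariantM (kGmod_valP x) (@ad_invariant k))).

Lemma contr_linear : linear contr.
Proof.
move=> a x y; rewrite /contr -linearP; congr (sigX _); apply: kGmod_val_inj.
rewrite [RHS]kGmod_val_linear -[LHS]/(kGmod_val (a *: x + y) * ad k).
by rewrite kGmod_val_linear mulrDl -scalerAl.
Qed.

Lemma contrP x : x = perD (contr x) + contr (perD x).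
Proof.
apply: kGmod_val_inj; have vl := @kGmod_val_linear k T.
have vD y : kGmod_val (perD y) = kGmod_val y + sigma_translate (kGmod_val y).
  by rewrite perDE (linD vl).
have vc y : kGmod_val (contr y) = sigma_translate (kGmod_val y) * (ad k + 1).
  by rewrite -(rs_ad char2) -(rsM char2).
rewrite (linD vl) vD !vc vD (rsM char2) !(linD (rs_linear char2)) !(rsK char2).
rewrite (rs_ad char2) (rs1 char2).
have two (z : kG k) : z + z = 0 := addvv_char2 char2 z.
set v := kGmod_val x; set w := sigma_translate v; set u := ad k.
have -> : w * (u + 1) + v * (u + 1 + 1) + (w + v) * (u + 1) =
  (w * (u + 1) + w * (u + 1)) + (v * (u + 1) + v * (u + 1)) + v by ring.
by rewrite !two !add0r.
Qed.

(** * The cup product on the periodic resolution *)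

Definition sig_pow (p : nat) : hom X X := iter p (hom_comp sigX) (hom_id X).

Lemma sign1 p : (-1) ^+ p = 1 :> k.
Proof. by rewrite (oppv_char2 char2 (1 : k^o)) expr1n. Qed.

(** The Alexander-Whitney product on the cochains of a group of order two, computed from
    its periodic resolution. *)
Let perQ p q n (e : (p + q = n)%N) (x : I p) (y : I q) : I n := mulX x (sig_pow p y).

Fact perQ_leibniz p q n (e : (p + q = n)%N) (e1 : (p.+1 + q = n.+1)%N)
    (e2 : (p + q.+1 = n.+1)%N) (x : I p) (y : I q) :
  res_d I n (perQ e x y) =
  perQ e1 (res_d I p x) y + (-1) ^+ p *: perQ e2 x (res_d I q y).
Proof.
have [bl br] := @kGmod_mul_bilin k T.
have sD : sig_pow p (perD y) = sig_pow p y + sigX (sig_pow p y).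
  have sS z : sig_pow p (sigX z) = sigX (sig_pow p z).
    by elim: (p) => //= p' ->.
  by rewrite perDE linearD sS.
rewrite sign1 scale1r.
transitivity (mulX x (sig_pow p y) + mulX (sigX x) (sigX (sig_pow p y))).
  by rewrite -sig_mul; exact: perDE.
transitivity (mulX (x + sigX x) (sigX (sig_pow p y)) +
    mulX x (sig_pow p y + sigX (sig_pow p y))); last by rewrite -perDE -sD.
rewrite [mulX (x + _) _](linD (bl _)) [mulX x (_ + _)](linD (br _)).
have cancel (a b c : X) : a + b = (c + b) + (a + c).
  by rewrite [c + b]addrC addrACA (addvv_char2 char2) addr0 addrC.
exact: cancel.
Qed.

Fact perQ_aug (e : (0 + 0 = 0)%N) (a b : A) :
  perQ e (res_aug I a) (res_aug I b) = res_aug I (mulA a b).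
Proof. by symmetry; exact: inc_mul. Qed.

Fact perQ_bilin p q n (e : (p + q = n)%N) : bilin (perQ e).
Proof. exact: (bilin_comp (@kGmod_mul_bilin k T) (hom_id X) (sig_pow p) (hom_id X)). Qed.

Fact perQ_equivariant p q n (e : (p + q = n)%N) : equivariant2 (perQ e).
Proof.
exact: (equivariant2_comp (@kGmod_mul_bilin k T) (hom_id X) (sig_pow p) (hom_id X)
  (@kGmod_mul_equivariant k T)).
Qed.

Definition per_pairing : pairing mulA I :=
  Pairing perQ_bilin perQ_equivariant perQ_leibniz perQ_aug.

Section AnyPairing.
Variable P : pairing mulA I.

Let pair0 (a : A) (y : X) (q : nat) : X :=
  pr P (erefl q : (0 + q = q)%N) (inc a : I 0) (y : I q).

(** Here [I] is [per_res].  Both [P] and the multiplication of [X] give chain maps from [A (x) I] to [I]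
    that lift the multiplication of [A], so they are homotopic; the homotopy is
    evaluated at the invariant [1]. *)
Lemma pairing_one_right q : exists eta : hom A X, forall a,
  pr P (erefl q : (0 + q = q)%N) (inc a : I 0) (one : I q) = inc a + perD (eta a).
Proof.
have Pb m := pr_bilin P (erefl m : (0 + m = m)%N).
have Pe m := pr_equivariant P (erefl m : (0 + m = m)%N).
pose F m : hom (tens_mod A X) X := hom_sub
  (tens_hom (bilin_comp (Pb m) inc (hom_id X) (hom_id X))
    (equivariant2_comp (Pb m) inc (hom_id X) (hom_id X) (Pe m)))
  (tens_hom (bilin_comp (@kGmod_mul_bilin k T) inc (hom_id X) (hom_id X))
    (equivariant2_comp (@kGmod_mul_bilin k T) inc (hom_id X) (hom_id X)
      (@kGmod_mul_equivariant k T))).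
have FE m a y : F m (pure a y) = pair0 a y m - mulX (inc a) y.
  by rewrite hom_subE !tens_homE.
have perD_inc a : perD (inc a) = 0 by apply/perD0; exists a.
have [bl br] := @kGmod_mul_bilin k T.
pose d := tens_right A perD.
have dex (t : tens_mod A X) : d t = 0 -> exists t', t = d t'.
  move=> dt; have lc := contr_linear; have li := @linear_id k.
  have lt := tmap_linear (li A) lc.
  exists (tmap id contr t).
  have : t = d (tmap id contr t) + tmap id contr (d t).
    apply: (tensor_ext (f := id) (g := fun t => d (tmap id contr t) + tmap id contr (d t))).
    - exact: li.
    - by move=> a x y; rewrite lt !linearP lt scalerDr addrACA.
    move=> a y; rewrite [d (pure _ _)]tens_rightE !tmap_pure // [d _]tens_rightE -pureDr.
    by rewrite -contrP.
  by rewrite dt (lin0 lt) addr0.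
have FS m (t : tens_mod A X) : F m.+1 (d t) = perD (F m t).
  apply: (tensor_ext (f := F m.+1 \o d) (g := perD \o F m)).
  - exact: (linear_comp (hom_linear d) (hom_linear (F m.+1))).
  - exact: (linear_comp (hom_linear (F m)) (hom_linear perD)).
  move=> a y; rewrite -[LHS]/(F m.+1 (d (pure a y))) -[RHS]/(perD (F m (pure a y))).
  rewrite [d _]tens_rightE !FE linearB; congr (_ - _).
    have := pr_leibniz P (erefl m : (0 + m = m)%N) (erefl : (1 + m = m.+1)%N)
      (erefl : (0 + m.+1 = m.+1)%N) (inc a : I 0) (y : I m).
    rewrite [res_d I 0 (inc a)]perD_inc (lin0 ((pr_bilin P _).1 _)) add0r expr0 scale1r.
    by move=> ->.
  by rewrite !perDE sig_mul sig_inc (linD (br _)).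
have F0 (t : tens_mod A X) : d t = 0 -> F 0 t = 0.
  move=> /dex[t' ->].
  apply: (tensor_ext (f := F 0 \o d) (g := fun _ => 0)).
  - exact: (linear_comp (hom_linear d) (hom_linear (F 0))).
  - by move=> a x y; rewrite scaler0 addr0.
  move=> a y; rewrite -[LHS]/(F 0 (d (pure a y))) [d _]tens_rightE FE.
  rewrite -[perD y]/(inc (prj y)) /pair0.
  rewrite [pr _ _ _ _](pr_aug P (erefl : (0 + 0 = 0)%N) a (prj y)).
  by rewrite [res_aug _ _]inc_mul subrr.
have ddX x : perD (perD x) = 0 by apply/perD_exact; exists x.
have [s [s0 sS]] := @chain_homotopy k (fun _ => tens_mod A X) (fun _ => X)
  (fun _ => d) (fun _ => perD) (fun _ => dex) (fun _ => ddX)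
  (fun _ => @kG_mod_T_injective k) F FS F0.
have d1 a : d (pure a one) = 0 by rewrite [d _]tens_rightE perD_one pure0r.
have one_hom : forall a, coact (tens_mod A X) (pure a one) =
    tmap (fun a => pure a one) id (coact A a).
  apply: (invariant_right (b := fun a x => pure a x : tens_mod A X) (pure_bilin A X)).
    by move=> a x; rewrite [LHS]tens_coact_pure.
  exact: one_invariant.
pose i1 : hom A (tens_mod A X) := @mkhom k A (tens_mod A X) _ ((pure_bilin A X).1 one) one_hom.
have FE1 m a : pair0 a one m = inc a + F m (pure a one).
  by rewrite FE mulX_one addrC subrK.
(* the homotopy has no component into degree -1, so the correction is zero if [q = 0] *)
case: q => [|q].
  exists (hom_sub inc inc) => a; rewrite [LHS](FE1 0) s0 d1 linear0.
  by rewrite hom_subE subrr linear0.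
exists (hom_comp (s q) i1) => a.
by rewrite [LHS](FE1 q.+1) sS d1 linear0 addr0.
Qed.

(** For fixed [q], the maps [phi m] form a chain map in the first argument.  By
    [pairing_one_right] it becomes a lift of the identity of [A] once the coboundary [eta]
    is removed in degree zero; so it is homotopic to the identity, and a homotopy has no
    effect on the constant one. *)
Lemma pairing_one p q n (e : (p + q = n)%N) : pr P e (one : I p) (one : I q) = one.
Proof.
case: n / e.
have [eta etaP] := pairing_one_right q.
have [eta' eta'P] := @kG_mod_T_injective k _ _ inc eta (@ses_inj _ _ _ _ E).
pose e m : (m + q = m + q)%N := erefl.
pose phi m : hom X X := @mkhom k X X _ ((pr_bilin P (e m)).1 one)
  (invariant_right (pr_bilin P (e m)) (pr_equivariant P (e m)) one_invariant).
have phiS m x : phi m.+1 (perD x) = perD (phi m x).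
  have := pr_leibniz P (e m) (e m.+1) (addnS m q) (x : I m) (one : I q).
  rewrite [res_d I q one]perD_one (lin0 ((pr_bilin P _).2 _)) scaler0 addr0.
  by move=> H; rewrite [RHS]H.
(* [F] subtracts from [phi] the identity and, in degree zero only, [perD \o eta'] *)
pose c m : k := if m is 0 then -1 else 0.
pose F m : hom X X := hom_lc (c m) (hom_sub (phi m) (hom_id X)) (hom_comp perD eta').
have FE m x : F m x = phi m x - x + c m *: perD (eta' x).
  by rewrite -[LHS]/(hom_sub (phi m) (hom_id X) x + c m *: perD (eta' x)) hom_subE.
have DD x : perD (perD x) = 0 by apply/perD_exact; exists x.
have FS m x : F m.+1 (perD x) = perD (F m x).
  rewrite !FE phiS -[c m.+1]/(0 : k) scale0r addr0 -linearB [RHS]linearD.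
  by rewrite [perD (_ *: _)]linearZZ DD scaler0 addr0.
have F0 a : F 0 (inc a) = 0.
  rewrite FE -[phi 0 (inc a)]/(pr P (e 0) (inc a : I 0) (one : I q)) etaP.
  by rewrite eta'P [inc a + _]addrC addrK scaleN1r subrr.
have /per_coboundary := @chain_null k A A I I F FS F0 p one (one_cocycle p).
rewrite FE (perD_invariant (hom_invariant eta' one_invariant)) scaler0 addr0.
by move/eqP; rewrite subr_eq0 => /eqP.
Qed.
End AnyPairing.
End Periodic.

(** * The cohomology ring *)

Section Main.
Variables (k : fieldType) (char2 : 2%N \in [pchar k]).
Local Notation X := (kG_mod_T k).
Local Notation A := (kG_mod_N k).
Local Notation N := (normalizer (torus k)).
Local Notation T := (torus k).
Variables (E : ses A X A) (calE_E : is_calE E).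
Local Notation I := (per_res E).
Local Notation one := (kGmod_one T : X).
Local Notation mulA := (@kGmod_mul k N).
Variable J : inj_res A.

Section ChainMaps.
Variables (F : forall n, hom (I n) (J n)) (G : forall n, hom (J n) (I n)).
Hypothesis F0 : forall m, F 0 (res_aug I m) = res_aug J m.
Hypothesis G0 : forall m, G 0 (res_aug J m) = res_aug I m.
Hypothesis FS : forall n x, F n.+1 (res_d I n x) = res_d J n (F n x).
Hypothesis GS : forall n x, G n.+1 (res_d J n x) = res_d I n (G n x).

Lemma GF_one n : G n (F n one) = one.
Proof.
have /per_coboundary : is_coboundary (hom_comp (G n) (F n) one - one).
  apply: (homotopic_id (K := I) (H := fun n => hom_comp (G n) (F n))).
  - by move=> m x; rewrite /= FS GS.
  - by move=> m; rewrite /= F0 G0.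
  - exact: one_cocycle.
by move=> /(_ calE_E) /eqP; rewrite subr_eq0 => /eqP.
Qed.

Lemma FG_homotopic n (x : J n) : is_cocycle x -> is_coboundary (F n (G n x) - x).
Proof.
move=> cx.
apply: (homotopic_id (K := J) (H := fun n => hom_comp (F n) (G n)) _ _ cx).
- by move=> m y; rewrite /= GS FS.
- by move=> m; rewrite /= G0 F0.
Qed.

Lemma gen_cocycle n : is_cocycle (F n one).
Proof. by apply: (hom_cocycle (H := F)) => //; exact: one_cocycle. Qed.

Definition gen n : Hn J n := Hclass (gen_cocycle n).

(** Since [F] after [G] is homotopic to the identity, the class of [z] only depends on
    the image of [z] in the periodic resolution. *)
Lemma Hclass_gen n (z : J n) (cz : is_cocycle z) (c : k) :
  G n z = c *: one -> Hclass cz = c *: gen n.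
Proof.
move=> Gz; rewrite HclassZ; apply/HclassE/coboundaryB.
by have := FG_homotopic cz; rewrite Gz linearZZ.
Qed.

Lemma gen_span n (h : Hn J n) : exists c : k, h = c *: gen n.
Proof.
have [c Ec] := X_invariants (hom_invariant (G n) (HreprP h).1).
by exists c; rewrite -[LHS]Hclass_repr; exact: Hclass_gen.
Qed.

Lemma gen_free n (c : k) : c *: gen n = 0 -> c = 0.
Proof.
rewrite HclassZ -[0](scale0r (gen n)) HclassZ => /HclassE.
rewrite scale0r subr0 => bx.
have : G n (c *: F n one) = 0.
  case: n bx => [|n] /=; first by move=> ->; rewrite linear0.
  by move=> [y [Iy ->]]; rewrite GS; apply: perD_invariant => //; exact: hom_invariant.
rewrite linearZZ GF_one => /(congr1 (@kGmod_val k T)).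
rewrite (linZ (@kGmod_val_linear k T)) (lin0 (@kGmod_val_linear k T)).
move/eqP; rewrite scaler_eq0 => /orP[/eqP//|].
by rewrite -[kGmod_val _]/(1 : kG k) oner_eq0.
Qed.

Lemma gen_inj n (c c' : k) : c *: gen n = c' *: gen n -> c = c'.
Proof.
by move=> H; apply/subr0_eq/(@gen_free n); rewrite scalerBl H subrr.
Qed.

Definition Hcoef n (h : Hn J n) : k^o := projT1 (cid (gen_span h)).
Lemma HcoefP n (h : Hn J n) : h = (Hcoef h : k) *: gen n.
Proof. exact: projT2 (cid (gen_span h)). Qed.
Lemma HcoefE n (c : k) : Hcoef (c *: gen n) = c.
Proof. by apply: (@gen_inj n); rewrite -HcoefP. Qed.

Lemma Hcoef_linear n : linear (@Hcoef n).
Proof.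
move=> a x y; apply: (@gen_inj n); rewrite -HcoefP [in LHS](HcoefP x) [in LHS](HcoefP y).
by rewrite scalerA -scalerDl.
Qed.

Lemma Hn_one_dimensional n : exists u : {linear Hn J n -> k^o}, bijective u.
Proof.
exists (mklin (@Hcoef_linear n)); exists (fun c : k^o => (c : k) *: gen n) => x /=.
  by rewrite -HcoefP.
exact: HcoefE.
Qed.

(** The maps [h] witnessing the splices form a chain map from the periodic resolution to
    [J]; it lifts the identity, like [F], so the two are homotopic.  Degree zero is apart
    because the homotopy has no component into degree -1. *)
Lemma yoneda_power_homotopic n (z : hom A (J n)) : yoneda_power E z ->
  match n return hom A (J n) -> Prop with
  | 0 => fun z => forall a, z a = F 0 (ses_inc E a)
  | n'.+1 => fun z => exists s : hom A (J n'),
      forall a, z a = F n'.+1 (ses_inc E a) + res_d J n' (s a)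
  end z.
Proof.
elim: n z => [|n IH] z /=; first by move=> zP a; rewrite zP -F0.
move=> [c [/IH {}IH [h [hi hd]]]].
(* [s'] is the coboundary by which [h] and [F n] differ on the image of [ses_inc] *)
have [s' s'P] : exists s' : hom X (J n), forall a,
    h (ses_inc E a) - F n (ses_inc E a) - s' (ses_inc E a) = 0 /\
    forall x, res_d J n (s' x) = 0.
  case: n c z h hi hd IH => [|n] c z h hi hd IH.
    exists (hom_sub h h) => a; split=> [|x].
      by rewrite hom_subE subrr subr0 hi IH subrr.
    by rewrite hom_subE subrr linear0.
  have [s sP] := IH.
  have [t tP] := @res_injective k A J n _ _ (ses_inc E) s (@ses_inj _ _ _ _ E).
  exists (hom_comp (res_d J n) t) => a; split=> [|x]; last exact: res_dd.
  by rewrite /= hi sP tP [F _ _ + _]addrC addrK subrr.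
have [t tP] : exists t : hom A (J n), forall x, t (ses_prj E x) =
    hom_sub (hom_sub h (F n)) s' x.
  apply: injective_factor; first exact: res_injective.
  by move=> x /(ses_exact E)[a ->]; rewrite !hom_subE; exact: (s'P a).1.
exists t => a; have [x <-] := ses_surj E a.
rewrite -hd tP !hom_subE !linearB (s'P 0).2 subr0.
by rewrite -[ses_inc E _]/(res_d I n x) FS addrC subrK.
Qed.

Lemma yoneda_power_cocycle n (z : hom A (J n)) : yoneda_power E z ->
  forall a, res_d J n (z a) = 0.
Proof.
case: n z => [|n] z /=; first by move=> zP a; rewrite zP res_d_aug.
move=> [c [_ [h [_ hd]]]] a; have [x <-] := ses_surj E a.
by rewrite -hd res_dd.
Qed.

Lemma yoneda_power_exists n : exists z : hom A (J n), yoneda_power E z.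
Proof.
elim: n => [|n [c cP]]; first by exists (res_aug J).
have [h hP] := @res_injective k A J n _ _ (ses_inc E) c (@ses_inj _ _ _ _ E).
have [z zP] : exists z : hom A (J n.+1), forall x, z (ses_prj E x) =
    hom_comp (res_d J n) h x.
  apply: injective_factor; first exact: res_injective.
  by move=> x /(ses_exact E)[a ->]; rewrite /= hP (yoneda_power_cocycle cP).
by exists z => /=; exists c; split=> //; exists h; split=> // x; rewrite zP.
Qed.

Lemma const_hom_one : const_hom N (1 : k^o) = kGmod_one N.
Proof. exact: scale1r. Qed.

Lemma yoneda_power_gen n (z : hom A (J n)) (cz : is_cocycle (z (const_hom N (1 : k^o)))) :
  yoneda_power E z -> Hclass cz = gen n.
Proof.
have inc1 := inc_one calE_E.
move=> /yoneda_power_homotopic zP; apply/HclassE; rewrite const_hom_one.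
case: n z zP {cz} => [|n] z; first by move=> ->; rewrite inc1 subrr.
move=> [s ->]; rewrite inc1 addrAC subrr add0r; exists (s (kGmod_one N)); split=> //.
by apply: hom_invariant; exact: kGmod_one_invariant.
Qed.

Lemma yoneda_class_gen n (y : Hn J n) :
  yoneda_class E (const_hom N) y <-> y = gen n.
Proof.
split=> [[z [cz [zP ->]]]|->]; first exact: yoneda_power_gen.
have [z zP] := yoneda_power_exists n.
have cz : is_cocycle (z (const_hom N (1 : k^o))).
  split; last exact: (yoneda_power_cocycle zP).
  by rewrite const_hom_one; apply: hom_invariant; exact: kGmod_one_invariant.
by exists z, cz; split=> //; rewrite yoneda_power_gen.
Qed.

Lemma cup_gen (P : pairing mulA J) p q n (e : (p + q = n)%N) (a b : k) :
  cup P e (a *: gen p) (b *: gen q) = (a * b) *: gen n.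
Proof.
rewrite (HclassZ a (gen_cocycle p)) (HclassZ b (gen_cocycle q)) cupE; apply: Hclass_gen.
have [bl br] := pr_bilin P e.
have -> : pr P e (a *: F p one) (b *: F q one) = (a * b) *: pr P e (F p one) (F q one).
  rewrite -scalerA; apply: (etrans (linZ (bl _) _ _)); congr (_ *: _).
  exact: (linZ (br _)).
rewrite linearZZ; congr (_ *: _).
exact: (pairing_one char2 calE_E (transport P F0 G0 FS GS) e).
Qed.

Lemma Hconst_gen : Hconst_comp J (kGmod_one_invariant N) 0 = gen 0.
Proof.
apply/HclassE => /=; rewrite -F0 -[res_aug I _]/(ses_inc E _) (inc_one calE_E).
by rewrite subrr.
Qed.

Fact poly_class_fin (p : {poly k}) :
  exists b, forall n, (b <= n)%N -> p`_n *: gen n = 0.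
Proof. by exists (size p) => n pn; rewrite nth_default // scale0r. Qed.
Definition poly_class (p : {poly k}) : Hstar J := mkHstar (poly_class_fin p).

Lemma poly_class_linear : linear poly_class.
Proof.
move=> a p q; apply: Hstar_eq => n.
by rewrite /= coefD coefZ scalerDl scalerA.
Qed.

Lemma poly_class_bij : bijective poly_class.
Proof.
pose g (h : Hstar J) : {poly k} :=
  \poly_(i < projT1 (cid (Hcomp_fin h))) (Hcoef (h i)).
exists g => [p|h].
  apply/polyP => i; rewrite coef_poly.
  case: cid => b bP /=; case: ltnP => [_|bi]; first exact: HcoefE.
  by apply: (@gen_inj i); rewrite scale0r [RHS]bP.
apply: Hstar_eq => n /=; rewrite coef_poly; case: cid => b bP /=.
by case: ltnP => [_|bn]; [rewrite -HcoefP | rewrite scale0r bP].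
Qed.

Lemma poly_classM (P : pairing mulA J) p q :
  poly_class (p * q) = Hmul P (poly_class p) (poly_class q).
Proof.
apply: Hstar_eq => n /=; rewrite coefM scaler_suml.
by apply: eq_bigr => i _; rewrite cup_gen.
Qed.

Lemma poly_class1 : poly_class 1 = Hconst J (kGmod_one_invariant N).
Proof.
apply: Hstar_eq => -[|n]; rewrite /= coef1 ?scale1r ?scale0r //.
exact: (esym Hconst_gen).
Qed.

End ChainMaps.
End Main.

Theorem mainTheorem2 (k : fieldType) (char2 : 2%N \in [pchar k]) :
  inhabited (inj_res (kG_mod_N k)) /\
  (exists E : ses (kG_mod_N k) (kG_mod_T k) (kG_mod_N k), is_calE E) /\
  forall J : inj_res (kG_mod_N k),
    (forall i : nat, exists u : {linear Hn J i -> k^o}, bijective u) /\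
    (forall E : ses (kG_mod_N k) (kG_mod_T k) (kG_mod_N k), is_calE E ->
      forall i : nat, (1 <= i)%N ->
      exists x : Hn J i,
        (forall y : Hn J i,
           yoneda_class E (const_hom (normalizer (torus k))) y <-> y = x) /\
        (forall y : Hn J i, exists c : k, y = c *: x)) /\
    inhabited (pairing (@kGmod_mul k (normalizer (torus k))) J) /\
    (forall P : pairing (@kGmod_mul k (normalizer (torus k))) J,
      exists phi : {linear {poly k} -> Hstar J},
        [/\ bijective phi,
            phi 1 = Hconst J (kGmod_one_invariant (normalizer (torus k))),
            (forall p q : {poly k}, phi (p * q) = Hmul P (phi p) (phi q))
          & (forall n : nat, n <> 1%N -> phi 'X n = 0)]).
Proof.
have cE := calE_is_calE char2.
split; first by constructor; exact: (per_res (calE char2)).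
split; first by exists (calE char2).
move=> J.
have [F [F0 FS]] := comparison (per_res (calE char2)) J.
have [G [G0 GS]] := comparison J (per_res (calE char2)).
split; first exact: (Hn_one_dimensional cE F0 G0 FS GS).
split=> [E EE i _|].
  have [F' [F0' FS']] := comparison (per_res E) J.
  have [G' [G0' GS']] := comparison J (per_res E).
  exists (gen EE FS' i); split=> y.
    exact: (yoneda_class_gen EE F0' FS' y).
  exact: (gen_span EE F0' G0' FS' GS' y).
split=> [|P].
  constructor; exact: (transport (per_pairing char2 cE) G0 F0 GS FS).
exists (mklin (@poly_class_linear k _ cE J F FS)); split.
- exact: (poly_class_bij cE F0 G0 FS GS).
- exact: (poly_class1 cE F0 FS).
- exact: (poly_classM char2 cE F0 G0 FS GS P).
by move=> n n1; rewrite /= coefX; case: eqP => // _; rewrite scale0r.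
Qed.
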